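(* Let $A$ be a valuation ring with maximal ideal $\mathfrak m$ and residue field $k$, with $2\in A^\times$, and let $K$ be its quotient field. Let $O_\infty(A)=\varinjlim_n O_n(A)$ (colimit along $f\mapsto f\oplus\mathrm{id}_A$) and let $M$ be an $O_\infty(A)$-module on which the commutator subgroup of $O_\infty(A)$ acts trivially; regard $M$ as an $O_n(A)$-module via the canonical map $O_n(A)\to O_\infty(A)$. Consider the map $$H_i(O_n(A);M)\to H_i(O_{n+1}(A);M)$$ induced by $O_n(A)\to O_{n+1}(A)$, $f\mapsto f\oplus\mathrm{id}_A$. Then this map is (i) a surjection for $i\leq\frac{n-m_A-2}{3}$ and an isomorphism for $i\leq\frac{n-m_A-4}{3}$ if $m_A<\infty$; (ii) a surjection for $i\leq\frac{n-2P(k)-2P(k)-2}{2P(k)+1}$ and an isomorphism for $i\leq\frac{n-2P(k)-2P(k)-4}{2P(k)+1}$ if $A$ is henselian and $P(k)<\infty$; (iii) a surjection for $i\leq\frac{n-P(k)-\max\{3,P(k)+1\}}{\max\{3,P(k)+1\}}$ and an isomorphism for $i\leq\frac{n-P(k)-2-\max\{3,P(k)+1\}}{\max\{3,P(k)+1\}}$ if $k$ is formally real, $A$ is henselian, and $P(k)<\infty$; (iv) a surjection for $i\leq\frac{n-m_K-2}{3}$ and an isomorphism for $i\leq\frac{n-m_K-4}{3}$ if $m_K<\infty$; (v) a surjection for $i\leq\frac{n-2P(K)-2P(K)-2}{2P(K)+1}$ and an isomorphism for $i\leq\frac{n-2P(K)-2P(K)-4}{2P(K)+1}$ if $P(K)<\infty$;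 (vi) a surjection for $i\leq\frac{n-P(K)-\max\{3,P(K)+1\}}{\max\{3,P(K)+1\}}$ and an isomorphism for $i\leq\frac{n-P(K)-2-\max\{3,P(K)+1\}}{\max\{3,P(K)+1\}}$ if $K$ is formally real and $P(K)<\infty$.
   Context: A quadratic module over a commutative ring $R$ is a pair $(V,q)$ with $V$ a finitely generated projective $R$-module and $q:V\to R$ with $q(ax)=a^2q(x)$ and $B_q(x,y)=q(x+y)-q(x)-q(y)$ bilinear; non-singular means $x\mapsto B_q(x,-)$ is an isomorphism $V\to\mathrm{Hom}_R(V,R)$. A quadratic submodule is a direct summand with the restricted form. $\mathbb E^n_R=(R^n,x_1^2+\dots+x_n^2)$; $O_n(R)$ is its group of form-preserving $R$-linear automorphisms. A unit vector is $v$ with $q(v)=1$. For a local ring $A$ with maximal ideal $\mathfrak m$ and residue field $k$, $m_A\in\mathbb Z_{\geq1}\cup\{\infty\}$ is the smallest $m$ such that every non-singular quadratic submodule $V$ of some $\mathbb E^n_A$ with $\dim_k V/\mathfrak mV\geq m$ contains a unit vector; for a field $K$, $m_K$ is this with $A=K$. $P(R)$ (Pythagoras number) is the smallest $p\geq1$ such that every sum of squares in $R$ is a sum of $p$ squares ($\infty$ if none). A field is formally real if $-1$ is not a sum of squares. A local ring $A$ with residue field $k$ is henselian if simple roots in $k$ of reductions of polynomials $f\in A[X]$ lift to roots of $f$ in $A$. A valuation ring is a domain $A$ with fraction field $K$ such that $x\in A$ or $x^{-1}\in A$ for all $x\in K^\times$. *)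

(* Defs.v *)
From HB Require Import structures.
From mathcomp Require Import all_boot all_order all_algebra.
Set Implicit Arguments. Unset Strict Implicit. Unset Printing Implicit Defensive.
Import Order.TTheory GRing.Theory Num.Theory.
Local Open Scope ring_scope.

Definition qE (R : comUnitRingType) n (x : 'rV[R]_n) : R := \sum_(j < n) x 0 j ^+ 2.
Definition bE (R : comUnitRingType) n (x y : 'rV[R]_n) : R := qE (x + y) - qE x - qE y.

(* maximal ideal of a local ring = its non-units *)
Definition maxid (R : comUnitRingType) (a : R) : Prop := a \isn't a GRing.unit.

Definition submod (R : comUnitRingType) n (V : 'rV[R]_n -> Prop) : Prop :=
  V 0 /\ (forall x y, V x -> V y -> V (x + y)) /\ (forall a x, V x -> V (a *: x)).

Definition direct_summand (R : comUnitRingType) n (V : 'rV[R]_n -> Prop) : Prop :=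
  submod V /\ exists W : 'rV[R]_n -> Prop, submod W /\
    (forall x, V x -> W x -> x = 0) /\ (forall z, exists x y, V x /\ W y /\ z = x + y).

Definition nonsingular (R : comUnitRingType) n (V : 'rV[R]_n -> Prop) : Prop :=
  forall phi : 'rV[R]_n -> R,
    (forall x y, V x -> V y -> phi (x + y) = phi x + phi y) ->
    (forall a x, V x -> phi (a *: x) = a * phi x) ->
    exists! x, V x /\ forall y, V y -> bE x y = phi y.

Definition mV (R : comUnitRingType) n (V : 'rV[R]_n -> Prop) (x : 'rV[R]_n) : Prop :=
  exists (p : nat) (a : 'I_p -> R) (u : 'I_p -> 'rV[R]_n),
    (forall j, maxid (a j) /\ V (u j)) /\ x = \sum_j a j *: u j.

(* dim_k V/mV >= m : there are m elements of V with k-linearly independent images in V/mV *)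
Definition res_dim_ge (R : comUnitRingType) n (V : 'rV[R]_n -> Prop) (m : nat) : Prop :=
  exists v : 'I_m -> 'rV[R]_n, (forall j, V (v j)) /\
    forall a : 'I_m -> R, mV V (\sum_j a j *: v j) -> forall j, maxid (a j).

Definition unit_vec_prop (R : comUnitRingType) (m : nat) : Prop :=
  forall (n : nat) (V : 'rV[R]_n -> Prop),
    direct_summand V -> nonsingular V -> res_dim_ge V m ->
    exists v, V v /\ qE v = 1.

(* m_R = m  (m_R < oo) ; R is meant to be local (a local ring or a field) *)
Definition m_is (R : comUnitRingType) (m : nat) : Prop :=
  (1 <= m)%N /\ unit_vec_prop R m /\
  forall m', (1 <= m')%N -> unit_vec_prop R m' -> (m <= m')%N.

Definition sum_sq (R : comUnitRingType) (p : nat) (x : R) : Prop :=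
  exists v : 'I_p -> R, x = \sum_j v j ^+ 2.
Definition is_sos (R : comUnitRingType) (x : R) : Prop := exists p, sum_sq p x.
Definition pyth_is (R : comUnitRingType) (p : nat) : Prop :=
  (1 <= p)%N /\ (forall x : R, is_sos x -> sum_sq p x) /\
  forall p', (1 <= p')%N -> (forall x : R, is_sos x -> sum_sq p' x) -> (p <= p')%N.
Definition formally_real (F : fieldType) : Prop := ~ is_sos (-1 : F).

Definition valuation_ring (A : idomainType) (K : fieldType) (iota : {rmorphism A -> K}) : Prop :=
  injective iota /\
  (forall x : K, exists a b, b != 0 /\ x = iota a / iota b) /\
  (forall x : K, x != 0 -> (exists a, x = iota a) \/ (exists a, x^-1 = iota a)).

Definition residue_field (A : idomainType) (k : fieldType) (pi : {rmorphism A -> k}) : Prop :=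
  (forall y : k, exists a, pi a = y) /\ (forall a, pi a = 0 <-> maxid a).

Definition henselian (A : idomainType) (k : fieldType) (pi : {rmorphism A -> k}) : Prop :=
  forall (f : {poly A}) (a0 : k),
    root (map_poly pi f) a0 -> ~~ root (map_poly pi f)^`() a0 ->
    exists a, root f a /\ pi a = a0.

Definition orth (R : comUnitRingType) n (f : 'M[R]_n) : Prop :=
  f \in unitmx /\ forall x : 'rV[R]_n, qE (x *m f) = qE x.

Definition stab (R : comUnitRingType) n (f : 'M[R]_n) : 'M[R]_(n + 1) :=
  block_mx f 0 0 (1%:M : 'M[R]_1).

Record GroupData := GD {
  gT : eqType; gmul : gT -> gT -> gT; ginv : gT -> gT; gone : gT; gmem : gT -> Prop }.

Definition Ogrp (R : comUnitRingType) n : GroupData :=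
  @GD 'M[R]_n mulmx invmx 1%:M (@orth R n).

Section Bar.
Variables (G : GroupData) (M : zmodType) (act : gT G -> M -> M).

(* a chain is a finite formal sum of terms m [g_1|...|g_i] *)
Definition chain := seq (seq (gT G) * M).
Definition coef (c : chain) (s : seq (gT G)) : M := \sum_(p <- c | p.1 == s) p.2.

Definition face (s : seq (gT G)) (j : nat) : seq (gT G) :=
  if j == size s then take j.-1 s
  else take j.-1 s ++ @gmul G (nth (@gone G) s j.-1) (nth (@gone G) s j) :: drop j.+1 s.
Definition sgn (j : nat) (m : M) : M := if odd j then - m else m.

Definition bd_term (p : seq (gT G) * M) : chain :=
  match p.1 with
  | [::] => [::]
  | g :: r => (r, act (@ginv G g) p.2) :: [seq (face p.1 j, sgn j p.2) | j <- iota 1 (size p.1)]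
  end.
Definition bd (c : chain) : chain := flatten (map bd_term c).

Definition in_deg (i : nat) (c : chain) : Prop :=
  forall p, p \in c -> size p.1 = i /\ forall g, g \in p.1 -> @gmem G g.
Definition is_cycle (c : chain) : Prop := forall s, coef (bd c) s = 0.
End Bar.

Definition mapc (G1 G2 : GroupData) (M : zmodType) (phi : gT G1 -> gT G2) (c : chain G1 M)
  : chain G2 M := [seq (map phi p.1, p.2) | p <- c].
Definition negc (G : GroupData) (M : zmodType) (c : chain G M) : chain G M :=
  [seq (p.1, - p.2) | p <- c].

Section Induced.
Variables (G1 G2 : GroupData) (M : zmodType) (act1 : gT G1 -> M -> M) (act2 : gT G2 -> M -> M)
  (phi : gT G1 -> gT G2).

Definition Hsurj (i : nat) : Prop :=
  forall c2 : chain G2 M, in_deg i c2 -> is_cycle act2 c2 ->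
  exists c1 : chain G1 M, in_deg i c1 /\ is_cycle act1 c1 /\
    exists b : chain G2 M, in_deg i.+1 b /\
      forall s, coef (bd act2 b) s = coef (mapc phi c1 ++ negc c2) s.

Definition Hinj (i : nat) : Prop :=
  forall c1 : chain G1 M, in_deg i c1 -> is_cycle act1 c1 ->
  (exists b : chain G2 M, in_deg i.+1 b /\ forall s, coef (bd act2 b) s = coef (mapc phi c1) s) ->
  exists b : chain G1 M, in_deg i.+1 b /\ forall s, coef (bd act1 b) s = coef c1 s.
End Induced.

Section Stab.
Variables (A : comUnitRingType) (M : zmodType) (act : forall n : nat, 'M[A]_n -> M -> M).

(* compatible family of O_n(A)-actions = an O_oo(A)-module *)
Definition Oinf_module : Prop :=
  forall n : nat,
    (forall f x y, orth f -> @act n f (x + y) = @act n f x + @act n f y) /\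
    (forall x, @act n 1%:M x = x) /\
    (forall f g x, orth f -> orth g -> @act n (f *m g) x = @act n f (@act n g x)) /\
    (forall f x, orth f -> @act (n + 1) (stab f) x = @act n f x).

Definition comm_trivial : Prop :=
  forall n (f g : 'M[A]_n) x, orth f -> orth g ->
    @act n (invmx f *m invmx g *m f *m g) x = x.

Definition stab_surj (n i : nat) : Prop :=
  @Hsurj (Ogrp A n) (Ogrp A (n + 1)) M (@act n) (@act (n + 1)) (@stab A n) i.
Definition stab_iso (n i : nat) : Prop :=
  stab_surj n i /\ @Hinj (Ogrp A n) (Ogrp A (n + 1)) M (@act n) (@act (n + 1)) (@stab A n) i.
End Stab.

(* Main.v *)
(* Let [O_N(A)] act on the complex of orthonormal frames whose simplices are words of
   pairwise orthogonal unit vectors.  Suppose that any [k] vectors of [A^l] have a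
   common orthogonal unit vector as soon as [l >= s k + c].  Filtering words by the
   prefix up to the last letter not orthogonal to a fixed unit vector [v], and then
   coning off with [v], shows that words in [A^n] are acyclic in all lengths [d] with
   [(s + 1) d + c <= n].  The group acts transitively on frames of given length, with
   smaller orthogonal groups as stabilisers, so in the double complex of bar chains
   and frames Shapiro's lemma identifies the columns; the faces of a frame differ by
   commutators of reflections, which act trivially on [M].  The usual zigzag in this
   double complex gives stability of slope [s + 1].

   It remains to find the unit vectors.  Over a valuation ring the given vectors may be
   replaced by a basis [G] of the saturation of their span.  For [m_A], a symmetric
   matrix of rank [t] has an invertible congruent minor of size [t], so the orthogonal
   complement of [G] contains a non-singular submodule of rank at least [l - 2 k]; hence
   [s = 2], [c = m].  For [m_K], a unit vector over [K] is made integral by one explicit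
   reflection.  For Pythagoras number [p], an induction that uses Witt extension and
   rewrites sums of squares with [max(2, p)] squares moves [G] into the first
   [k max(2, p) + 1] coordinates, leaving a free basis vector; hence [s = max(2, p)],
   [c = 4].  In the henselian case this is done over [k], and the unit vector is lifted
   by extracting a square root. *)
Require Import Defs.
From HB Require Import structures.
From mathcomp Require Import all_boot all_order all_algebra.
From mathcomp Require Import perm finmap.
From mathcomp.multinomials Require Import monalg.
From mathcomp Require Import zify ring.
Import Order.TTheory GRing.Theory Num.Theory.
Set Implicit Arguments. Unset Strict Implicit. Unset Printing Implicit Defensive.
Local Open Scope ring_scope.

(** A prefix letter costs one dimension: it extends an orthonormal frame, and an orthogonal change
    of coordinates makes that frame standard. The coning vector [v] costs [s]: it need not be
    orthogonal to the prefix, so it only joins the list of vectors to be orthogonal to. As each step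
    shortens the words by at least one letter, the slope is [s + 1].

    Different ranks have to be compared inside one complex. So all [O_m] with [m <= N] are realised
    in [O_N] as stabilisers of the last [N - m] basis vectors, and matrix sizes change only in the
    final translation. No spectral sequence is formed; its pages occur as statements about elements
    of the double complex.

    A transposition of two basis vectors already carries a face of the standard frame to the next,
    but may act non-trivially on [M]. A 3-cycle is a commutator of reflections, and its spare vector
    costs one more dimension.

    For sums of squares the obstacle is that pushing a vector into few coordinates can destroy
    linear independence modulo the maximal ideal, on which Witt extension rests. A unit square is
    then traded for a correction that restores independence. *)

(* Reflection for identities in a [zmodType], where [ring] does not apply. *)
Inductive zexpr := ZVar of nat | ZAdd of zexpr & zexpr | ZOpp of zexpr | ZNil.

Fixpoint zeval (V : zmodType) (env : seq V) (e : zexpr) : V :=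
  match e with
  | ZVar i => env`_i
  | ZAdd a b => zeval env a + zeval env b
  | ZOpp a => - zeval env a
  | ZNil => 0
  end.

Fixpoint zcoef (e : zexpr) (i : nat) : int :=
  match e with
  | ZVar j => (i == j)%:R
  | ZAdd a b => zcoef a i + zcoef b i
  | ZOpp a => - zcoef a i
  | ZNil => 0
  end.

Lemma zevalE (V : zmodType) (env : seq V) e :
  zeval env e = \sum_(i < size env) env`_i *~ zcoef e i.
Proof.
elim: e => [j|a IHa b IHb|a IHa|] /=.
- have [lt_j|ge_j] := ltnP j (size env).
    rewrite (bigD1 (Ordinal lt_j)) //= eqxx big1 ?addr0 // => i /negbTE ij.
    by rewrite -val_eqE /= in ij; rewrite ij.
  rewrite nth_default // big1 // => i _.
  by have /ltn_eqF -> := leq_trans (ltn_ord i) ge_j.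
- by rewrite IHa IHb -big_split; apply: eq_bigr => i _; rewrite mulrzDr.
- by rewrite IHa -sumrN; apply: eq_bigr => i _; rewrite mulrNz.
- by rewrite big1.
Qed.

Lemma zmod_sound (V : zmodType) (env : seq V) e f :
  all (fun i => zcoef e i == zcoef f i) (iota 0 (size env)) -> zeval env e = zeval env f.
Proof.
move=> /allP h; rewrite !zevalE; apply: eq_bigr => i _; congr (_ *~ _).
by apply/eqP/h; rewrite mem_iota add0n ltn_ord.
Qed.

Ltac zmem x env :=
  lazymatch env with
  | nil => constr:(false)
  | cons ?y ?t => match constr:(Set) with
                  | _ => let _ := match constr:(Set) with _ => first [constr_eq x y | unify x y] end in constr:(true)
                  | _ => zmem x t end
  end.
Ltac zadd x env :=
  let b := zmem x env in
  lazymatch b with true => env | false => constr:(cons x env) end.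
Ltac zidx x env :=
  lazymatch env with
  | cons ?y ?t => match constr:(Set) with
                  | _ => let _ := match constr:(Set) with _ => first [constr_eq x y | unify x y] end in constr:(O)
                  | _ => let n := zidx x t in constr:(S n) end
  end.
Ltac zvars t env :=
  lazymatch t with
  | (?a + ?b)%R => let e := zvars a env in zvars b e
  | (- ?a)%R => zvars a env
  | (@GRing.zero _)%R => env
  | _ => zadd t env
  end.
Ltac zreify t env :=
  lazymatch t with
  | (?a + ?b)%R => let x := zreify a env in let y := zreify b env in constr:(ZAdd x y)
  | (- ?a)%R => let x := zreify a env in constr:(ZOpp x)
  | (@GRing.zero _)%R => constr:(ZNil)
  | _ => let i := zidx t env in constr:(ZVar i)
  end.
Ltac zmod :=
  lazymatch goal with
  | |- @eq ?T ?l ?r =>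
    let env := zvars l (@nil T) in
    let env := zvars r env in
    let el := zreify l env in
    let er := zreify r env in
    exact: (@zmod_sound _ env el er isT)
  end.

(** * Finitely supported chains *)

(* Locked so that unification never unfolds finitely supported functions. *)
HB.lock Definition gen (K : choiceType) (M : zmodType) (k : K) (m : M) : {malg M[K]} :=
  << m *g k >>.
Notation "<< z *g k >>" := (gen k z) : ring_scope.

Section Gen.
Variables (K : choiceType) (M : zmodType).
Implicit Types (k : K) (m : M).
Lemma genB k : {morph @gen K M k : x y / x - y}.
Proof. by move=> x y; rewrite !gen.unlock monalgUB. Qed.
Lemma genN k : {morph @gen K M k : x / - x}.
Proof. by move=> x; rewrite !gen.unlock monalgUN. Qed.
Lemma coef_gen k m k' : << m *g k >>@_k' = m *+ (k == k').
Proof. by rewrite gen.unlock mcoeffU. Qed.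
Lemma supp_gen k m : (msupp << m *g k >> `<=` [fset k])%fset.
Proof. by rewrite gen.unlock msuppU_le. Qed.
Lemma gen_sum (z : {malg M[K]}) : z = \sum_(k <- msupp z) << z@_k *g k >>.
Proof. by rewrite gen.unlock; exact: monalgE. Qed.
End Gen.

Definition zlin (U V : zmodType) (f : U -> V) := forall x y, f (x - y) = f x - f y.

Section ZLinear.
Variables (U V : zmodType) (f : U -> V).
Hypothesis fB : zlin f.
Lemma zlin0 : f 0 = 0. Proof. by rewrite -(subrr 0) fB subrr. Qed.
Lemma zlinN x : f (- x) = - f x. Proof. by rewrite -sub0r fB zlin0 sub0r. Qed.
Lemma zlinD x y : f (x + y) = f x + f y.
Proof. by rewrite -[y in LHS]opprK fB zlinN opprK. Qed.
Lemma zlin_sum (I : Type) (r : seq I) (P : pred I) (F : I -> U) :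
  f (\sum_(i <- r | P i) F i) = \sum_(i <- r | P i) f (F i).
Proof. by elim/big_rec2: _ => [|i a b _ <-]; [exact: zlin0|rewrite zlinD]. Qed.
End ZLinear.

Lemma zlin_id (U : zmodType) : zlin (@id U). Proof. by []. Qed.
Lemma zlin_comp (U V W : zmodType) (f : V -> W) (g : U -> V) :
  zlin f -> zlin g -> zlin (fun x => f (g x)).
Proof. by move=> hf hg x y; rewrite hg hf. Qed.
Lemma zlin_sub (U V : zmodType) (f g : U -> V) :
  zlin f -> zlin g -> zlin (fun x => f x - g x).
Proof. by move=> hf hg x y; rewrite hf hg !opprD !opprK addrACA. Qed.
Lemma zlin_opp (U V : zmodType) (f : U -> V) : zlin f -> zlin (fun x => - f x).
Proof. by move=> hf x y; rewrite hf opprD. Qed.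
Lemma zlin_add (U V : zmodType) (f g : U -> V) :
  zlin f -> zlin g -> zlin (fun x => f x + g x).
Proof. by move=> hf hg x y; rewrite hf hg opprD addrACA. Qed.
Lemma zlin_0 (U V : zmodType) : zlin (fun _ : U => 0 : V).
Proof. by move=> x y; rewrite subrr. Qed.
Lemma zlin_U (K : choiceType) (M : zmodType) (k : K) : zlin (fun m : M => << m *g k >>).
Proof. by move=> x y; rewrite genB. Qed.

HB.lock Definition ext (K : choiceType) (M B : zmodType) (F : K -> M -> B) (z : {malg M[K]}) : B :=
  \sum_(k <- msupp z) F k z@_k.

Section Ext.
Variables (K : choiceType) (M B : zmodType).
Definition sup (S : K -> Prop) (z : {malg M[K]}) := forall k, z@_k != 0 -> S k.

Lemma sup0 S : sup S 0. Proof. by move=> k; rewrite mcoeff0 eqxx. Qed.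
Lemma supN S z : sup S z -> sup S (- z).
Proof. by move=> h k; rewrite mcoeffN oppr_eq0; apply: h. Qed.
Lemma supD S z w : sup S z -> sup S w -> sup S (z + w).
Proof.
move=> h1 h2 k; rewrite mcoeffD; case: (eqVneq z@_k 0) => [->|/h1 //].
by rewrite add0r; apply: h2.
Qed.
Lemma supB S z w : sup S z -> sup S w -> sup S (z - w).
Proof. by move=> h1 h2; apply: supD => //; apply: supN. Qed.
Lemma supU (S : K -> Prop) k m : S k -> sup S << m *g k >>.
Proof. by move=> h k'; rewrite coef_gen; case: (eqVneq k k') => [<-//|_]; rewrite mulr0n eqxx. Qed.
Lemma sup_sum S (I : eqType) (r : seq I) (P : pred I) (F : I -> {malg M[K]}) :
  (forall i, i \in r -> P i -> sup S (F i)) -> sup S (\sum_(i <- r | P i) F i).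
Proof.
move=> h; rewrite big_seq_cond; elim/big_rec: _ => [|i z /andP[ir Pi] hz]; first exact: sup0.
by apply: supD hz; apply: h.
Qed.
Lemma sup_imp (S S' : K -> Prop) z : (forall k, S k -> S' k) -> sup S z -> sup S' z.
Proof. by move=> h hz k /hz /h. Qed.

Variable F : K -> M -> B.
Hypothesis FB : forall k, zlin (F k).

Lemma ext_big (d : {fset K}) (z : {malg M[K]}) : (msupp z `<=` d)%fset ->
  ext F z = \sum_(k <- d) F k z@_k.
Proof.
move=> le; rewrite ext.unlock (big_fsetID _ (mem (msupp z)) d) /=.
rewrite [X in _ = _ + X]big1_fset ?addr0; last first.
  by move=> k; rewrite !inE /= => /andP[_ h] _; rewrite mcoeff_outdom // zlin0.
apply: eq_fbigl => k; rewrite !inE /=; apply/idP/idP => [h|/andP[]//].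
by rewrite h (fsubsetP le).
Qed.

Lemma extU k m : ext F << m *g k >> = F k m.
Proof. by rewrite (ext_big (supp_gen _ _)) big_seq_fset1 coef_gen eqxx. Qed.

Lemma extB : zlin (ext F).
Proof.
move=> x y; pose d := (msupp x `|` msupp y)%fset.
rewrite (@ext_big d) ?msuppB_le // (@ext_big d x) ?fsubsetUl //.
rewrite (@ext_big d y) ?fsubsetUr // -sumrB; apply: eq_bigr => k _.
by rewrite mcoeffB FB.
Qed.
End Ext.

Lemma gen_eq (K : choiceType) (M B : zmodType) (S : K -> Prop) (f g : {malg M[K]} -> B) :
  zlin f -> zlin g -> (forall k m, S k -> f << m *g k >> = g << m *g k >>) ->
  forall z, sup S z -> f z = g z.
Proof.
move=> hf hg h z hz; rewrite (gen_sum z) !zlin_sum //.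
by rewrite !big_seq; apply: eq_bigr => k kz; apply/h/hz; rewrite mcoeff_neq0.
Qed.
Lemma gen_eqT (K : choiceType) (M B : zmodType) (f g : {malg M[K]} -> B) :
  zlin f -> zlin g -> (forall k m, f << m *g k >> = g << m *g k >>) -> forall z, f z = g z.
Proof. by move=> hf hg h z; apply: (@gen_eq _ _ _ (fun _ => True)). Qed.

Lemma ext_sup (K K' : choiceType) (M M' : zmodType) (S : K -> Prop) (S' : K' -> Prop)
   (F : K -> M -> {malg M'[K']}) z :
  (forall k m, S k -> sup S' (F k m)) -> sup S z -> sup S' (ext F z).
Proof. by rewrite ext.unlock => h hz; apply: sup_sum => k kz _; apply/h/hz; rewrite mcoeff_neq0. Qed.

Definition kmap (K K' : choiceType) (M : zmodType) (f : K -> K') : {malg M[K]} -> {malg M[K']} :=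
  ext (fun k m => << m *g f k >>).

Section KMap.
Variables (K K' : choiceType) (M : zmodType) (f : K -> K').
Lemma kmapU k (m : M) : kmap f << m *g k >> = << m *g f k >>.
Proof. by rewrite /kmap extU // => x; apply: zlin_U. Qed.
Lemma kmapB : zlin (@kmap K K' M f). Proof. by apply: extB => k; apply: zlin_U. Qed.
Lemma kmap_sup (S : K -> Prop) (S' : K' -> Prop) (z : {malg M[K]}) :
  (forall k, S k -> S' (f k)) -> sup S z -> sup S' (kmap f z).
Proof. by move=> h; apply: ext_sup => k m /h Sk; apply: supU. Qed.
End KMap.
Arguments kmapB {K K' M} f.

Definition sg (V : zmodType) (n : nat) (z : V) : V := if odd n then - z else z.
Lemma zlin_sg (U V : zmodType) (f : U -> V) n : zlin f -> zlin (fun x => sg n (f x)).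
Proof. by move=> hf x y; rewrite /sg; case: odd; rewrite hf // opprD. Qed.
Lemma sgK (V : zmodType) n : involutive (@sg V n).
Proof. by move=> z; rewrite /sg; case: odd; rewrite ?opprK. Qed.
Lemma sup_sg (K : choiceType) (M : zmodType) (S : K -> Prop) n (z : {malg M[K]}) :
  sup S z -> sup S (sg n z).
Proof. by rewrite /sg; case: odd => // /supN. Qed.

(** * Complexes of words *)

Section Words.
Variables (L : choiceType) (M : zmodType).
Local Notation C := {malg M[seq L]}.

(** The alternating sum of letter deletions, in recursive form so that coning is immediate. The
    empty word is a generator, hence the complex is augmented. *)
Fixpoint fd (w : seq L) (m : M) : C :=
  if w is v :: r then << m *g r >> - kmap (cons v) (fd r m) else 0.

Lemma zlin_fd w : zlin (fd w).
Proof.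
elim: w => [|v r IH] /=; first exact: zlin_0.
by apply: zlin_sub; [exact: zlin_U|apply: zlin_comp => //; exact: kmapB].
Qed.

Definition dl : C -> C := ext fd.
Lemma zlin_dl : zlin dl. Proof. exact: extB zlin_fd. Qed.
Lemma dlU w m : dl << m *g w >> = fd w m. Proof. exact: extU zlin_fd _ _. Qed.

(** Prepending [v] is a contracting homotopy on all words to which [v] may be prepended. *)
Lemma dl_cons v z : dl (kmap (cons v) z) = z - kmap (cons v) (dl z).
Proof.
move: z; apply: gen_eqT => [||w m].
- by apply: zlin_comp; [exact: zlin_dl|exact: kmapB].
- by apply: zlin_sub => //; apply: zlin_comp; [exact: kmapB|exact: zlin_dl].
- by rewrite kmapU !dlU.
Qed.

Lemma dl_dl z : dl (dl z) = 0.
Proof.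
move: z; apply: gen_eqT => [||w m]; first by apply: zlin_comp; exact: zlin_dl.
  exact: zlin_0.
rewrite dlU; elim: w => [|v r IH] /=; first exact: zlin0 zlin_dl.
by rewrite zlin_dl dlU dl_cons IH (zlin0 (kmapB _)) subr0 subrr.
Qed.

Lemma fd_sup w m : sup (fun w' => subseq w' w /\ (size w').+1 = size w) (fd w m).
Proof.
elim: w => [|v r IH] /=; first exact: sup0.
apply: supB; first by apply: supU; split => //; exact: subseq_cons.
by apply: kmap_sup IH => w' [h1 h2] /=; rewrite eqxx h1 h2.
Qed.

Lemma fd_cat p y m :
  fd (p ++ y) m = kmap (fun q => q ++ y) (fd p m) + sg (size p) (kmap (cat p) (fd y m)).
Proof.
have id_kmap (z : C) : kmap (cat [::]) z = z.
  by move: z; apply: gen_eqT => [||w n]; [exact: kmapB|exact: zlin_id|rewrite kmapU].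
elim: p => [|v p IH] /=; first by rewrite (zlin0 (kmapB _)) add0r /sg /= id_kmap.
rewrite IH [RHS]/= (kmapB (fun q => q ++ y)) kmapU (zlinD (kmapB (cons v))) opprD addrA; congr (_ - _ + _).
  move: (fd p m); apply: gen_eqT => [||w n]; try by apply: zlin_comp; exact: kmapB.
  by rewrite !kmapU.
have E z : kmap (cons v) (kmap (cat p) z) = kmap (cat (v :: p)) z :> C.
  move: z; apply: gen_eqT => [||w n]; [apply: zlin_comp; exact: kmapB|exact: kmapB|].
  by rewrite !kmapU.
rewrite /sg /=; case: (odd _) => /=; last by rewrite E.
by rewrite (zlinN (kmapB _)) opprK E.
Qed.

Variable R : rel L.
Definition valid (P : pred L) (w : seq L) := all P w && pairwise R w.
Definition acyc (P : pred L) (d : nat) :=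
  forall a (z : C), (a <= d)%N -> sup (fun w => valid P w /\ size w = a) z -> dl z = 0 ->
  exists2 z' : C, sup (fun w => valid P w /\ size w = a.+1) z' & dl z' = z.
Definition perpp (P : pred L) (v : L) (p : seq L) : pred L :=
  [pred l | [&& P l, R v l & all (fun q => R q l) p]].

Lemma valid_sub (P : pred L) w w' : subseq w' w -> valid P w -> valid P w'.
Proof.
move=> h /andP[h1 h2]; apply/andP; split.
  by apply/allP => x /(mem_subseq h); move/allP: h1; apply.
exact: subseq_pairwise h _.
Qed.

Lemma valid_cat P v p y :
  valid P (p ++ y) && all (R v) y = valid P p && valid (perpp P v p) y.
Proof.
rewrite /valid all_cat pairwise_cat /perpp.
have -> : all [pred l | [&& P l, R v l & all (fun q => R q l) p]] y =
          [&& all P y, all (R v) y & allrel R p y].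
  rewrite allrelC /allrel -!all_predI; apply: eq_all => l /=.
  by congr [&& _, _ & _].
case: (all P p) => //=; case: (all P y) => //=; case: (all _ y); rewrite ?andbF ?andbT //=.
by case: allrel; rewrite ?andbT ?andbF.
Qed.

(* Words are filtered by the length of their prefix up to the last letter not
   orthogonal to [v]; fixing such a prefix [p], the rest runs over [perpp P v p]. *)
Lemma acyc_step (P : pred L) (d : nat) (v : L) : P v ->
  (forall p, valid P p -> (0 < size p <= d)%N -> acyc (perpp P v p) (d - size p)) ->
  acyc P d.
Proof.
move=> Pv IHd a z le_ad.
(* [T j] is the filtration: letters from position [j] on are orthogonal to [v]. [T a] imposes
   nothing, and on [T 0] coning with [v] fills the cycle. *)
pose T j w := [/\ valid P w, size w = a & all (R v) (drop j w)].
suff main j : forall z : C, sup (T j) z -> dl z = 0 ->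
    exists2 z' : C, sup (fun w => valid P w /\ size w = a.+1) z' & dl z' = z.
  move=> hz; apply: (main a); apply: sup_imp hz => w [h1 h2]; split => //.
  by rewrite drop_oversize ?h2.
elim: j => {z} [|j IHj] z hz dz.
  exists (kmap (cons v) z); last by rewrite dl_cons dz (zlin0 (kmapB _)) subr0.
  apply: kmap_sup hz => w [/andP[h1 h2] h3]; rewrite drop0 => h4; split; last by rewrite /= h3.
  by rewrite /valid /= Pv h1 h2 h4.
have [le_aj|lt_ja] := leqP a j.
  apply: IHj dz; apply: sup_imp hz => w [h1 h2 _]; split => //.
  by rewrite drop_oversize ?h2.
set J := j.+1 in hz *.
pose pr p : C -> C := ext (fun w m => if take J w == p then << m *g drop J w >> else 0).
have prB p : zlin (pr p).
  by apply: extB => w; case: eqP => _; [exact: zlin_U|exact: zlin_0].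
have prU p w m : pr p << m *g w >> = if take J w == p then << m *g drop J w >> else 0.
  by rewrite /pr extU // => w'; case: eqP => _; [exact: zlin_U|exact: zlin_0].
(* A word in [T J] but not in [T j] has a letter at position [j] that is not orthogonal to [v], the
   last letter of its prefix of length [J]. *)
pose bad p := ~~ all (R v) (drop j p).
have pr_out p u : sup (fun w => take J w != p) u -> pr p u = 0.
  move: u; apply: gen_eq => //; first exact: zlin_0.
  by move=> w m /negbTE h; rewrite prU h.
have pr_cat p q u : size q = J -> pr p (kmap (cat q) u) = if q == p then u else 0.
  move=> sq; move: u; apply: gen_eqT => [||w m].
  - by apply: zlin_comp => //; exact: kmapB.
  - by case: (q == p); [exact: zlin_id|exact: zlin_0].
  - by rewrite kmapU prU take_size_cat // drop_size_cat //; case: (q == p).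
have splitw w : T J w -> [/\ size (take J w) = J, w = take J w ++ drop J w &
     valid P (take J w) && valid (perpp P v (take J w)) (drop J w)].
  case=> h1 h2 h3; rewrite size_takel ?h2 // -valid_cat cat_take_drop h1 h3.
  by split.
(* Deleting a letter of the prefix moves a letter of the tail to position [j]. That letter is
   orthogonal to [v], so the face no longer has a bad prefix, and only faces of the tail contribute
   to the component at [p]. *)
have prA p : size p = J -> bad p -> dl (pr p z) = 0.
  move=> sp bp; suff h : pr p (dl z) = sg J (dl (pr p z)).
    by rewrite -(sgK J (dl _)) -h dz (zlin0 (prB p)) /sg; case: odd; rewrite ?oppr0.
  move: (z) hz; apply: gen_eq => [||w m Tw].
  - by apply: zlin_comp => //; exact: zlin_dl.
  - by apply: zlin_sg; apply: zlin_comp => //; exact: zlin_dl.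
  have [sq ew vq] := splitw w Tw; case: Tw => _ _ gy.
  rewrite dlU {1}ew fd_cat (zlinD (prB p)) pr_out; last first.
    apply: kmap_sup (@fd_sup _ _) => q' [_]; rewrite sq => -[sq'].
    apply: contra bp => /eqP <-.
    have -> : drop j (take J (q' ++ drop J w)) = take 1 (drop J w).
      by rewrite -[J in take J (_ ++ _)]add1n -take_drop drop_size_cat.
    by apply/allP => l /mem_take; move/allP: gy; apply.
  rewrite add0r sq prU [sg]lock.
  have -> x : pr p (locked sg _ J x) = locked sg _ J (pr p x).
    by rewrite -lock /sg; case: odd; rewrite // (zlinN (prB p)).
  rewrite pr_cat //; congr (locked sg _ _ _).
  by case: ifP => _; rewrite ?dlU ?(zlin0 zlin_dl).
pose ps := undup [seq take J w | w <- msupp z].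
have psP p : p \in ps -> valid P p /\ size p = J.
  rewrite mem_undup => /mapP[w wz ->].
  have [|sq _ /andP[vq _]] := splitw w; first by apply: hz; rewrite mcoeff_neq0.
  by split.
have T_cat p y : bad p = false -> size p = J -> T J (p ++ y) -> T j (p ++ y).
  move=> /negbFE bp sp [h1 h2]; rewrite drop_size_cat // => h3; split => //.
  by rewrite drop_cat sp ltnS leqnn all_cat bp.
have ex_Z (qs : seq (seq L)) : {subset qs <= ps} -> exists2 Z : C,
    sup (fun w => valid P w /\ size w = a.+1) Z &
    sup (T j) (\sum_(p <- qs | bad p) kmap (cat p) (pr p z) - dl Z).
  elim: qs => [|p qs IHq] sub.
    by exists 0; [exact: sup0|rewrite big_nil (zlin0 zlin_dl) subr0; exact: sup0].
  have [|Z hZ1 hZ2] := IHq; first by move=> q qq; apply: sub; rewrite in_cons qq orbT.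
  rewrite big_cons; case: ifP => [bp|_]; last by exists Z.
  have [vp sp] := psP p (sub p (mem_head _ _)).
  have [|||c hc1 hc2] := IHd p vp _ (a - J)%N (pr p z) _ _ (prA p sp bp).
  - by rewrite sp /= (leq_trans lt_ja).
  - by rewrite sp leq_sub2r.
  - apply: ext_sup hz => w m Tw; case: eqP => [e|_]; last exact: sup0.
    have [sq ew] := splitw w Tw; rewrite e => /andP[_ vy].
    apply: supU; split => //; rewrite size_drop.
    by case: Tw => _ -> _.
  have svalid y : valid (perpp P v p) y /\ size y = (a - J).+1 ->
     [/\ valid P (p ++ y), size (p ++ y) = a.+1 & all (R v) y].
    move=> [h1 h2]; have := valid_cat P v p y; rewrite vp h1 => /andP[h3 h4].
    by split => //; rewrite size_cat sp h2 addnS subnKC.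
  exists (sg J (kmap (cat p) c) + Z).
    apply: supD => //; apply: sup_sg; apply: kmap_sup hc1 => y /svalid[h3 h4 _].
    by split.
  rewrite (zlinD zlin_dl) opprD addrACA; apply: supD => // {hZ1 hZ2 IHq}.
  (* After the tail is filled by [c], only the faces inside [p] survive. They have a prefix of
     length [j] followed by letters orthogonal to [v], hence lie in [T j]. *)
  suff -> : kmap (cat p) (pr p z) - dl (sg J (kmap (cat p) c)) =
       - sg J (ext (fun y m => kmap (fun q => q ++ y) (fd p m)) c).
    apply: supN; apply: sup_sg; apply: ext_sup hc1 => y m /svalid[h3 h4 gy].
    apply: kmap_sup (@fd_sup p m) => q [sq1 sq2]; split.
    + by apply: valid_sub h3; rewrite cat_subseq.
    + by move: h4; rewrite !size_cat -sq2 => -[].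
    + by move: sq2; rewrite sp => -[e]; rewrite drop_size_cat.
  rewrite -hc2.
  have -> : dl (sg J (kmap (cat p) c)) = sg J (dl (kmap (cat p) c)).
    by rewrite /sg; case: odd; rewrite // (zlinN zlin_dl).
  suff -> : dl (kmap (cat p) c) = ext (fun y m => kmap (fun q => q ++ y) (fd p m)) c
      + sg J (kmap (cat p) (dl c)).
    by rewrite /sg; case: odd; rewrite ?opprK ?opprD addrCA subrr addr0.
  have FB y : zlin (fun m => kmap (fun q => q ++ y) (fd p m)).
    by apply: zlin_comp; [exact: kmapB|exact: zlin_fd].
  move: (c); apply: gen_eqT => [||y m].
  - by apply: zlin_comp; [exact: zlin_dl|exact: kmapB].
  - apply: zlin_add; first exact: extB.
    by apply: zlin_sg; apply: zlin_comp; [exact: kmapB|exact: zlin_dl].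
  - by rewrite kmapU !dlU extU // fd_cat sp.
have [Z hZ1 hZ2] := ex_Z ps (fun _ => id).
have ez : z = \sum_(p <- ps) kmap (cat p) (pr p z).
  have h u : sup (fun w => take J w \in ps) u -> u = \sum_(p <- ps) kmap (cat p) (pr p u).
    move: u; apply: gen_eq => [||w m wp]; first exact: zlin_id.
      move=> x y; rewrite -sumrB; apply: eq_bigr => p _.
      by rewrite (prB p) (kmapB _).
    rewrite (bigD1_seq (take J w)) ?undup_uniq //= prU eqxx kmapU cat_take_drop.
    rewrite big1 ?addr0 // => p; rewrite eq_sym => /negbTE h.
    by rewrite prU h (zlin0 (kmapB _)).
  apply: h => w; rewrite mcoeff_neq0 => wz; rewrite mem_undup.
  exact: map_f.
have hT : sup (T j) (z - dl Z).
  rewrite {1}ez (bigID bad) /= addrAC; apply: supD => //.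
  apply: sup_sum => p pp /negbTE nb; have [_ sp] := psP p pp.
  have : sup (fun y => T J (p ++ y)) (pr p z).
    apply: ext_sup hz => w m Tw; case: eqP => [e|_]; last exact: sup0.
    by apply: supU; have [_ ew _] := splitw w Tw; rewrite -e -ew.
  by apply: kmap_sup => y; apply: T_cat.
have [|z'' h1 h2] := IHj _ hT; first by rewrite zlin_dl dz dl_dl subrr.
exists (z'' + Z); first exact: supD.
by rewrite (zlinD zlin_dl) h2 subrK.
Qed.
End Words.

Definition cmap (K : choiceType) (M M' : zmodType) (f : M -> M') : {malg M[K]} -> {malg M'[K]} :=
  ext (fun k m => << f m *g k >>).

Section CMap.
Variables (K : choiceType) (M M' : zmodType) (f : M -> M').
Hypothesis fB : zlin f.
Lemma cmap_genB (k : K) : zlin (fun m => << f m *g k >>).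
Proof. by apply: zlin_comp => //; exact: zlin_U. Qed.
Lemma cmapB : zlin (@cmap K M M' f). Proof. exact: extB cmap_genB. Qed.
Lemma cmapU k m : cmap f << m *g k >> = << f m *g k >> :> {malg M'[K]}.
Proof. exact: extU cmap_genB _ _. Qed.
End CMap.

Lemma cmap_kmap (K K' : choiceType) (M M' : zmodType) (f : M -> M') (h : K -> K') (z : {malg M[K]}) :
  zlin f -> cmap f (kmap h z) = kmap h (cmap f z).
Proof.
move=> fB; move: z; apply: gen_eqT => [||k m].
- by apply: zlin_comp; [exact: cmapB|exact: kmapB].
- by apply: zlin_comp; [exact: kmapB|exact: cmapB].
- by rewrite kmapU !cmapU // kmapU.
Qed.

Lemma kmap_comp (K K' K'' : choiceType) (M : zmodType) (h : K -> K') (h' : K' -> K'') (z : {malg M[K]}) :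
  kmap h' (kmap h z) = kmap (fun k => h' (h k)) z.
Proof.
move: z; apply: gen_eqT => [||k m]; [by apply: zlin_comp; exact: kmapB|exact: kmapB|].
by rewrite !kmapU.
Qed.

(** * Bar complexes of translation groupoids *)

Section Bar.
Variables (G : groupType) (M : zmodType).
Local Notation W := {malg M[seq G]}.

Definition cns (g : G) : W -> W := kmap (cons g).
Lemma cnsB g : zlin (cns g). Proof. exact: kmapB. Qed.
Lemma cnsU g w m : cns g << m *g w >> = << m *g g :: w >>. Proof. exact: kmapU. Qed.

(* The faces of a bar simplex that leave its initial vertex unchanged. *)
Fixpoint dw (s : seq G) (m : M) : W :=
  match s with
  | [::] => 0
  | g :: r => (if r is h :: r' then - << m *g (g * h)%g :: r' >> else - << m *g [::] >>)
              - (if r is [::] then 0 else cns g (dw r m))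
  end.

Lemma dw1 g m : dw [:: g] m = - << m *g [::] >>.
Proof. by rewrite /= subr0. Qed.
Lemma dw2 g h r m : dw (g :: h :: r) m = - << m *g (g * h)%g :: r >> - cns g (dw (h :: r) m).
Proof. by []. Qed.

Lemma zlin_dw s : zlin (dw s).
Proof.
elim: s => [|g [|h r] IH]; first exact: zlin_0.
  by move=> x y; rewrite !dw1 genB opprD.
move=> x y; rewrite !dw2 IH cnsB genB !opprD !opprK.
by rewrite addrACA.
Qed.

Definition dwe : W -> W := ext dw.
Lemma dweB : zlin dwe. Proof. exact: extB zlin_dw. Qed.
Lemma dweU s m : dwe << m *g s >> = dw s m. Proof. exact: extU zlin_dw _ _. Qed.

Lemma dwe_cns2 g h z : dwe (cns g (cns h z)) = - cns (g * h)%g z - cns g (dwe (cns h z)).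
Proof.
move: z; apply: gen_eqT => [||s m].
- by apply: zlin_comp; [exact: dweB|apply: zlin_comp; exact: cnsB].
- apply: zlin_sub; first by apply: zlin_opp; exact: cnsB.
  by apply: zlin_comp; [exact: cnsB|apply: zlin_comp; [exact: dweB|exact: cnsB]].
- by rewrite !cnsU !dweU dw2.
Qed.

Lemma dwe_dw s m : dwe (dw s m) = 0.
Proof.
elim: s => [|g [|h r] IH]; first exact: zlin0 dweB.
  by rewrite dw1 (zlinN dweB) dweU oppr0.
case: r IH => [|k r] IH.
  rewrite dw2 dw1 dweB (zlinN dweB) dweU (zlinN (@cnsB _)) cnsU (zlinN dweB) dweU !dw1.
  by rewrite !opprK subrr.
have IH' : dwe (cns h (dw (k :: r) m)) = - dw ((h * k)%g :: r) m.
  move: IH; rewrite dw2 dweB (zlinN dweB) dweU => /eqP.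
  by rewrite -opprD oppr_eq0 addrC addr_eq0 => /eqP.
rewrite (dw2 g h) dweB (zlinN dweB) dweU (dw2 (g * h)%g k) (dw2 h k) (@cnsB g) (zlinN (@cnsB g)) cnsU.
rewrite dweB (zlinN dweB) dweU dwe_cns2 IH' (dw2 g) (zlinN (@cnsB g)) mulgA !opprK !opprD !opprK.
move: (gen _ _) (cns g _) (cns (g * h)%g _) => x y z; zmod.
Qed.

Section Space.
Variables (X : choiceType) (xa : X -> G -> X) (ma : M -> G -> M).
Hypothesis xaM : forall x g h, xa (xa x g) h = xa x (g * h)%g.
Hypothesis maB : forall g, zlin (ma^~ g).
Hypothesis maM : forall m g h, ma (ma m g) h = ma m (g * h)%g.
Local Notation D := {malg M[(X * seq G)%type]}.

(** The remaining face, the only one that moves the vertex and acts on the coefficient. Keeping it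
    apart lets [dw] be treated without any [G]-set. *)
Definition d0 (k : X * seq G) (m : M) : D :=
  if k.2 is g :: r then << ma m g *g (xa k.1 g, r) >> else 0.
Definition attach (x : X) : W -> D := kmap (pair x).
Definition bar (k : X * seq G) (m : M) : D := d0 k m + attach k.1 (dw k.2 m).

Lemma zlin_d0 k : zlin (d0 k).
Proof. by case: k => x [|g r]; [exact: zlin_0|move=> m n /=; rewrite /d0 /= maB genB]. Qed.
Lemma attB x : zlin (attach x). Proof. exact: kmapB. Qed.
Lemma zlin_bar k : zlin (bar k).
Proof.
by apply: zlin_add; [exact: zlin_d0|apply: zlin_comp; [exact: attB|exact: zlin_dw]].
Qed.
Definition dv : D -> D := ext bar.
Lemma dvB : zlin dv. Proof. exact: extB zlin_bar. Qed.
Lemma dvU k m : dv << m *g k >> = bar k m. Proof. exact: extU zlin_bar _ _. Qed.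

Definition d0e : D -> D := ext d0.
Lemma d0eB : zlin d0e. Proof. exact: extB zlin_d0. Qed.
Lemma d0eU k m : d0e << m *g k >> = d0 k m. Proof. exact: extU zlin_d0 _ _. Qed.

Lemma dv_att x u : dv (attach x u) = d0e (attach x u) + attach x (dwe u).
Proof.
move: u; apply: gen_eqT => [||s m].
- by apply: zlin_comp; [exact: dvB|exact: attB].
- apply: zlin_add; first by apply: zlin_comp; [exact: d0eB|exact: attB].
  by apply: zlin_comp; [exact: attB|exact: dweB].
- by rewrite /attach !kmapU dvU dweU d0eU.
Qed.

Lemma d0_cns x g u : d0e (attach x (cns g u)) = attach (xa x g) (cmap (ma^~ g) u).
Proof.
move: u; apply: gen_eqT => [||s m].
- by apply: zlin_comp; [exact: d0eB|apply: zlin_comp; [exact: attB|exact: cnsB]].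
- by apply: zlin_comp; [exact: attB|apply: cmapB; exact: maB].
- by rewrite cnsU /attach kmapU d0eU cmapU ?kmapU //; exact: maB.
Qed.

Lemma cmap_dw (f : M -> M) s m : zlin f -> cmap f (dw s m) = dw s (f m).
Proof.
move=> fB; elim: s => [|g [|h r] IH]; first exact: (zlin0 (cmapB fB)).
  by rewrite !dw1 (zlinN (cmapB fB)) cmapU.
by rewrite !dw2 (cmapB fB) (zlinN (cmapB fB)) cmapU // cmap_kmap // IH.
Qed.

Lemma dv_dv z : dv (dv z) = 0.
Proof.
move: z; apply: gen_eqT => [||[x s] m]; first by apply: zlin_comp; exact: dvB.
  exact: zlin_0.
rewrite dvU /bar /= (zlinD dvB) dv_att dwe_dw (zlin0 (attB x)) addr0.
case: s => [|g [|h r]].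
- by rewrite /d0 /= (zlin0 dvB) (zlin0 (attB x)) (zlin0 d0eB) addr0.
- rewrite /d0 dw1 (zlinN (attB x)) (zlinN d0eB) /attach kmapU d0eU dvU /bar /d0 /=.
  by rewrite (zlin0 (attB _)); zmod.
- rewrite /d0 [_.2]/= dvU dw2 (attB x) (zlinN (attB x)) d0eB (zlinN d0eB) d0_cns.
  rewrite cmap_dw; last exact: maB.
  rewrite /bar /d0 /= [attach x (gen _ _)]kmapU d0eU /d0 /= maM xaM.
  move: (gen _ _) (attach _ _) => a b.
  zmod.
Qed.

(** * Natural transformations and prism homotopies *)

Section Twist.
Variable th : X -> G.

(* The conjugate of the path [x --s-->] by the natural transformation [th]. *)
Fixpoint tw (x : X) (s : seq G) : seq G :=
  if s is g :: r then ((th x)^-1 * g * th (xa x g))%g :: tw (xa x g) r else [::].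
(** Alternating sum over the positions at which the path crosses, along [th], to its conjugate: the
    prism decomposition. *)
Fixpoint hw (x : X) (s : seq G) (m : M) : W :=
  << m *g th x :: tw x s >> - (if s is g :: r then cns g (hw (xa x g) r m) else 0).

Lemma zlin_hw x s : zlin (hw x s).
Proof.
elim: s x => [|g r IH] x /=.
  by move=> m n; rewrite !subr0 genB.
by apply: zlin_sub; [exact: zlin_U|apply: zlin_comp; [exact: cnsB|exact: IH]].
Qed.

Lemma cmap_hw (f : M -> M) x s m : zlin f -> cmap f (hw x s m) = hw x s (f m).
Proof.
move=> fB; elim: s x => [|g r IH] x /=; rewrite (cmapB fB) cmapU //.
  by rewrite (zlin0 (cmapB fB)).
by rewrite cmap_kmap // IH.
Qed.

Lemma dw_tw x s m : dw (tw x s) m = kmap (tw x) (dw s m).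
Proof.
elim: s x => [|g [|h r] IH] x; first by rewrite /= (zlin0 (kmapB _)).
  by rewrite !dw1 (zlinN (kmapB _)) kmapU.
rewrite [tw x _]/= !dw2 (kmapB (tw x)) (zlinN (kmapB (tw x))) kmapU [tw x (_ :: r)]/=.
rewrite xaM; congr (- gen _ _ - _).
  by rewrite -!mulgA mulVKg.
have := IH (xa x g); rewrite [tw _ _]/= xaM => ->.
by rewrite /cns !kmap_comp.
Qed.

Definition hwe x : W -> W := ext (hw x).
Lemma hweB x : zlin (hwe x). Proof. exact: extB (zlin_hw x). Qed.
Lemma hweU x s m : hwe x << m *g s >> = hw x s m. Proof. exact: extU (zlin_hw x) _ _. Qed.

Lemma hwe_cns x g u : hwe x (cns g u) =
  cns (th x) (kmap (tw x) (cns g u)) - cns g (hwe (xa x g) u).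
Proof.
move: u; apply: gen_eqT => [||s m].
- by apply: zlin_comp; [exact: hweB|exact: cnsB].
- apply: zlin_sub; last by apply: zlin_comp; [exact: cnsB|exact: hweB].
  by apply: zlin_comp; [exact: cnsB|apply: zlin_comp; [exact: kmapB|exact: cnsB]].
- by rewrite !cnsU kmapU cnsU !hweU.
Qed.

(** Only one end of the prism appears here, because these faces keep the initial vertex. The
    conjugated end is the zeroth face of the first summand of [hw] and enters in [prismP]. *)
Lemma dwe_hw x s m : dwe (hw x s m) + hwe x (dw s m) = - << m *g s >>.
Proof.
elim: s x => [|g r IH] x.
  by rewrite /= subr0 dweU dw1 (zlin0 (hweB x)) addr0.
have := IH (xa x g); case: r {IH} => [|h r] IH.
  rewrite /= !subr0 dweB dweU dw2 dw1 cnsU dweU dw2 dw1 (zlinN (hweB x)) hweU /= subr0.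
  rewrite !(zlinN (@cnsB _)) !cnsU !opprD !opprK mulgA mulgA mulgV mul1g.
  move: (gen _ _) (gen _ _) (gen _ _) => a b c.
  zmod.
set x' := xa x g in IH *; set U := << m *g tw x' (h :: r) >>.
set V := hw (xa x' h) r m.
have eh : hw x' (h :: r) m = cns (th x') U - cns h V by rewrite /U cnsU.
have e1 : hw x [:: g, h & r] m =
    << m *g [:: th x, (th x)^-1 * g * th x' & tw x' (h :: r)]%g >> - cns g (hw x' (h :: r) m) by [].
have e2 : hw x ((g * h)%g :: r) m = << m *g th x :: tw x ((g * h)%g :: r) >> - cns (g * h)%g V.
  by rewrite /V /x' xaM.
have e3 : dwe (cns g (hw x' (h :: r) m)) =
    - cns (g * th x')%g U + cns (g * h)%g V - cns g (dwe (hw x' (h :: r) m)).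
  rewrite eh (@cnsB g) !dweB !dwe_cns2 (@cnsB g) !opprD !opprK.
  move: (cns _ U) (cns _ V) (cns g _) (cns g _) => p q c d.
  zmod.
have e4 : dw [:: th x, (th x)^-1 * g * th x' & tw x' (h :: r)]%g m =
    - cns (g * th x')%g U - cns (th x) (kmap (tw x) (dw [:: g, h & r] m)).
  by rewrite (dw2 (th x)) -[dw (_ :: tw x' _) m]/(dw (tw x [:: g, h & r]) m) dw_tw !mulgA mulgV mul1g -cnsU.
have e5 : - << m *g [:: g, h & r] >> =
    cns g (dwe (hw x' (h :: r) m)) + cns g (hwe x' (dw (h :: r) m)).
  by rewrite -(zlinD (@cnsB g)) IH (zlinN (@cnsB g)) cnsU.
rewrite e5 e1 dweB dweU e3 e4 (dw2 g h) hweB (zlinN (hweB x)) hweU e2 hwe_cns -/x'.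
rewrite (kmapB (tw x)) (zlinN (kmapB (tw x))) kmapU (@cnsB (th x)) (zlinN (@cnsB (th x))) (cnsU (th x) (tw x ((g * h)%g :: r))).
zmod.
Qed.

Definition prism : D -> D := ext (fun k m => attach k.1 (hw k.1 k.2 m)).
Definition twist : D -> D :=
  ext (fun k m => << ma m (th k.1) *g (xa k.1 (th k.1), tw k.1 k.2) >>).

Lemma zlin_prism_gen (k : X * seq G) : zlin (fun m => attach k.1 (hw k.1 k.2 m)).
Proof. by apply: zlin_comp; [exact: attB|exact: zlin_hw]. Qed.
Lemma prismB : zlin prism. Proof. exact: extB zlin_prism_gen. Qed.
Lemma zlin_twist_gen (k : X * seq G) :
  zlin (fun m => << ma m (th k.1) *g (xa k.1 (th k.1), tw k.1 k.2) >>).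
Proof. by move=> m n; rewrite maB genB. Qed.
Lemma twistB : zlin twist. Proof. exact: extB zlin_twist_gen. Qed.
Lemma twistU k m :
  twist << m *g k >> = << ma m (th k.1) *g (xa k.1 (th k.1), tw k.1 k.2) >>.
Proof. exact: extU zlin_twist_gen _ _. Qed.
Lemma prismU k m : prism << m *g k >> = attach k.1 (hw k.1 k.2 m).
Proof. exact: extU zlin_prism_gen _ _. Qed.
Lemma prism_att x u : prism (attach x u) = attach x (hwe x u).
Proof.
move: u; apply: gen_eqT => [||s m].
- by apply: zlin_comp; [exact: prismB|exact: attB].
- by apply: zlin_comp; [exact: attB|exact: hweB].
- by rewrite /attach kmapU prismU hweU.
Qed.

(** [th] is a natural transformation from the identity of the translation groupoid to the
    conjugation functor, so the induced maps are homotopic. Both Shapiro's lemma and the comparison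
    of faces are instances. *)
Lemma prismP z : dv (prism z) + prism (dv z) = twist z - z.
Proof.
move: z; apply: gen_eqT => [||[x s] m].
- by apply: zlin_add; apply: zlin_comp; (exact: prismB || exact: dvB).
- by apply: zlin_sub; [exact: twistB|exact: zlin_id].
rewrite prismU twistU dvU [_.1]/= [_.2]/= dv_att (zlinD prismB) prism_att.
set A := attach x (dwe _); set B := attach x (hwe _ _).
have -> : - << m *g (x, s) >> = A + B.
  rewrite /A /B -(zlinD (attB x)) dwe_hw (zlinN (attB x)) /attach kmapU //.
suff -> : d0e (attach x (hw x s m)) =
    << ma m (th x) *g (xa x (th x), tw x s) >> - prism (d0 (x, s) m) by zmod.
have e1 : << m *g th x :: tw x s >> = cns (th x) << m *g tw x s >> by rewrite cnsU.
case: s {A B} e1 => [|g r] e1 /=; rewrite e1.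
  rewrite subr0 d0_cns cmapU; last exact: maB.
  by rewrite /attach kmapU /d0 /= (zlin0 prismB) subr0.
rewrite (attB x) d0eB !d0_cns cmapU; last exact: maB.
by rewrite cmap_hw; [rewrite /attach kmapU /d0 /= prismU|exact: maB].
Qed.
End Twist.

Section Support.
Variables (K : pred G).
Hypotheses (KM : forall g h, K g -> K h -> K (g * h)%g) (KV : forall g, K g -> K g^-1%g).
Definition deg (Q : X -> Prop) (q : nat) (k : X * seq G) :=
  [/\ Q k.1, size k.2 = q & all K k.2].

Lemma dw_sup s m : all K s -> sup (fun w => (size w).+1 = size s /\ all K w) (dw s m).
Proof.
elim: s => [|g [|h r] IH] => [_|_|]; first exact: sup0.
  by rewrite dw1; apply: supN; apply: supU.
move=> /and3P[Kg Kh Kr]; rewrite dw2; apply: supB.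
  by apply: supN; apply: supU; rewrite /= KM.
apply: kmap_sup (IH _) => [w [sw Kw]|]; last by rewrite /= Kh.
by rewrite [size (_ :: w)]/= sw /= Kg Kw.
Qed.

Lemma dv_sup (Q : X -> Prop) q z : (forall x g, K g -> Q x -> Q (xa x g)) ->
  sup (deg Q q.+1) z -> sup (deg Q q) (dv z).
Proof.
move=> hQ; apply: ext_sup => -[x s] m [/= Qx ss Ks]; apply: supD.
  case: s ss Ks => [|g r] /=; first by move=> *; exact: sup0.
  by move=> [sr] /andP[Kg Kr]; apply: supU; split => //=; apply: hQ.
by apply: (kmap_sup _ (@dw_sup s m Ks)) => w [sw Kw]; split => //=; move: sw; rewrite ss => -[].
Qed.

Lemma dv_deg0 (Q : X -> Prop) z : sup (deg Q 0) z -> dv z = 0.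
Proof.
move: z; apply: gen_eq => [||[x s] m [/= _ /size0nil -> _]]; [exact: dvB|exact: zlin_0|].
by rewrite dvU /bar /d0 /= (zlin0 (attB _)) addr0.
Qed.

Variable th : X -> G.
Hypothesis Kth : forall x, K (th x).

Lemma tw_all x s : all K s -> all K (tw th x s).
Proof.
elim: s x => //= g r IH x /andP[Kg Kr]; rewrite IH // andbT.
by apply: KM => //; apply: KM => //; apply: KV.
Qed.
Lemma size_tw x s : size (tw th x s) = size s.
Proof. by elim: s x => //= g r IH x; rewrite IH. Qed.

Lemma hw_sup x s m : all K s -> sup (fun w => size w = (size s).+1 /\ all K w) (hw th x s m).
Proof.
elim: s x => [|g r IH] x Ks.
  by rewrite /= subr0; apply: supU; rewrite /= Kth.
apply: supB; first by apply: supU; split; [rewrite /= size_tw|apply/andP; split => //; exact: (tw_all x Ks)].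
move: Ks => /= /andP[Kg Kr]; apply: kmap_sup (IH (xa x g) Kr) => w [sw Kw] /=.
by rewrite sw Kg.
Qed.

Lemma prism_sup (Q : X -> Prop) q z : sup (deg Q q) z -> sup (deg Q q.+1) (prism th z).
Proof.
apply: ext_sup => -[x s] m [/= Qx ss Ks].
by apply: (kmap_sup _ (@hw_sup x s m Ks)) => w [sw Kw]; split; rewrite //= sw ss.
Qed.

End Support.
End Space.
End Bar.

(** * The double complex and abstract stability *)

Section Horizontal.
Variables (G : groupType) (V : choiceType) (va : V -> G -> V).
Variables (M : zmodType) (ma : M -> G -> M).
Hypothesis vaM : forall x g h, va (va x g) h = va x (g * h)%g.
Hypothesis maB : forall g, zlin (ma^~ g).
Hypothesis maM : forall m g h, ma (ma m g) h = ma m (g * h)%g.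
Local Notation D := {malg M[(seq V * seq G)%type]}.
Definition actw (w : seq V) (g : G) := map (va^~ g) w.
Local Notation dv := (dv actw ma).
Local Notation dvB := (dvB actw maB).
Local Notation att := (@attach G M (seq V)).

Lemma xaM x g h : actw (actw x g) h = actw x (g * h)%g.
Proof. by rewrite /actw -map_comp; apply: eq_map => v /=; rewrite vaM. Qed.

Definition ins (s : seq G) : {malg M[seq V]} -> D := kmap (fun w => (w, s)).
Lemma insB s : zlin (ins s). Proof. exact: kmapB. Qed.
Definition hdel (k : seq V * seq G) (m : M) : D := ins k.2 (fd k.1 m).
Lemma zlin_hdel k : zlin (hdel k).
Proof. by apply: zlin_comp; [exact: insB|exact: zlin_fd]. Qed.
Definition dh : D -> D := ext hdel.
Lemma dhB : zlin dh. Proof. exact: extB zlin_hdel. Qed.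
Lemma dhU k m : dh << m *g k >> = hdel k m. Proof. exact: extU zlin_hdel _ _. Qed.

Lemma dh_ins s u : dh (ins s u) = ins s (dl u).
Proof.
move: u; apply: gen_eqT => [||w m].
- by apply: zlin_comp; [exact: dhB|exact: insB].
- by apply: zlin_comp; [exact: insB|exact: zlin_dl].
- by rewrite /ins kmapU dhU dlU.
Qed.

Lemma dh_dh z : dh (dh z) = 0.
Proof.
move: z; apply: gen_eqT => [||[w s] m]; first by apply: zlin_comp; exact: dhB.
  exact: zlin_0.
by rewrite dhU /hdel dh_ins -dlU dl_dl (zlin0 (insB _)).
Qed.

Lemma fd_map (f : V -> V) (b : M -> M) w m : zlin b ->
  fd (map f w) (b m) = kmap (map f) (cmap b (fd w m)).
Proof.
move=> bB; elim: w => [|v r IH] /=; first by rewrite (zlin0 (cmapB bB)) (zlin0 (kmapB _)).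
rewrite IH (cmapB bB) (kmapB (map f)) cmapU // kmapU cmap_kmap // !kmap_comp.
by [].
Qed.

Definition cf (v : V) : D -> D := kmap (fun k => (v :: k.1, k.2)).
Lemma cfB v : zlin (cf v). Proof. exact: kmapB. Qed.

Definition dwv : D -> D := ext (fun k m => att k.1 (dw k.2 m)).
Lemma zlin_dwv_gen (k : seq V * seq G) : zlin (fun m => att k.1 (dw k.2 m)).
Proof. by apply: zlin_comp; [exact: attB|exact: zlin_dw]. Qed.
Lemma dwvB : zlin dwv. Proof. exact: extB zlin_dwv_gen. Qed.
Lemma dwvU k m : dwv << m *g k >> = att k.1 (dw k.2 m).
Proof. exact: extU zlin_dwv_gen _ _. Qed.

Lemma dvE z : dv z = d0e actw ma z + dwv z.
Proof.
move: z; apply: gen_eqT => [||k m]; first exact: dvB.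
  by apply: zlin_add; [exact: d0eB|exact: dwvB].
by rewrite dvU // d0eU // dwvU.
Qed.

Lemma dh_att_cons v r u : dh (att (v :: r) u) = att r u - cf v (dh (att r u)).
Proof.
move: u; apply: gen_eqT => [||s m].
- by apply: zlin_comp; [exact: dhB|exact: attB].
- apply: zlin_sub; first exact: attB.
  by apply: zlin_comp; [exact: cfB|apply: zlin_comp; [exact: dhB|exact: attB]].
- by rewrite /attach !kmapU !dhU /hdel /= (insB _) /ins kmapU /cf !kmap_comp.
Qed.

Lemma dh_att0 u : dh (att [::] u) = 0.
Proof.
move: u; apply: gen_eqT => [||s m]; last by rewrite /attach kmapU dhU /hdel /= (zlin0 (insB _)).
- by apply: zlin_comp; [exact: dhB|exact: attB].
- exact: zlin_0.
Qed.

Lemma dwv_cf v z : dwv (cf v z) = cf v (dwv z).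
Proof.
move: z; apply: gen_eqT => [||[w s] m]; try by apply: zlin_comp; (exact: dwvB || exact: cfB).
by rewrite /cf kmapU !dwvU /attach kmap_comp.
Qed.

Lemma dwv_ins w s m : dwv (ins s (fd w m)) = dh (att w (dw s m)).
Proof.
elim: w => [|v r IH]; first by rewrite dh_att0 /= (zlin0 (insB _)) (zlin0 dwvB).
rewrite dh_att_cons -IH [fd _ _]/= (insB _) dwvB /ins kmapU dwvU; congr (_ - _).
by rewrite kmap_comp -dwv_cf /cf kmap_comp.
Qed.

(** Deleting letters is equivariant, so the two differentials commute; no sign is built into either
    of them. *)
Lemma dh_dv z : dh (dv z) = dv (dh z).
Proof.
move: z; apply: gen_eqT => [||[w s] m]; try by apply: zlin_comp; (exact: dvB || exact: dhB).
rewrite dvU // dhU /hdel /bar dvE dwv_ins (zlinD dhB); congr (_ + _).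
rewrite /d0 /=; case: s => [|g r].
  rewrite (zlin0 dhB); move: (fd w m); apply: gen_eqT => [||w' m']; first exact: zlin_0.
    by apply: zlin_comp; [exact: d0eB|exact: insB].
  by rewrite /ins kmapU d0eU.
rewrite dhU /hdel /= (@fd_map (va^~ g) (ma^~ g) w m (maB g)); move: (fd w m); apply: gen_eqT => [||w' m'].
- apply: zlin_comp; first exact: insB.
  by apply: zlin_comp; [exact: kmapB|apply: cmapB; exact: maB].
- by apply: zlin_comp; [exact: d0eB|exact: insB].
- by rewrite cmapU // /ins !kmapU d0eU.
Qed.

Variables (R : rel V) (P : pred V) (K : pred G).
Definition fr (a : nat) (w : seq V) := valid R P w /\ size w = a.

Lemma dh_sup a q z : sup (deg K (fr a.+1) q) z -> sup (deg K (fr a) q) (dh z).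
Proof.
apply: ext_sup => -[w s] m [/= [vw sw] ss Ks].
apply: (kmap_sup _ (@fd_sup _ _ w m)) => w' [h1 h2]; split => //=; split.
  exact: valid_sub h1 vw.
by move: h2; rewrite sw => -[].
Qed.

(** For fixed [q] the row is a direct sum, over group words [s], of copies of the word complex;
    fillings are chosen for each of the finitely many [s] that occur. *)
Lemma row_exact d a q z : acyc M R P d -> (a <= d)%N -> sup (deg K (fr a) q) z -> dh z = 0 ->
  exists2 z', sup (deg K (fr a.+1) q) z' & dh z' = z.
Proof.
move=> acy le_ad hz dz.
pose pr s : D -> {malg M[seq V]} := ext (fun k m => if k.2 == s then << m *g k.1 >> else 0).
have prg s (k : seq V * seq G) : zlin (fun m : M => if k.2 == s then << m *g k.1 >> else 0).
  by case: eqP => _; [exact: zlin_U|exact: zlin_0].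
have prB s : zlin (pr s) by exact: extB (prg s).
have prU s k m : pr s << m *g k >> = if k.2 == s then << m *g k.1 >> else 0.
  exact: extU (prg s) _ _.
have pr_ins s s' u : pr s (ins s' u) = if s' == s then u else 0.
  move: u; apply: gen_eqT => [||w m]; last by rewrite /ins kmapU prU.
    by apply: zlin_comp => //; exact: insB.
  by case: (s' == s); [exact: zlin_id|exact: zlin_0].
have pr_dh s y : pr s (dh y) = dl (pr s y).
  move: y; apply: gen_eqT => [||[w s'] m].
  - by apply: zlin_comp => //; exact: dhB.
  - by apply: zlin_comp => //; exact: zlin_dl.
  - by rewrite dhU prU /hdel pr_ins /=; case: eqP => _; rewrite ?dlU ?(zlin0 (@zlin_dl _ _)).
pose ss := undup [seq k.2 | k <- msupp z].
have ssP s : s \in ss -> size s = q /\ all K s.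
  rewrite mem_undup => /mapP[k kz ->].
  by have [|_ h1 h2] := hz k; [rewrite mcoeff_neq0|split].
have ez : z = \sum_(s <- ss) ins s (pr s z).
  have h u : sup (fun k => k.2 \in ss) u -> u = \sum_(s <- ss) ins s (pr s u).
    move: u; apply: gen_eq => [||k m kp]; first exact: zlin_id.
      by move=> x y; rewrite -sumrB; apply: eq_bigr => s _; rewrite (prB s) (insB _).
    rewrite (bigD1_seq k.2) ?undup_uniq //= prU eqxx /ins kmapU -surjective_pairing.
    rewrite big1 ?addr0 // => s; rewrite eq_sym => /negbTE h.
    by rewrite prU h (zlin0 (kmapB _)).
  apply: h => k; rewrite mcoeff_neq0 => kz; rewrite mem_undup.
  exact: map_f.
suff ex ts : {subset ts <= ss} ->
    exists2 z', sup (deg K (fr a.+1) q) z' & dh z' = \sum_(s <- ts) ins s (pr s z).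
  by have [z' h1 h2] := ex ss (fun _ => id); exists z'; rewrite // h2 -ez.
elim: ts => [|s ts IH] sub.
  by exists 0; [exact: sup0|rewrite big_nil (zlin0 dhB)].
have [|Z hZ1 hZ2] := IH; first by move=> t tt; apply: sub; rewrite in_cons tt orbT.
have [sq sK] := ssP s (sub s (mem_head _ _)).
have [||c hc1 hc2] := acy a (pr s z) le_ad.
- by apply: ext_sup hz => k m [h1 _ _]; case: eqP => _; [exact: supU|exact: sup0].
- by rewrite -pr_dh dz (zlin0 (prB s)).
exists (ins s c + Z); last by rewrite (zlinD dhB) big_cons hZ2 dh_ins hc2.
apply: supD => //; apply: kmap_sup hc1 => w [h1 h2]; split => //=.
Qed.
End Horizontal.

(** * Stability from acyclic frame complexes *)

Section Stability.
Variables (G : groupType) (V : choiceType) (va : V -> G -> V).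
Variables (M : zmodType) (ma : M -> G -> M).
Hypothesis vaM : forall x g h, va (va x g) h = va x (g * h)%g.
Hypothesis va1 : forall x, va x 1%g = x.
Hypothesis maB : forall g, zlin (ma^~ g).
Hypothesis maM : forall m g h, ma (ma m g) h = ma m (g * h)%g.
Hypothesis ma1 : forall m, ma m 1%g = m.
Variables (R : rel V) (P : nat -> pred V) (K : nat -> pred G) (st : nat -> nat -> seq V) (N : nat).
Local Notation D := {malg M[(seq V * seq G)%type]}.
Local Notation W := {malg M[seq G]}.
Local Notation xa := (actw va).
Local Notation dv := (dv xa ma).
Local Notation dh := (@dh G V M).
Local Notation att := (@attach G M (seq V)).
Local Notation vfr n a := (fr R (P n) a).
Local Notation In n a q := (@sup _ M (deg (K n) (vfr n a) q)).
Hypothesis KM : forall n g h, K n g -> K n h -> K n (g * h)%g.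
Hypothesis KV : forall n g, K n g -> K n g^-1%g.
Hypothesis fr_act : forall n a w g, (n <= N)%N -> K n g -> vfr n a w -> vfr n a (xa w g).
Hypothesis st_fr : forall n a, (a <= n <= N)%N -> vfr n a (st n a).
Hypothesis st_trans : forall n a w, (a <= n <= N)%N -> vfr n a w ->
  exists g, K n g && (xa (st n a) g == w).
Hypothesis stabP : forall n a g, (a <= n <= N)%N ->
  K (n - a)%N g <-> K n g /\ xa (st n a) g = st n a.
Hypothesis st_behead : forall n a, (a < n <= N)%N -> behead (st n a.+1) = st n a.

Definition del (i : nat) (w : seq V) := take i w ++ drop i.+1 w.
(** The element must centralise the stabiliser of [a.+2] letters, one more than the frame has: the
    additional basis vector is the room needed to write it as a commutator. *)
Hypothesis st_face : forall n a i, (a.+2 <= n <= N)%N -> (i < a)%N ->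
  exists th, [/\ K n th, forall g, K (n - a.+2)%N g -> (g * th = th * g)%g,
    forall m, ma m th = m & xa (del i (st n a.+1)) th = del i.+1 (st n a.+1)].

Let xaM := xaM vaM.
Let dvB := dvB xa maB.
Let prismB th := @prismB G M _ xa th.
Let twistB th := @twistB G M _ xa ma maB th.

Lemma xa1 w : xa w 1%g = w.
Proof. by rewrite /actw -[RHS]map_id; apply: eq_map => v. Qed.

Lemma K_mono m n g : (m <= n <= N)%N -> K m g -> K n g.
Proof.
move=> /andP[le_mn le_nN] Kg.
have h : (n - m <= n <= N)%N by rewrite leq_subr.
by have := (stabP g h).1; rewrite subKn // => /(_ Kg) [].
Qed.

(** The empty word is fixed by the whole group, so its column is the ordinary bar complex; this is
    its differential. *)
Definition db : W -> W := fun u => kmap snd (dv (att [::] u)).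

Lemma att_inj x : injective (att x).
Proof.
have attK : cancel (att x) (kmap snd).
  move=> u; rewrite /attach kmap_comp; move: u.
  by apply: gen_eqT => [||s m]; [exact: kmapB|exact: zlin_id|rewrite kmapU].
exact: can_inj attK.
Qed.

Lemma kmap_att x u : kmap snd (att x u) = u.
Proof.
rewrite /attach kmap_comp; move: u.
by apply: gen_eqT => [||s m]; [exact: kmapB|exact: zlin_id|rewrite kmapU].
Qed.

Lemma dbB : zlin db.
Proof.
apply: zlin_comp; first exact: kmapB.
by apply: zlin_comp; [exact: dvB|exact: attB].
Qed.

Definition wd (k : pred G) (q : nat) (s : seq G) := size s = q /\ all k s.

Lemma dv_att_fix (S : pred G) x u : (forall g, S g -> xa x g = x) ->
  sup (fun s => all S s) u -> dv (att x u) = att x (db u).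
Proof.
move=> hS; move: u; apply: gen_eq => [||s m Ss].
- by apply: zlin_comp; [exact: dvB|exact: attB].
- by apply: zlin_comp; [exact: attB|exact: dbB].
rewrite /db /attach !kmapU !dvU // /bar !(zlinD (kmapB _)) /= /attach !kmap_comp.
congr (_ + _); case: s Ss => [|g r] /=; rewrite /d0 /=; first by rewrite !(zlin0 (kmapB _)).
by move=> /andP[Sg _]; rewrite !kmapU hS.
Qed.

Lemma dv_att0 u : dv (att [::] u) = att [::] (db u).
Proof. by apply: (@dv_att_fix predT) => // s _; apply/allP. Qed.

Lemma db_db u : db (db u) = 0.
Proof. by apply: (@att_inj [::]); rewrite -!dv_att0 dv_dv // (zlin0 (attB _)). Qed.

Lemma sup_wd_att (S : pred G) (Q : seq V -> Prop) q x u : Q x ->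
  sup (wd S q) u -> sup (deg S Q q) (att x u).
Proof. by move=> Qx; apply: kmap_sup => s [h1 h2]; split. Qed.

Lemma sup_all S q (u : W) : sup (wd S q) u -> sup (fun s => all S s) u.
Proof. by apply: sup_imp => s []. Qed.

Lemma sup_kmap_snd (S : pred G) (Q : seq V -> Prop) q z : sup (deg S Q q) z ->
  sup (wd S q) (kmap snd z : W).
Proof. by apply: kmap_sup => s [h1 h2]; split. Qed.

Lemma dv_In n a q z : (n <= N)%N -> In n a q.+1 z -> In n a q (dv z).
Proof. by move=> le_nN; apply: dv_sup => [g h|x g Kg Qx]; [exact: KM|exact: fr_act]. Qed.

Lemma dh_In n a q z : In n a.+1 q z -> In n a q (dh z).
Proof. exact: dh_sup. Qed.

Lemma twist_dv th z : twist xa ma th (dv z) = dv (twist xa ma th z).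
Proof.
have e1 := prismP xaM maB th z.
have e2 := prismP xaM maB th (dv z).
rewrite dv_dv // (zlin0 (prismB th)) addr0 in e2.
have -> : twist xa ma th z = z + (dv (prism xa th z) + prism xa th (dv z)).
  by rewrite e1; zmod.
by rewrite !(zlinD dvB) dv_dv // add0r e2; zmod.
Qed.

(** * Shapiro's lemma for the columns *)

Section Shapiro.
Variables (n a : nat).
Hypothesis le_an : (a <= n <= N)%N.
Let s0 := st n a.

Definition vfrb (w : seq V) := valid R (P n) w && (size w == a).
Lemma vfrP w : reflect (vfr n a w) (vfrb w).
Proof. by apply: (iffP andP) => -[h1 /eqP h2]; split => //; apply/eqP. Qed.

(** Normalised to 1 at [s0], so that conjugation by [sec] is the identity on chains already based at
    [s0]; injectivity in Shapiro's lemma relies on this. *)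
Definition sec (w : seq V) : G :=
  if w == s0 then 1%g else
  match vfrP w with ReflectT h => (xchoose (st_trans le_an h))^-1%g | _ => 1%g end.

Lemma K1 : K n 1%g.
Proof.
have [g /andP[Kg _]] := st_trans le_an (st_fr le_an).
by rewrite -(mulgV g); apply: KM => //; apply: KV.
Qed.

Lemma secK w : K n (sec w).
Proof.
rewrite /sec; case: eqP => _; first exact: K1.
case: vfrP => h; last exact: K1.
by apply: KV; have /andP[] := xchooseP (st_trans le_an h).
Qed.

Lemma secP w : vfr n a w -> xa w (sec w) = s0.
Proof.
move=> hw; rewrite /sec; case: eqP => [->|_]; first exact: xa1.
case: vfrP => h //; have /andP[_ /eqP e] := xchooseP (st_trans le_an h).
by rewrite -{1}e xaM mulgV xa1.
Qed.

Lemma le_nN : (n <= N)%N. Proof. by case/andP: le_an. Qed.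

Lemma tw_sec w s : vfr n a w -> all (K n) s -> all (K (n - a)) (tw xa sec w s).
Proof.
elim: s w => //= g r IH w hw /andP[Kg Kr].
have hwg : vfr n a (xa w g) by apply: fr_act; rewrite ?le_nN.
rewrite IH // andbT; apply/(stabP _ le_an); split.
  by apply: KM; [apply: KM => //; apply: KV; exact: secK|exact: secK].
by rewrite -/s0 -{1}(secP hw) xaM mulgA mulgA mulgV mul1g -xaM secP.
Qed.

Lemma twist_sec_In q x : In n a q x ->
  exists2 u, sup (wd (K (n - a)) q) u & twist xa ma sec x = att s0 u.
Proof.
move=> hx; exists (kmap snd (twist xa ma sec x)).
  apply: (@sup_kmap_snd _ (eq s0)); apply: ext_sup hx => -[w s] m [/= hw ss Ks].
  by apply: supU; split => /=; [rewrite secP|rewrite size_tw|exact: tw_sec].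
have : sup (fun k => k.1 = s0) (twist xa ma sec x).
  by apply: ext_sup hx => -[w s] m [/= hw ss Ks]; apply: supU; exact: secP.
move: (twist _ _ _ x); apply: gen_eq => [||[w s] m /= ->]; first exact: zlin_id.
  by apply: zlin_comp; [exact: attB|exact: kmapB].
by rewrite /attach !kmapU.
Qed.

Lemma s0_fix g : K (n - a) g -> xa s0 g = s0.
Proof. by move=> /(stabP _ le_an)[]. Qed.

Lemma dv_att_st q u : sup (wd (K (n - a)) q) u -> dv (att s0 u) = att s0 (db u).
Proof. by move=> hu; apply: dv_att_fix s0_fix (sup_all hu). Qed.

Lemma att_st_In q u : sup (wd (K (n - a)) q) u -> In n a q (att s0 u).
Proof.
move=> hu; apply: sup_wd_att (st_fr le_an) _; apply: sup_imp hu => s [h1 h2]; split => //.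
by apply: sub_all h2 => g; apply: K_mono; rewrite leq_subr le_nN.
Qed.

(** Conjugation by [sec] sends every path to a loop at [s0], that is to a word in the stabiliser,
    and the prism bounds the difference. *)
Lemma shapiro_surj q x : In n a q x -> dv x = 0 ->
  exists u w, [/\ sup (wd (K (n - a)) q) u, In n a q.+1 w, db u = 0 & x = att s0 u + dv w].
Proof.
move=> hx dx; have [u hu eu] := twist_sec_In hx.
exists u, (- prism xa sec x); split => //.
- by apply: supN; apply: prism_sup => //; [exact: KM|exact: KV|exact: secK].
- apply: (@att_inj s0); rewrite -(dv_att_st hu) -eu -twist_dv dx.
  by rewrite (zlin0 (twistB _)) (zlin0 (attB _)).
- have := prismP xaM maB sec x; rewrite dx (zlin0 (prismB _)) addr0 eu (zlinN dvB) => ->.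
  zmod.
Qed.

Lemma twist_st q u : sup (wd (K (n - a)) q) u -> twist xa ma sec (att s0 u) = att s0 u.
Proof.
move=> /sup_all; move: u; apply: gen_eq => [||s m Ss].
- by apply: zlin_comp; [exact: twistB|exact: attB].
- exact: attB.
have sec0 : sec s0 = 1%g by rewrite /sec eqxx.
rewrite /attach !kmapU twistU //= sec0 xa1 ma1; congr (gen (_, _) _).
elim: s Ss => //= g r IH /andP[Kg Kr].
by rewrite s0_fix // sec0 invg1 mul1g mulg1 IH.
Qed.

Lemma shapiro_inj q u b : sup (wd (K (n - a)) q) u -> In n a q.+1 b -> att s0 u = dv b ->
  exists2 v, sup (wd (K (n - a)) q.+1) v & u = db v.
Proof.
move=> hu hb e; have [v hv ev] := twist_sec_In hb.
exists v => //; apply: (@att_inj s0).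
by rewrite -(dv_att_st hv) -ev -twist_dv -e (twist_st hu).
Qed.
End Shapiro.

Lemma xa_del i w g : xa (del i w) g = del i (xa w g).
Proof. by rewrite /del /actw map_cat map_take map_drop. Qed.

Lemma del_subseq i w : subseq (del i w) w.
Proof.
rewrite -[X in subseq _ X](cat_take_drop i w); apply: cat_subseq => //.
by rewrite -add1n -drop_drop; exact: drop_subseq.
Qed.

Lemma size_del i w : (i < size w)%N -> size (del i w) = (size w).-1.
Proof. by move=> h; rewrite size_cat size_takel ?size_drop; lia. Qed.

Lemma fd_del w (m : M) : fd w m = \sum_(i < size w) sg i << m *g del i w >>.
Proof.
elim: w => [|v r IH]; first by rewrite big_ord0.
rewrite big_ord_recl /= /del take0 drop1 /=; congr (_ + _).
rewrite IH (zlin_sum (kmapB _)) -sumrN; apply: eq_bigr => i _.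
have e : kmap (cons v) << m *g del i r >> = << m *g del i.+1 (v :: r) >> by rewrite kmapU.
by rewrite /sg /bump leq0n add1n [odd i.+1]/=; case: (odd i); rewrite /= ?(zlinN (kmapB _)) ?opprK e.
Qed.

Lemma sg_zlin (A B : zmodType) (f : A -> B) i x : zlin f -> f (sg i x) = sg i (f x).
Proof. by move=> fB; rewrite /sg; case: odd; rewrite ?(zlinN fB). Qed.

Lemma dh_att w u : dh (att w u) = \sum_(i < size w) sg i (att (del i w) u).
Proof.
move: u; apply: gen_eqT => [||s m].
- by apply: zlin_comp; [exact: dhB|exact: attB].
- move=> x y; rewrite -sumrB; apply: eq_bigr => i _.
  exact: (zlin_sg i (attB (del i w))).
rewrite /attach kmapU dhU /hdel /= fd_del (zlin_sum (insB _)); apply: eq_bigr => i _.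
by rewrite sg_zlin ?/ins ?kmapU; last exact: insB.
Qed.

(** With [th] constant and commuting with all letters of [c], conjugation changes neither the words
    nor the coefficients: it only moves the frame from one face to the next. *)
Lemma face_step n a i q c : (a.+2 <= n <= N)%N -> (i < a)%N ->
  sup (wd (K (n - a.+2)) q) c -> db c = 0 ->
  exists2 b, In n a q.+1 b & att (del i.+1 (st n a.+1)) c = att (del i (st n a.+1)) c + dv b.
Proof.
move=> /andP[le_an le_nN] lt_ia hc dc; set w := st n a.+1.
have le_w : (a.+1 <= n <= N)%N by rewrite le_nN ltnW.
have [|th [Kth cth mth eth]] := @st_face n a i _ lt_ia; first by rewrite le_an.
have [vw sw] := st_fr le_w.
have fixd g : K (n - a.+2) g -> xa (del i w) g = del i w.
  move=> Kg; rewrite xa_del; congr del; apply: (s0_fix le_w).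
  by apply: K_mono Kg; apply/andP; split; lia.
have hd : vfr n a (del i w).
  split; first by apply: valid_sub vw; exact: del_subseq.
  by rewrite size_del sw //; lia.
have hc' : sup (wd (K n) q) c.
  apply: sup_imp hc => s [h1 h2]; split => //; apply: sub_all h2 => g.
  by apply: K_mono; apply/andP; split; lia.
exists (prism xa (fun=> th) (att (del i w) c)).
  apply: prism_sup => //; [exact: KM|exact: KV|exact: sup_wd_att].
have := prismP xaM maB (fun=> th) (att (del i w) c).
rewrite (dv_att_fix fixd (sup_all hc)) dc (zlin0 (attB _)) (zlin0 (prismB _)) addr0 => ->.
suff -> : twist xa ma (fun=> th) (att (del i w) c) = att (del i.+1 w) c by zmod.
move: (c) (sup_all hc); apply: gen_eq => [||s m Ss].
- by apply: zlin_comp; [exact: twistB|exact: attB].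
- exact: attB.
rewrite /attach !kmapU twistU //= mth eth; congr (gen (_, _) _).
elim: s (del i w) Ss => //= g r IH x /andP[Kg Kr].
by rewrite IH // -mulgA cth // mulKg.
Qed.

(** All [a.+1] faces are homologous to the zeroth one, so their alternating sum telescopes: [d^1] is
    the stabilisation map or zero according to parity. *)
Lemma face_sum n a q c : (a.+2 <= n <= N)%N -> sup (wd (K (n - a.+2)) q) c -> db c = 0 ->
  exists2 b, In n a q.+1 b &
    dh (att (st n a.+1) c) = (if odd a.+1 then att (st n a) c else 0) + dv b.
Proof.
move=> le_n hc dc; set w := st n a.+1.
have le_w : (a < n <= N)%N by case/andP: le_n => h ->; rewrite ltnW.
have ew : del 0 w = st n a by rewrite -st_behead // /del take0 drop1.
have [_ sw] := st_fr le_w.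
have face i : (i <= a)%N -> exists2 b, In n a q.+1 b & att (del i w) c = att (st n a) c + dv b.
  elim: i => [_|i IH lt_ia]; first by exists 0; [exact: sup0|rewrite ew (zlin0 dvB) addr0].
  have [b1 hb1 e1] := IH (ltnW lt_ia); have [b2 hb2 e2] := face_step le_n lt_ia hc dc.
  by exists (b1 + b2); [exact: supD|rewrite e2 -/w e1 (zlinD dvB) addrA].
rewrite dh_att sw.
suff h k : (k <= a.+1)%N -> exists2 b, In n a q.+1 b &
    \sum_(i < k) sg i (att (del i w) c) = (if odd k then att (st n a) c else 0) + dv b.
  exact: h.
elim: k => [_|k IH lt_k]; first by exists 0; [exact: sup0|rewrite big_ord0 (zlin0 dvB) addr0].
have [b1 hb1 e1] := IH (ltnW lt_k); have [b2 hb2 e2] := face k lt_k.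
exists (b1 + sg k b2); first by apply: supD => //; exact: sup_sg.
rewrite big_ord_recr /= e1 e2 (zlinD dvB) (sg_zlin _ _ dvB) /sg.
by case: (odd k) => /=; move: (att _ c) (dv b1) (dv b2) => x y z; zmod.
Qed.

Definition surj_at m i := forall z, sup (wd (K m.+1) i) z -> db z = 0 ->
  exists c b, [/\ sup (wd (K m) i) c, sup (wd (K m.+1) i.+1) b, db c = 0 & z = c + db b].
Definition inj_at m i := forall c b, sup (wd (K m) i) c -> sup (wd (K m.+1) i.+1) b -> c = db b ->
  exists2 b', sup (wd (K m) i.+1) b' & c = db b'.
(* Exactness at [(a, q)] of the second page of the spectral sequence of the double
   complex; the extra hypothesis that [dh x] bounds says that [d^1] kills [x]. *)
Definition E2_exact n a q := forall x b, In n a q x -> dv x = 0 -> In n a.-1 q.+1 b -> dh x = dv b ->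
  exists y w, [/\ In n a.+1 q y, In n a q.+1 w, dv y = 0 & x = dh y + dv w].

(** Here the incoming [d^1] is stabilisation, hence onto. Surjectivity is used twice because
    [face_sum] only accepts cycles of the stabiliser of [a.+2] letters. *)
Lemma E2_exact_even n a q : ~~ odd a -> (a.+2 <= n <= N)%N ->
  surj_at (n - a.+1) q -> surj_at (n - a.+2) q -> E2_exact n a q.
Proof.
move=> ev le_n S1 S2 x _ hx dx _ _; have /andP[le_an le_nN] := le_n.
have la : (a <= n <= N)%N by rewrite le_nN andbT; lia.
have la1 : (a < n <= N)%N by rewrite le_nN andbT; lia.
have [u [w [hu hw du ex]]] := shapiro_surj la hx dx.
have e1 : (n - a.+1).+1 = (n - a)%N by lia.
have e2 : (n - a.+2).+1 = (n - a.+1)%N by lia.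
rewrite /surj_at e1 in S1; rewrite /surj_at e2 in S2.
have [c [b [hc hb dc eu]]] := S1 u hu du; have [c' [b' [hc' hb' dc' ec]]] := S2 c hc dc.
have [b2 hb2 e] := face_sum le_n hc' dc'.
rewrite /= ev in e.
have hb'n : sup (wd (K (n - a)) q.+1) b'.
  by apply: sup_imp hb' => s [h1 h2]; split => //; apply: sub_all h2 => g; apply: K_mono; lia.
have hc'n : sup (wd (K (n - a.+1)) q) c'.
  by apply: sup_imp hc' => s [h1 h2]; split => //; apply: sub_all h2 => g; apply: K_mono; lia.
exists (att (st n a.+1) c'), (att (st n a) (b + b') + w - b2); split.
- exact: att_st_In.
- apply: supB => //; apply: supD => //; apply: att_st_In => //; exact: supD.
- by rewrite (dv_att_st la1 hc'n) dc' (zlin0 (attB _)).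
- rewrite e dvB (zlinD dvB) (dv_att_st la (supD hb hb'n)) ex eu ec.
  rewrite (zlinD dbB b b') (zlinD (attB (st n a)) (db b)) (zlinD (attB (st n a)) (c' + db b')) (zlinD (attB (st n a)) c').
  zmod.
Qed.

(** Here the outgoing [d^1] is stabilisation, hence injective: if [dh x] bounds, so does [x], and no
    preimage under [dh] is needed. *)
Lemma E2_exact_odd n a q : odd a -> (a.+1 <= n <= N)%N ->
  surj_at (n - a.+1) q -> inj_at (n - a) q -> E2_exact n a q.
Proof.
case: a => // a od le_n S1 I1 x b hx dx hb edh; have /andP[le_an le_nN] := le_n.
have la : (a.+1 <= n <= N)%N by rewrite le_nN andbT; lia.
have la0 : (a <= n <= N)%N by rewrite le_nN andbT; lia.
have [u [w [hu hw du ex]]] := shapiro_surj la hx dx.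
have e1 : (n - a.+2).+1 = (n - a.+1)%N by lia.
have e2 : (n - a.+1).+1 = (n - a)%N by lia.
rewrite /surj_at e1 in S1; rewrite /inj_at e2 in I1.
have [c [b1 [hc hb1 dc eu]]] := S1 u hu du.
have [b2 hb2 e] := face_sum le_n hc dc; rewrite od in e.
have hcn m : (n - a.+2 <= m <= N)%N -> sup (wd (K m) q) c.
  by move=> hm; apply: sup_imp hc => s [h1 h2]; split => //; apply: sub_all h2 => g; apply: K_mono.
have [|||b3 hb3 e3] := @shapiro_inj n a la0 q c (b - dh (att (st n a.+1) b1 + w) - b2) _ _ _.
- by apply: hcn; lia.
- apply: supB => //; apply: supB => //; apply: dh_In; apply: supD => //; exact: att_st_In.
- rewrite !dvB -edh -dh_dv // (zlinD dvB) (dv_att_st la hb1) ex eu (zlinD (attB (st n a.+1)) c) (zlinD (@dhB _ _ _) (att _ _ + _)) (zlinD (@dhB _ _ _) (att _ c)) (zlinD (@dhB _ _ _) (att _ _)) e.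
  zmod.
have [|b4 hb4 e4] := I1 c b3 _ hb3 e3; first by apply: hcn; lia.
exists 0, (att (st n a.+1) (b4 + b1) + w); split; first exact: sup0.
- by apply: supD => //; apply: att_st_In => //; exact: supD.
- exact: zlin0 dvB.
- rewrite (zlin0 (@dhB _ _ _)) add0r (zlinD dvB) (dv_att_st la (supD hb4 hb1)) (zlinD dbB b4) -e4 -eu.
  exact: ex.
Qed.

(** The cycle [dv x] of the row lifts to some [y] one column further, which by induction may be
    taken with [dv y = 0]. Exactness at [y] gives [y = dh u + dv w], and then [x - dh w] is the
    required correction. *)
Lemma zigzag n d q : (n <= N)%N -> acyc M R (P n) d -> forall a, (a + q <= d.+1)%N ->
  (forall a' q', (a < a')%N -> (a' + q' = a + q)%N -> E2_exact n a' q') ->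
  forall x, In n a q x -> dv (dh x) = 0 -> exists x', [/\ In n a q x', dv x' = 0 & dh x' = dh x].
Proof.
move=> le_nN acy; elim: q => [|q IH] a le_d hE x hx ddx.
  by exists x; split => //; exact: dv_deg0 hx.
have hdx : In n a q (dv x) by exact: dv_In.
have [||y hy ey] := row_exact (d := d) (K := K n) acy _ hdx; first by lia.
  by rewrite dh_dv.
have [||| y' [hy' dy' ey']] := IH a.+1 _ _ y hy; first by lia.
- by move=> a' q' lt e; apply: hE; lia.
- by rewrite ey dv_dv.
have [|||u [w [hu hw du eu]]] := hE a.+1 q _ _ y' x hy' dy' hx; try lia.
  by rewrite ey' ey.
exists (x - dh w); split.
- by apply: supB => //; exact: dh_In.
- by rewrite dvB -dh_dv // -[dv x]ey -ey' eu (zlinD (@dhB _ _ _)) dh_dh add0r subrr.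
- by rewrite (@dhB _ _ _) dh_dh subr0.
Qed.

Variables (kap c : nat).
Hypotheses (kap_gt2 : (2 < kap)%N) (c_gt0 : (0 < c)%N).
Hypothesis acy : forall n d, (n <= N)%N -> (kap * d + c <= n)%N -> acyc M R (P n) d.

Lemma kap_ge b e : (b <= 3 * e)%N -> (b <= kap * e)%N.
Proof. by move=> h; apply: leq_trans h _; rewrite leq_mul2r kap_gt2 orbT. Qed.

Lemma stability_frames i :
  (forall m, (m < N)%N -> (kap * i + c <= m.+1)%N -> surj_at m i) /\
  (forall m, (m < N)%N -> (kap * i + kap + c <= m.+1)%N -> inj_at m i).
Proof.
elim/ltn_ind: i => i IH.
(* The slope has to be at least 3 because of the column [a = 2]: two uses of surjectivity require
   [a.+1 <= kap * (a - 1)]. *)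
have hE m a q : (m < N)%N -> (1 < a)%N -> (a + q <= i.+2)%N -> (q < i)%N ->
    (kap * (a + q - 1) + c <= m.+1)%N -> E2_exact m.+1 a q.
  move=> lt_mN a_gt1 aqi lt_qi le_m.
  have [S I] := IH q lt_qi.
  have e1 : (kap * (a + q - 1) = kap * q + kap * (a - 1))%N by rewrite -mulnDr; congr muln; lia.
  have [od|ev] := boolP (odd a).
    have a_gt2 : (2 < a)%N by move: od a_gt1; case: (a) => [|[|[|]]].
    have e2 : (kap * (a - 1) = kap + kap * (a - 2))%N by rewrite -mulnS; congr muln; lia.
    have := @kap_ge (a - 1) (a - 2); have := @kap_ge 0 q => *.
    by apply: E2_exact_odd => //; [lia|apply: S; lia|apply: I; lia].
  have := @kap_ge a.+1 (a - 1); have := @kap_ge 0 q => *.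
  by apply: E2_exact_even => //; [lia|apply: S; lia|apply: S; lia].
(* A cycle on the empty word lifts to words of one letter. The zigzag makes the lift a vertical
   cycle, Shapiro's lemma moves it into the smaller group, and the error becomes a boundary on the
   empty word. *)
have S : forall m, (m < N)%N -> (kap * i + c <= m.+1)%N -> surj_at m i.
  move=> m lt_mN le_m z hz dz.
  have hz0 : In m.+1 0 i (att [::] z) by apply: sup_wd_att.
  have [|x hx ex] := row_exact (acy lt_mN le_m) (leq0n _) hz0; first exact: dh_att0.
  have [|||x' [hx' dx' ex']] := @zigzag m.+1 i i lt_mN (acy lt_mN le_m) 1%N _ _ x hx.
  - by [].
  - move=> a q a_gt1 eq; apply: hE => //; lia.
  - by rewrite ex dv_att0 dz (zlin0 (attB _)).
  have le1 : (1 <= m.+1 <= N)%N by [].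
  have [u [w [hu hw du e]]] := shapiro_surj le1 hx' dx'.
  rewrite subn1 /= in hu.
  have hu' : sup (wd (K m.+1) i) u.
    by apply: sup_imp hu => s [h1 h2]; split => //; apply: sub_all h2 => g; apply: K_mono; lia.
  exists u, (kmap snd (dh w)).
  have hdw : In m.+1 0 i.+1 (dh w) by exact: dh_In.
  have edw : dh w = att [::] (kmap snd (dh w)).
    move: (dh w) hdw; apply: gen_eq => [||[v s] n [/= [_ /size0nil ->] _ _]]; first exact: zlin_id.
      by apply: zlin_comp; [exact: attB|exact: kmapB].
    by rewrite /attach !kmapU.
  split => //; first exact: sup_kmap_snd hdw.
  apply: (@att_inj [::]); rewrite (zlinD (attB [::]) u) -dv_att0 -edw -ex -ex' e.
  rewrite (zlinD (@dhB _ _ _)) dh_dv //; congr (_ + _).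
  have [_] := st_fr le1; case: (st m.+1 1) => [|v [|]] // _.
  by rewrite dh_att_cons // dh_att0 (zlin0 (cfB v)) subr0.
split=> // m lt_mN le_m u b hu hb eu.
(* Injectivity has to fill a chain of bar degree [i.+1], so it needs rows exact one length further;
   this is the additional [kap] in its range. *)
have le_m' : (kap * i.+1 + c <= m.+1)%N by rewrite mulnS; lia.
have acy' := acy lt_mN le_m'.
have hb0 : In m.+1 0 i.+1 (att [::] b) by apply: sup_wd_att.
have [|y hy ey] := row_exact acy' (leq0n _) hb0; first exact: dh_att0.
have le1 : (1 <= m.+1 <= N)%N by [].
have du : db u = 0 by rewrite eu db_db.
have hu1 : sup (wd (K (m.+1 - 1)) i) u by rewrite subn1.
have hx0 := att_st_In le1 hu1.
set x0 := att (st m.+1 1) u in hx0.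
have dhx0 : dh x0 = att [::] u.
  rewrite /x0; have [_] := st_fr le1; case: (st m.+1 1) => [|v [|]] // _.
  by rewrite dh_att_cons // dh_att0 (zlin0 (cfB v)) subr0.
have dx0 : dv x0 = 0 by rewrite /x0 (dv_att_st le1 hu1) du (zlin0 (attB _)).
have hx1 : In m.+1 1 i (x0 - dv y) by apply: supB => //; apply: dv_In.
have [||e he ee] := row_exact acy' _ hx1; first by [].
  by rewrite (@dhB _ _ _) dhx0 dh_dv // ey dv_att0 -eu subrr.
have := @kap_ge 3 1; have := @kap_ge 0 i; rewrite muln1 => ki k3.
have [|||e' [he' de' ee']] := @zigzag m.+1 i.+1 i lt_mN acy' 2%N _ _ e he.
- by [].
- move=> a q a_gt2 eq; apply: hE => //; lia.
- by rewrite ee dvB dv_dv // dx0 subr0.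
have le2 : (2 <= m.+1 <= N)%N by lia.
have le3 : (3 <= m.+1 <= N)%N by lia.
have [v [w [hv hw dv0 e2]]] := shapiro_surj le2 he' de'.
(* From column 2 to column 1 [d^1] vanishes, but only on cycles of the stabiliser of three letters.
   The surjectivity just proved, in the same degree [i], brings [v] there. *)
have Sm : surj_at (m.+1 - 3) i by apply: S; lia.
have e3 : (m.+1 - 3).+1 = (m.+1 - 2)%N by lia.
rewrite /surj_at e3 in Sm; have [v1 [b1 [hv1 hb1 dv1 ev]]] := Sm v hv dv0.
have [b2 hb2 e4] := face_sum le3 hv1 dv1; rewrite /= add0r in e4.
have [||b' hb' e5] := @shapiro_inj _ _ le1 i u (y + b2 + dh (att (st m.+1 2) b1 + w)) hu1 _ _.
- apply: supD; first exact: supD.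
  by apply: dh_In; apply: supD => //; exact: att_st_In.
- rewrite !(zlinD dvB) -dh_dv // (zlinD dvB) (dv_att_st le2 hb1) -/x0.
  have -> : x0 = dv y + dh e' by rewrite ee' ee; zmod.
  rewrite e2 ev (zlinD (attB (st m.+1 2)) v1) !(zlinD (@dhB _ _ _)) e4.
  zmod.
by exists b' => //; rewrite subn1 in hb'.
Qed.
End Stability.

(** * Orthogonal groups and frames *)

Section Dot.
Variables (A : comUnitRingType) (n : nat).
Implicit Types x y z : 'rV[A]_n.
Definition dot x y : A := (x *m y^T) 0 0.

Lemma dotE x y : dot x y = \sum_j x 0 j * y 0 j.
Proof. by rewrite /dot mxE; apply: eq_bigr => j _; rewrite mxE. Qed.
Lemma dotC x y : dot x y = dot y x.
Proof. by rewrite !dotE; apply: eq_bigr => j _; rewrite mulrC. Qed.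
Lemma dotDl x y z : dot (x + y) z = dot x z + dot y z.
Proof. by rewrite /dot mulmxDl mxE. Qed.
Lemma dotDr x y z : dot z (x + y) = dot z x + dot z y.
Proof. by rewrite dotC dotDl !(dotC z). Qed.
Lemma dotZl a x y : dot (a *: x) y = a * dot x y.
Proof. by rewrite /dot -scalemxAl mxE. Qed.
Lemma dotZr a x y : dot x (a *: y) = a * dot x y.
Proof. by rewrite dotC dotZl dotC. Qed.
Lemma dotNl x y : dot (- x) y = - dot x y.
Proof. by rewrite /dot mulNmx mxE. Qed.
Lemma dotNr x y : dot x (- y) = - dot x y.
Proof. by rewrite dotC dotNl dotC. Qed.
Lemma dotBl x y z : dot (x - y) z = dot x z - dot y z.
Proof. by rewrite dotDl dotNl. Qed.
Lemma dotBr x y z : dot z (x - y) = dot z x - dot z y.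
Proof. by rewrite dotDr dotNr. Qed.
Lemma dot0l x : dot 0 x = 0. Proof. by rewrite /dot mul0mx mxE. Qed.
Lemma dot0r x : dot x 0 = 0. Proof. by rewrite dotC dot0l. Qed.
Lemma dot_mx x y : x *m y^T = (dot x y)%:M.
Proof. by rewrite [LHS]mx11_scalar. Qed.
Lemma dot_row p x (U : 'M[A]_(p, n)) i : dot x (row i U) = (x *m U^T) 0 i.
Proof. by rewrite dotE mxE; apply: eq_bigr => j _; rewrite !mxE. Qed.

(* A junk value unless [dot z z] is a unit. *)
Definition refl z : 'M[A]_n := 1%:M - (2%:R / dot z z) *: (z^T *m z).

Lemma mul_refl x z : x *m refl z = x - (2%:R * dot x z / dot z z) *: z.
Proof.
rewrite /refl mulmxBr mulmx1 -scalemxAr mulmxA dot_mx mul_scalar_mx scalerA.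
by rewrite mulrAC.
Qed.

Lemma refl_tr z : (refl z)^T = refl z.
Proof. by rewrite /refl linearB /= trmx1 linearZ /= trmx_mul trmxK. Qed.

Lemma reflN z : refl (- z) = refl z.
Proof.
rewrite /refl dotNl dotNr opprK; congr (_ - _ *: _).
by rewrite mulmxN (_ : (- z)^T = - z^T) ?mulNmx ?opprK //; apply/matrixP => i j; rewrite !mxE.
Qed.

Lemma refl_refl z : dot z z \is a GRing.unit -> refl z *m refl z = 1%:M.
Proof.
move=> uz; apply/row_matrixP => i; rewrite !rowE mulmx1 mulmxA.
set x := delta_mx 0 i; rewrite !mul_refl; set b := dot x z.
rewrite dotBl dotZl -/b divrK // -[in RHS](addr0 x) -addrA -opprD -scalerDl; congr (x + _).
have -> : 2%:R * b / dot z z + 2%:R * (b - 2%:R * b) / dot z z = 0 by ring.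
by rewrite scale0r oppr0.
Qed.
End Dot.

Lemma dot_mulr (A : comUnitRingType) m n (x : 'rV[A]_m) (f : 'M[A]_(m, n)) y :
  dot (x *m f) y = dot x (y *m f^T).
Proof. by rewrite /dot trmx_mul trmxK mulmxA. Qed.

Section OrthogonalGroup.
Variables (A : comUnitRingType) (N : nat).
Local Notation vec := 'rV[A]_N.

Record ortho := Ortho { oval :> 'M[A]_N; ovalP : oval *m oval^T == 1%:M }.
HB.instance Definition _ := [isSub for oval].
HB.instance Definition _ := [Choice of ortho by <:].

Lemma ortho_tr (g : ortho) : g^T *m g = 1%:M.
Proof. by apply: mulmx1C; apply/eqP/ovalP. Qed.
Lemma ortho_tr' (g : ortho) : g *m g^T = 1%:M.
Proof. by apply/eqP/ovalP. Qed.
Lemma ortho_one_subproof : (1%:M : 'M[A]_N) *m 1%:M^T == 1%:M.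
Proof. by rewrite trmx1 mulmx1. Qed.
Lemma ortho_mul_subproof (g h : ortho) : (g *m h) *m (g *m h)^T == 1%:M.
Proof. by rewrite trmx_mul mulmxA -(mulmxA g) ortho_tr' mulmx1 ortho_tr'. Qed.
Lemma ortho_inv_subproof (g : ortho) : (g^T : 'M[A]_N) *m g^T^T == 1%:M.
Proof. by rewrite trmxK ortho_tr. Qed.
Definition ortho_one := Ortho ortho_one_subproof.
Definition ortho_mul g h := Ortho (ortho_mul_subproof g h).
Definition ortho_inv g := Ortho (ortho_inv_subproof g).

Lemma ortho_mulA : associative ortho_mul.
Proof. by move=> f g h; apply: val_inj; exact: mulmxA. Qed.
Lemma ortho_mul1 : left_id ortho_one ortho_mul.
Proof. by move=> f; apply: val_inj; exact: mul1mx. Qed.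
Lemma ortho_1mul : right_id ortho_one ortho_mul.
Proof. by move=> f; apply: val_inj; exact: mulmx1. Qed.
Lemma ortho_mulV : left_inverse ortho_one ortho_inv ortho_mul.
Proof. by move=> f; apply: val_inj; exact: ortho_tr. Qed.
Lemma ortho_Vmul : right_inverse ortho_one ortho_inv ortho_mul.
Proof. by move=> f; apply: val_inj; exact: ortho_tr'. Qed.
HB.instance Definition _ := isGroup.Build ortho ortho_mulA ortho_mul1 ortho_1mul
  ortho_mulV ortho_Vmul.

Lemma ovalM (g h : ortho) : oval (g * h)%g = g *m h. Proof. by []. Qed.
Lemma ovalV (g : ortho) : oval g^-1%g = g^T. Proof. by []. Qed.
Lemma oval1 : oval (1%g : ortho) = 1%:M. Proof. by []. Qed.

Lemma dot_ortho (g : ortho) (x y : vec) : dot (x *m g) (y *m g) = dot x y.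
Proof. by rewrite dot_mulr -mulmxA ortho_tr' mulmx1. Qed.

Lemma refl_ortho_subproof (z : vec) : dot z z \is a GRing.unit -> refl z *m (refl z)^T == 1%:M.
Proof. by move=> uz; rewrite refl_tr refl_refl. Qed.
Definition orefl z (uz : dot z z \is a GRing.unit) := Ortho (refl_ortho_subproof uz).

Hypothesis unit2 : (2%:R : A) \is a GRing.unit.
Hypothesis loc : forall a b : A, a + b \is a GRing.unit ->
  (a \is a GRing.unit) || (b \is a GRing.unit).

Lemma refl_swap (x y : vec) : dot x x = dot y y -> dot (x - y) (x - y) \is a GRing.unit ->
  x *m refl (x - y) = y.
Proof.
move=> e u; rewrite mul_refl.
have -> : 2%:R * dot x (x - y) = dot (x - y) (x - y).
  by rewrite !dotBl !dotBr -e (dotC y x); ring.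
by rewrite divrr // scale1r subKr.
Qed.

Lemma refl_fix (x z : vec) : dot x z = 0 -> x *m refl z = x.
Proof. by move=> h; rewrite mul_refl h mulr0 mul0r scale0r subr0. Qed.

(* For unit vectors one of [x - y] and [x + y] can be reflected in, as
   [q (x - y) + q (x + y) = 4]. *)
Lemma unit_vec_trans (x y : vec) : dot x x = 1 -> dot y y = 1 ->
  exists2 g : ortho, x *m g = y & forall z : vec, dot z x = 0 -> dot z y = 0 -> z *m g = z.
Proof.
move=> qx qy.
have : dot (x - y) (x - y) + dot (x + y) (x + y) \is a GRing.unit.
  have -> : dot (x - y) (x - y) + dot (x + y) (x + y) = 2%:R * 2%:R.
    by rewrite !dotBl !dotBr !dotDl !dotDr qx qy (dotC y x); ring.
  by rewrite unitrM unit2.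
case/loc/orP => u.
  exists (orefl u) => [|z zx zy]; first by apply: refl_swap; rewrite ?qx.
  by apply: refl_fix; rewrite dotBr zx zy subr0.
have uy : dot y y \is a GRing.unit by rewrite qy unitr1.
exists (orefl u * orefl uy)%g => [|z zx zy]; rewrite ovalM mulmxA /=.
  have -> : x *m refl (x + y) = - y.
    by rewrite -{1}[y]opprK; apply: refl_swap; rewrite ?dotNl ?dotNr ?opprK ?qx.
  rewrite mul_refl dotNl qy mulrN1 divr1 scaleNr opprK scaler_nat mulr2n.
  by rewrite addKr.
by rewrite !refl_fix // dotDr zx zy addr0.
Qed.

Definition perpv : rel vec := fun x y => dot x y == 0.
Definition onf (w : seq vec) := all (fun x => dot x x == 1) w && pairwise perpv w.
Definition actv (x : vec) (g : ortho) : vec := x *m g.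

Lemma onf_act w g : onf w -> onf (map (actv^~ g) w).
Proof.
case/andP => h1 h2; apply/andP; split.
  by rewrite all_map; apply: sub_all h1 => x; rewrite /= /actv dot_ortho.
have e : relpre (actv^~ g) perpv =2 perpv by move=> x y; rewrite /= /perpv /actv dot_ortho.
by rewrite pairwise_map; have := eq_pairwise e w; rewrite -!topredE /= => ->.
Qed.

Lemma actvM x g h : actv (actv x g) h = actv x (g * h)%g.
Proof. by rewrite /actv ovalM mulmxA. Qed.
Lemma actv1 x : actv x 1%g = x. Proof. exact: mulmx1. Qed.

Lemma onf_rcons w x : onf (rcons w x) ->
  [/\ onf w, dot x x = 1 & forall y, y \in w -> dot y x = 0].
Proof.
rewrite /onf all_rcons pairwise_rcons => /andP[/andP[/eqP h1 h2] /andP[h3 h4]].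
by split; [rewrite h2|by []|move=> y yw; apply/eqP; move/allP: h3; apply].
Qed.

(** Vectors already matched are orthogonal both to the next vector and to its target, so the
    reflections that match the next vector fix them. *)
Lemma onf_trans w w' : onf w -> onf w' -> size w = size w' ->
  exists g : ortho, map (actv^~ g) w = w'.
Proof.
elim/last_ind: w w' => [|w x IH] w'; first by case: w' => // _ _ _; exists 1%g.
case/lastP: w' => [|w' x']; first by rewrite size_rcons.
move=> h h'; rewrite !size_rcons => -[ss].
have [h1 qx hx] := onf_rcons h; have [h1' qx' hx'] := onf_rcons h'.
have [g eg] := IH w' h1 h1' ss.
have [||f ef ff] := @unit_vec_trans (actv x g) x'; rewrite ?dot_ortho //.
exists (g * f)%g; rewrite map_rcons; congr rcons; last by rewrite -actvM /actv ef.
rewrite -[RHS]eg; apply/eq_in_map => y yw /=; rewrite -actvM; apply: ff.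
  by rewrite dot_ortho hx.
by apply: hx'; rewrite -eg; exact: (map_f (actv^~ g)).
Qed.
End OrthogonalGroup.

(** * Standard frames, their stabilisers, and acyclicity *)

Section Frames.
Variables (A : comUnitRingType) (N : nat).
Hypothesis unit2 : (2%:R : A) \is a GRing.unit.
Hypothesis loc : forall a b : A, a + b \is a GRing.unit ->
  (a \is a GRing.unit) || (b \is a GRing.unit).
Local Notation vec := 'rV[A]_N.
Local Notation G := (ortho A N).
Local Notation perp := (@perpv A N).

Definition e_ (j : nat) : vec := \row_i (i == j :> nat)%:R.
(** Level [n] is cut out of [A^N] by the basis vectors from [n] on: their stabiliser is [Kn n],
    their unit complement [Pn n]. The standard frame [st n a] directly precedes them, so appending
    the tail to it gives the tail of level [n - a]. *)
Definition tail (n : nat) : seq vec := [seq e_ j | j <- iota n (N - n)].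
Definition st (n a : nat) : seq vec := [seq e_ j | j <- iota (n - a) a].
Definition Pn (n : nat) : pred vec := [pred x | (dot x x == 1) && all (perp x) (tail n)].
Definition PF (F us : seq vec) : pred vec :=
  [pred x | [&& dot x x == 1, all (perp x) F & all (perp x) us]].
Definition Kn (n : nat) : pred G := [pred g | all (fun x => actv x g == x) (tail n)].

Lemma dot_e x (j : 'I_N) : dot x (e_ j) = x 0 j.
Proof.
rewrite dotE (bigD1 j) //= mxE eqxx mulr1 big1 ?addr0 // => i /negbTE h.
by rewrite mxE -val_eqE /= in h *; rewrite h mulr0.
Qed.

Lemma dot_ee i j : (i < N)%N -> (j < N)%N -> dot (e_ i) (e_ j) = (i == j)%:R.
Proof. by move=> hi hj; rewrite -[j]/(val (Ordinal hj)) dot_e mxE /= eq_sym. Qed.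

Lemma perpC : symmetric perp.
Proof. by move=> x y; rewrite /perpv dotC. Qed.

Lemma onf_cat w t : onf (w ++ t) = [&& onf w, onf t & allrel perp w t].
Proof.
rewrite /onf all_cat pairwise_cat; case: (all _ w) => //=; case: (all _ t) => //=.
  by case: allrel; rewrite ?andbT ?andbF.
by rewrite andbF.
Qed.

Lemma iota_onf b k : (b + k <= N)%N -> onf [seq e_ j | j <- iota b k].
Proof.
elim: k b => [|k IH] b le_N; first by [].
rewrite [iota _ _]/= [map _ _]/= -cat1s onf_cat IH; last by lia.
have bN : (b < N)%N by lia.
rewrite /onf /= dot_ee // !eqxx /= allrel1l; apply/allP => _ /mapP[j + ->].
rewrite mem_iota => hj; have bj : (b == j) = false by lia.
by rewrite /perpv dot_ee ?bj ?eqxx //; lia.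
Qed.

Lemma tail_onf n : onf (tail n).
Proof.
have [h|h] := leqP n N; first by apply: iota_onf; rewrite subnKC.
by rewrite /tail (_ : N - n = 0)%N //; lia.
Qed.

(** Frames of level [n] become full orthonormal words ending in the tail, so transitivity inside
    [Kn n] follows from transitivity of the ambient group. *)
Lemma valid_Pn n w : valid perp (Pn n) w = onf (w ++ tail n).
Proof.
rewrite onf_cat tail_onf /valid /onf /Pn /= -andbA [_ && allrel _ _ _]andbC andbA; congr (_ && _).
by rewrite /allrel -all_predI; apply: eq_all => x.
Qed.

Lemma st_tail n a : (a <= n <= N)%N -> st n a ++ tail n = tail (n - a).
Proof.
move=> h; rewrite /tail /st -map_cat; congr map.
have -> : (N - (n - a) = a + (N - n))%N by lia.
by rewrite iotaD subnK //; lia.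
Qed.

Lemma Kn_mul n g h : Kn n g -> Kn n h -> Kn n (g * h)%g.
Proof.
move=> /allP h1 /allP h2; apply/allP => x hx.
by rewrite -actvM (eqP (h1 x hx)) (eqP (h2 x hx)).
Qed.
Lemma Kn_inv n g : Kn n g -> Kn n g^-1%g.
Proof.
move=> /allP h; apply/allP => x hx.
by rewrite -{1}(eqP (h x hx)) actvM mulgV actv1.
Qed.

Lemma act_fix (w : seq vec) (g : G) :
  all (fun x => actv x g == x) w = (actw (@actv A N) w g == w).
Proof.
elim: w => //= x w IH; rewrite eqseq_cons -IH //.
Qed.

Lemma fr_act n a w g : Kn n g -> fr perp (Pn n) a w -> fr perp (Pn n) a (actw (@actv A N) w g).
Proof.
move=> Kg [vw sw]; split; last by rewrite size_map.
have e : actw (@actv A N) (tail n) g = tail n by apply/eqP; rewrite -act_fix.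
by move: vw; rewrite !valid_Pn => /(onf_act g); rewrite map_cat [map _ (tail n)]e.
Qed.

Lemma st_fr n a : (a <= n <= N)%N -> fr perp (Pn n) a (st n a).
Proof.
by move=> h; split; [rewrite valid_Pn st_tail // tail_onf|rewrite size_map size_iota].
Qed.

Lemma st_trans n a w : (a <= n <= N)%N -> fr perp (Pn n) a w ->
  exists g, Kn n g && (actw (@actv A N) (st n a) g == w).
Proof.
move=> le_n [vw sw]; have [vs ss] := st_fr le_n.
rewrite valid_Pn in vw; rewrite valid_Pn in vs.
have [|g eg] := onf_trans unit2 loc vs vw; first by rewrite !size_cat ss sw.
exists g; move/eqP: eg; rewrite map_cat eqseq_cat ?size_map ?size_iota ?sw //.
by case/andP=> h1 h2; rewrite /Kn /= act_fix h1 andbT.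
Qed.

Lemma stabP n a g : (a <= n <= N)%N ->
  Kn (n - a) g <-> Kn n g /\ actw (@actv A N) (st n a) g = st n a.
Proof.
move=> h; rewrite /Kn /= -(st_tail h) all_cat act_fix; split.
  by case/andP => /eqP.
by case=> -> ->; rewrite eqxx.
Qed.

Lemma st_behead n a : (a < n <= N)%N -> behead (st n a.+1) = st n a.
Proof. by move=> h; rewrite /st /=; congr (map _ (iota _ _)); lia. Qed.

Lemma refl_comm (g : G) z : actv z g = z -> g *m refl z = refl z *m g.
Proof.
move=> e; have e' : z *m g^T = z.
  by rewrite -{1}e /actv -mulmxA ortho_tr' mulmx1.
rewrite /refl mulmxBr mulmxBl mulmx1 mul1mx -scalemxAr -scalemxAl -mulmxA [z *m g]e.
congr (_ - _ *: _); rewrite mulmxA; congr (_ *m _).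
by rewrite -[g : 'M_N]trmxK -trmx_mul e'.
Qed.

Lemma e_sub i j : (i < N)%N -> (j < N)%N -> i != j ->
  dot (e_ i - e_ j) (e_ i - e_ j) = 2%:R.
Proof.
move=> hi hj /negbTE ij; have ji : (j == i) = false by rewrite eq_sym.
by rewrite dotBl !dotBr !dot_ee // !eqxx ij ji /=; ring.
Qed.

(* Consecutive faces of the standard frame differ by a commutator of two reflections,
   which acts trivially on the coefficients. *)
Lemma st_face (M : Type) (ma : M -> G -> M) n a i :
  (forall (g h : G) m, ma m (g^-1 * h^-1 * g * h)%g = m) ->
  (a.+2 <= n <= N)%N -> (i < a)%N ->
  exists th, [/\ Kn n th, forall g, Kn (n - a.+2) g -> (g * th = th * g)%g,
    forall m, ma m th = m & actw (@actv A N) (del i (st n a.+1)) th = del i.+1 (st n a.+1)].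
Proof.
move=> ma_comm /andP[le_an le_nN] lt_ia; set b := (n - a.+1)%N.
have b_gt0 : (0 < b)%N by rewrite /b; lia.
(* At position [i] the two faces have [x] and [y] respectively and they agree elsewhere; [z] is the
   spare vector. The swaps of [x, y] and of [y, z] have a 3-cycle as commutator, which sends [x] to
   [y]. *)
pose x := e_ (b + i).+1; pose y := e_ (b + i); pose z := e_ b.-1.
have h1 : ((b + i).+1 < N)%N by rewrite /b; lia.
have h2 : (b + i < N)%N by lia.
have h3 : (b.-1 < N)%N by lia.
have qx : dot (x - y) (x - y) \is a GRing.unit by rewrite e_sub //; lia.
have qy : dot (y - z) (y - z) \is a GRing.unit by rewrite e_sub //; lia.
pose t1 := orefl qx; pose t2 := orefl qy.
have t1V : (t1^-1 = t1)%g by apply: val_inj; rewrite /= refl_tr.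
have t2V : (t2^-1 = t2)%g by apply: val_inj; rewrite /= refl_tr.
have qq j : (j < N)%N -> dot (e_ j) (e_ j) = 1 by move=> hj; rewrite dot_ee // eqxx.
have fix1 j : (j < N)%N -> j != (b + i).+1 -> j != (b + i)%N -> actv (e_ j) t1 = e_ j.
  move=> hj /negbTE d1 /negbTE d2; apply: refl_fix.
  by rewrite dotBr !dot_ee // d1 d2 subrr.
have fix2 j : (j < N)%N -> j != (b + i)%N -> j != b.-1 -> actv (e_ j) t2 = e_ j.
  move=> hj /negbTE d1 /negbTE d2; apply: refl_fix.
  by rewrite dotBr !dot_ee // d1 d2 subrr.
have fixth j : (j < N)%N -> j != (b + i).+1 -> j != (b + i)%N -> j != b.-1 ->
    actv (e_ j) (t1^-1 * t2^-1 * t1 * t2)%g = e_ j.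
  move=> hj d1 d2 d3; rewrite t1V t2V -!actvM.
  by rewrite (fix1 j) // (fix2 j) // (fix1 j) // (fix2 j).
have mov : actv x (t1^-1 * t2^-1 * t1 * t2)%g = y.
  rewrite t1V t2V -!actvM.
  have -> : actv x t1 = y by apply: refl_swap => //; rewrite !qq.
  have -> : actv y t2 = z by apply: refl_swap => //; rewrite !qq.
  rewrite fix1; [|lia..].
  have e : refl (y - z) = refl (z - y).
    by rewrite -[y - z]opprB reflN.
  change (z *m refl (y - z) = y); rewrite e; apply: refl_swap; rewrite ?qq //.
  by rewrite -[z - y]opprB dotNl dotNr opprK.
exists (t1^-1 * t2^-1 * t1 * t2)%g; split.
- apply/allP => _ /mapP[j + ->]; rewrite mem_iota => hj; apply/eqP/fixth; rewrite /b in b_gt0 *; lia.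
- move=> g /allP Kg.
  have gfix j : (n - a.+2 <= j < N)%N -> actv (e_ j) g = e_ j.
    by move=> hj; apply/eqP/Kg/map_f; rewrite mem_iota; lia.
  have c1 : (g * t1 = t1 * g)%g.
    by apply: val_inj; apply: refl_comm; rewrite /actv mulmxBl; congr (_ - _); apply: gfix; lia.
  have c2 : (g * t2 = t2 * g)%g.
    by apply: val_inj; apply: refl_comm; rewrite /actv mulmxBl; congr (_ - _); apply: gfix; lia.
  by rewrite t1V t2V !mulgA c1 -(mulgA t1 g) c2 mulgA -(mulgA _ g) c1 !mulgA -(mulgA _ g) c2 !mulgA.
- by move=> m; apply: ma_comm.
- have delE k : (k <= a)%N -> del k (st n a.+1) = [seq e_ j | j <- iota b k ++ iota (b + k.+1) (a - k)].
    move=> hk; rewrite /st -/b /del -map_take -map_drop -map_cat; congr map.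
    by rewrite take_iota drop_iota (minn_idPl _) ?subSS //; lia.
  rewrite !delE //; last by lia.
  have -> : iota b i.+1 = iota b i ++ [:: (b + i)%N] by rewrite -addn1 iotaD.
  have -> : iota (b + i.+1) (a - i) = (b + i).+1 :: iota (b + i.+2) (a - i.+1).
    by rewrite (_ : a - i = (a - i.+1).+1)%N ?addnS //; lia.
  rewrite -catA !map_cat /actw map_cat; congr (_ ++ _).
    rewrite -map_comp; apply/eq_in_map => j; rewrite mem_iota => hj /=.
    by apply: fixth; lia.
  rewrite /= [actv _ _]mov; congr (_ :: _).
  rewrite -map_comp; apply/eq_in_map => j; rewrite mem_iota => hj /=.
  by apply: fixth; rewrite /b in hj *; lia.
Qed.

Definition perp_unit_vec (s c : nat) := forall l k (U : 'M[A]_(k, l)), (s * k + c <= l)%N ->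
  exists2 v : 'rV[A]_l, dot v v = 1 & v *m U^T = 0.

(** Rotating [F] onto the last basis vectors turns its complement into [A^l] with [l = N - size F],
    so a frame vector costs one dimension where a general vector of [us] costs [s]. *)
Lemma perp_unit_vec_frame s c F us : perp_unit_vec s c -> onf F -> (size F + s * size us + c <= N)%N ->
  exists v, PF F us v.
Proof.
move=> core hF le_N; pose l := (N - size F)%N.
have sF : size F = size (tail l) by rewrite /tail size_map size_iota /l; lia.
have [g eg] := onf_trans unit2 loc (tail_onf l) hF (esym sF).
pose U : 'M[A]_(size us, N) := \matrix_(i < size us) us`_i.
pose J : 'M[A]_(N, l) := pid_mx l.
have [|v qv vU] := core l (size us) (U *m g^T *m J); first by rewrite /l; lia.
have JJ : J^T *m J = 1%:M.
  by rewrite /J tr_pid_mx mul_pid_mx minnn (minn_idPr _) ?pid_mx_1 // /l leq_subr.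
exists (v *m J^T *m g); apply/and3P; split.
- by rewrite dot_ortho dot_mulr trmxK -mulmxA JJ mulmx1 qv.
- apply/allP => f; rewrite -eg => /mapP[_ /mapP[j + ->] ->]; rewrite mem_iota => hj.
  rewrite /perpv /actv dot_ortho dot_mulr trmxK.
  suff -> : e_ j *m J = 0 by rewrite dot0r.
  apply/rowP => i; rewrite mxE big1 ?mxE // => t _; rewrite !mxE.
  by case: eqP => [->|_]; rewrite ?mul0r //; case: eqP => e; rewrite /= ?mulr0 //; have := ltn_ord i; lia.
- apply/(all_nthP 0) => i hi; rewrite /perpv.
  have -> : us`_i = row (Ordinal hi) U by rewrite rowK.
  by move: vU; rewrite !trmx_mul trmxK dot_row -!mulmxA => ->; rewrite mxE.
Qed.

Lemma acyc_ext (L : choiceType) (M : zmodType) (R : rel L) (P P' : pred L) d :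
  P =1 P' -> acyc M R P d -> acyc M R P' d.
Proof.
move=> e h a z le_ad hz dz.
have ev w : valid R P w = valid R P' w by rewrite /valid (eq_all e).
have [|z' h1 h2] := h a z le_ad _ dz; first by apply: sup_imp hz => w []; rewrite ev.
by exists z' => //; apply: sup_imp h1 => w []; rewrite ev.
Qed.

(** A prefix [p] passes into the frame at cost [size p], the coning vector into [us] at cost [s],
    and [d] drops by [size p]. Since [p] is not empty, [s.+1] per unit of [d] pays for both. *)
Lemma acyc_PF (M : zmodType) s c d F us : (0 < s)%N -> perp_unit_vec s c -> onf F ->
  (size F + s.+1 * d + s * size us + c <= N)%N -> acyc M perp (PF F us) d.
Proof.
move=> s_gt0 core; elim/ltn_ind: d F us => d IH F us hF le_N.
have [|v Pv] := perp_unit_vec_frame core hF (us := us); first by lia.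
apply: (acyc_step Pv) => p vp /andP[p_gt0 le_pd].
apply: (@acyc_ext _ _ _ (PF (F ++ p) (v :: us))).
  move=> x; rewrite /perpp /PF /= all_cat [perp v x]perpC.
  have -> : all (fun q => perp q x) p = all (perp x) p by apply: eq_all => q; rewrite perpC.
  by case: (_ == 1) => //=; case: (all _ F) => //=; case: (all _ us); case: (all _ p); rewrite /= ?andbT ?andbF.
apply: IH; first by lia.
  rewrite onf_cat hF /=; case/andP: vp => /allP vp1 vp2; apply/andP; split.
    by apply/andP; split => //; apply/allP => x /vp1 /and3P[].
  by rewrite allrelC; apply/allP => x /vp1 /and3P[_ + _]; under eq_all do rewrite perpC.
rewrite size_cat /=.
suff arith f q u : (0 < q <= d)%N -> (f + s.+1 * d + s * u + c <= N)%N ->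
    (f + q + s.+1 * (d - q) + s * u.+1 + c <= N)%N.
  by apply: arith le_N; rewrite p_gt0.
case/andP=> q_gt0 le_qd; have e : (s * d = s * (d - q) + s * q)%N by rewrite -mulnDr subnK.
have e2 : (s <= s * q)%N by rewrite leq_pmulr.
by rewrite mulnS !mulSn; lia.
Qed.

Lemma acyc_Pn (M : zmodType) s c n d : (0 < s)%N -> perp_unit_vec s c -> (n <= N)%N ->
  (s.+1 * d + c <= n)%N -> acyc M perp (Pn n) d.
Proof.
move=> s_gt0 core le_nN le_n; apply: (@acyc_ext _ _ _ (PF (tail n) [::])).
  by move=> x; rewrite /PF /Pn /= andbT.
apply: (@acyc_PF M s c d (tail n) [::] s_gt0 core (tail_onf n)).
by rewrite size_map size_iota muln0; lia.
Qed.
End Frames.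

(** * Comparison of chain complexes *)

Lemma qE_dot (A : comUnitRingType) n (x : 'rV[A]_n) : qE x = dot x x.
Proof. by rewrite dotE; apply: eq_bigr => j _; rewrite expr2. Qed.

Section OrthP.
Variables (A : comUnitRingType) (n : nat).
Hypothesis unit2 : (2%:R : A) \is a GRing.unit.

Lemma orthP (f : 'M[A]_n) : orth f <-> f *m f^T == 1%:M.
Proof.
split=> [[_ hq]|/eqP hf]; last first.
  split=> [|x]; first by have [] := mulmx1_unit hf.
  by rewrite !qE_dot dot_mulr -mulmxA hf mulmx1.
have hd (x y : 'rV[A]_n) : dot (x *m f) (y *m f) = dot x y.
  apply: (mulrI unit2).
  have e (u v : 'rV[A]_n) : 2%:R * dot u v = qE (u + v) - qE u - qE v.
    by rewrite !qE_dot dotDl !dotDr (dotC v u); ring.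
  by rewrite !e -mulmxDl !hq.
apply/eqP/row_matrixP => i; apply/rowP => j.
have := hd (delta_mx 0 i) (delta_mx 0 j); rewrite -!rowE dot_row -row_mul => ->.
by rewrite dotE (bigD1 j) //= big1 ?addr0 => [|l /negbTE lj];
  rewrite !mxE ?eqxx ?lj ?mulr1 ?mulr0 // eq_sym.
Qed.

Lemma orth_invmx (f : 'M[A]_n) : orth f -> invmx f = f^T.
Proof.
move=> hf; have [uf _] := hf; move/orthP/eqP: hf => hf.
by rewrite -[LHS]mulmx1 -hf mulmxA mulVmx // mul1mx.
Qed.
End OrthP.

Section GroupFaces.
Variables (G : groupType) (M : zmodType).
Definition gface (s : seq G) (j : nat) : seq G :=
  if j == size s then take j.-1 s
  else take j.-1 s ++ (nth 1 s j.-1 * nth 1 s j)%g :: drop j.+1 s.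

Lemma gface_cons g s j : (0 < j)%N -> gface (g :: s) j.+1 = g :: gface s j.
Proof. by case: j => // j _; rewrite /gface /= eqSS; case: eqP. Qed.

Lemma sum_gface s (m : M) : \sum_(j <- iota 1 (size s)) << sg j m *g gface s j >> = dw s m.
Proof.
elim: s => [|g s IH]; first by rewrite big_nil.
rewrite [iota _ _]/= big_cons; case: s IH => [|h r] IH.
  rewrite big_nil addr0 dw1 /gface /= /sg /= genN //.
rewrite dw2 -IH (zlin_sum (@cnsB _ _ g)) -sumrN; congr (_ + _).
  by rewrite /gface /sg /= genN drop0.
rewrite (iotaDl 1 1) big_map !big_seq; apply: eq_bigr => j; rewrite mem_iota => /andP[j_gt0 _].
rewrite cnsU add1n gface_cons // /sg /=.
by case: (odd j); rewrite /= ?opprK // genN ?opprK.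
Qed.
End GroupFaces.

(** * Translation between list chains of matrices and finitely supported chains *)

Section Bridge.
Variables (A : comUnitRingType) (M : zmodType) (act : forall n : nat, 'M[A]_n -> M -> M).
Hypothesis unit2 : (2%:R : A) \is a GRing.unit.
Hypothesis actO : Oinf_module act.
Hypothesis actC : comm_trivial act.

Section Level.
Variable N : nat.
Local Notation G := (ortho A N).
Local Notation W := {malg M[seq G]}.
Local Notation chainN := (chain (Ogrp A N) M).

(* The bar complex takes right actions, whence the transpose. *)
Definition ma (m : M) (g : G) : M := act (oval g)^T m.

Lemma orth_oval (g : G) : orth (oval g).
Proof. by apply/orthP; rewrite ?ortho_tr'. Qed.
Lemma orth_ovalT (g : G) : orth (oval g)^T.
Proof. by rewrite -ovalV; exact: orth_oval. Qed.

Lemma act_zlin (f : 'M[A]_N) : orth f -> zlin (@act N f).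
Proof.
move=> hf; have [hD _] := actO N.
have h0 : act f 0 = 0 by apply: (addrI (act f 0)); rewrite -hD // !addr0.
have hN x : act f (- x) = - act f x.
  by apply: (addrI (act f x)); rewrite -hD // !subrr h0.
by move=> x y; rewrite hD // hN.
Qed.

Lemma maB g : zlin (ma^~ g). Proof. exact: act_zlin (orth_ovalT g). Qed.
Lemma maM m g h : ma (ma m g) h = ma m (g * h)%g.
Proof.
have [_ [_ [hM _]]] := actO N.
by rewrite /ma ovalM trmx_mul hM //; exact: orth_ovalT.
Qed.
Lemma ma1 m : ma m 1%g = m.
Proof. by have [_ [h1 _]] := actO N; rewrite /ma oval1 trmx1 h1. Qed.

Lemma ma_comm (g h : G) m : ma m (g^-1 * h^-1 * g * h)%g = m.
Proof.
rewrite -[in RHS](actC m (orth_oval h) (orth_oval g)) /ma !ovalM !trmx_mul !trmxK.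
by rewrite !orth_invmx ?mulmxA //; exact: orth_oval.
Qed.

(** Non-orthogonal matrices get the junk value 1; [okw] and [okc] keep them out. *)
Definition enc (f : 'M[A]_N) : G := insubd (1%g : G) f.
Lemma encK f : orth f -> oval (enc f) = f.
Proof. by move/(orthP unit2) => h; rewrite /enc insubdK. Qed.
Lemma ovalK g : enc (oval g) = g.
Proof. exact: valKd. Qed.

Definition okw (s : seq 'M[A]_N) := forall g, g \in s -> orth g.
Definition okc (c : chainN) := forall p, p \in c -> okw p.1.

Definition toM (c : chainN) : W := \sum_(p <- c) << p.2 *g map enc p.1 >>.

Lemma okw_enc s : okw s -> map (@oval A N) (map enc s) = s.
Proof.
move=> h; rewrite -map_comp -[RHS]map_id; apply/eq_in_map => g gs /=.
by rewrite encK //; apply: h.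
Qed.

Lemma okw_oval (s : seq G) : okw (map (@oval A N) s).
Proof. by move=> _ /mapP[g _ ->]; exact: orth_oval. Qed.

Lemma coef_toM c k : okc c -> (toM c)@_k = coef c (map (@oval A N) k).
Proof.
move=> hc; have e : zlin (@mcoeff _ M k) by move=> x y; exact: mcoeffB.
transitivity (\sum_(p <- c) p.2 *+ (map enc p.1 == k)).
  by rewrite /toM (zlin_sum e); apply: eq_bigr => p _; rewrite coef_gen.
rewrite /coef [RHS]big_mkcond /= !big_seq; apply: eq_bigr => p pc.
suff -> : (map enc p.1 == k) = (p.1 == map (@oval A N) k) by case: eqP.
have hp : okw p.1 by exact: hc.
apply/eqP/eqP => [<-|->]; first by rewrite okw_enc.
by rewrite -map_comp -[RHS]map_id; apply: eq_map => g /=; exact: ovalK.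
Qed.

Lemma coef_bad c s : okc c -> ~ okw s -> coef c s = 0.
Proof.
move=> hc hs; rewrite /coef big_seq_cond big1 // => p /andP[pc /eqP e].
by case: hs; rewrite -e; apply: hc.
Qed.

Lemma okwP s : okw s \/ ~ okw s.
Proof.
have [h|h] := boolP (all (fun g : 'M[A]_N => g *m g^T == 1%:M) s); [left|right].
  by move=> g gs; apply/(orthP unit2); move/allP: h; apply.
by move=> h'; case/negP: h; apply/allP => g /h' /(orthP unit2).
Qed.

Lemma toM_eq c c' : okc c -> okc c' -> toM c = toM c' -> forall s, coef c s = coef c' s.
Proof.
move=> hc hc' e s; case: (okwP s) => hs; last by rewrite !coef_bad.
by rewrite -(okw_enc hs) -!coef_toM // e.
Qed.

Lemma eq_toM c c' : okc c -> okc c' -> (forall s, coef c s = coef c' s) -> toM c = toM c'.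
Proof. by move=> hc hc' e; apply/malgP => k; rewrite !coef_toM. Qed.

Lemma toM_cat c c' : toM (c ++ c') = toM c + toM c'.
Proof. by rewrite /toM big_cat. Qed.

Lemma toM_neg c : toM (negc c) = - toM c.
Proof.
rewrite /toM /negc big_map -sumrN; apply: eq_bigr => p _.
by rewrite /= genN.
Qed.

Lemma okw_face s j : okw s -> (0 < j <= size s)%N -> okw (@face (Ogrp A N) s j).
Proof.
move=> hs /andP[j0 le_j]; rewrite /face; case: eqP => [_|/eqP ne] g.
  by move/mem_take; apply: hs.
have lt_j : (j < size s)%N by rewrite ltn_neqAle ne.
have lt_j1 : (j.-1 < size s)%N by exact: leq_ltn_trans (leq_pred _) lt_j.
rewrite mem_cat in_cons => /or3P[/mem_take|/eqP->|/mem_drop]; try exact: hs.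
have h1 : orth (nth (@gone (Ogrp A N)) s j.-1) by apply/hs/mem_nth.
have h2 : orth (nth (@gone (Ogrp A N)) s j) by apply/hs/mem_nth.
have := orth_oval (enc (nth (@gone (Ogrp A N)) s j.-1) * enc (nth (@gone (Ogrp A N)) s j))%g.
by rewrite ovalM !encK.
Qed.

Lemma enc_face s j : okw s -> (0 < j <= size s)%N ->
  map enc (@face (Ogrp A N) s j) = gface (map enc s) j.
Proof.
move=> hs /andP[j0 le_j]; rewrite /face /gface size_map; case: eqP => [_|/eqP ne].
  by rewrite map_take.
have lt_j : (j < size s)%N by rewrite ltn_neqAle ne.
have lt_j1 : (j.-1 < size s)%N by exact: leq_ltn_trans (leq_pred _) lt_j.
rewrite map_cat map_take /= map_drop !(nth_map (@gone (Ogrp A N))) //.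
congr (_ ++ _ :: _); apply: val_inj.
have h1 : orth (nth (@gone (Ogrp A N)) s j.-1) by apply/hs/mem_nth.
have h2 : orth (nth (@gone (Ogrp A N)) s j) by apply/hs/mem_nth.
have := orth_oval (enc (nth (@gone (Ogrp A N)) s j.-1) * enc (nth (@gone (Ogrp A N)) s j))%g.
by rewrite ovalM !encK // => h; rewrite [LHS]encK // [RHS]ovalM !encK.
Qed.

Local Notation db := (db (@actv A N) ma).
Local Notation bdN := (@bd (Ogrp A N) M (@act N)).

Lemma okc_bd c : okc c -> okc (bdN c).
Proof.
move=> hc p /flatten_mapP[[s m] sc]; have hs := hc _ sc.
rewrite /bd_term /=; case: s sc hs => [|g r] //= sc hs.
rewrite in_cons => /orP[/eqP ->|pin].
  by move=> h /= hr; apply: hs; rewrite in_cons hr orbT.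
have pin' : p \in [seq (@face (Ogrp A N) (g :: r) j, sgn j m) | j <- iota 1 (size (g :: r))].
  exact: pin.
have [j jin ->] := mapP pin'; apply: okw_face => //.
by move: jin; rewrite mem_iota.
Qed.

Lemma toM_bd c : okc c -> toM (bdN c) = db (toM c).
Proof.
elim: c => [|[s m] c IH] hc.
  by rewrite /toM /= !big_nil (zlin0 (dbB _ maB)).
have hs : okw s by apply: (hc (s, m)); rewrite mem_head.
have hc' : okc c by move=> p pc; apply: hc; rewrite in_cons pc orbT.
have e : bdN ((s, m) :: c) = @bd_term (Ogrp A N) M (@act N) (s, m) ++ bdN c by [].
rewrite e toM_cat IH // [toM (_ :: _)]/toM big_cons (zlinD (dbB _ maB)); congr (_ + _).
rewrite /db /attach kmapU dvU; last exact: maB.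
rewrite /bar [_.1]/= [_.2]/= (zlinD (kmapB _)) kmap_att.
case: s hs {e hc} => [|g r] hs.
  by rewrite /toM /= big_nil /d0 /= (zlin0 (kmapB _)) add0r.
rewrite /bd_term /toM big_cons; congr (_ + _).
  rewrite /d0 /= kmapU; congr (gen _ _); rewrite /ma.
  have hg : orth g by apply: hs; rewrite mem_head.
  by rewrite encK // orth_invmx.
rewrite big_map -sum_gface size_map !big_seq.
apply: eq_bigr => j; rewrite mem_iota => hj.
by rewrite (@enc_face (g :: r)).
Qed.

Lemma in_deg_okc i (c : chainN) : in_deg i c -> okc c.
Proof. by move=> h p /h[]. Qed.

Lemma toM_sup i (c : chainN) (K : pred G) : in_deg i c ->
  (forall p (g : 'M[A]_N), p \in c -> g \in p.1 -> K (enc g)) ->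
  sup (wd K i) (toM c).
Proof.
move=> hc hK; apply: sup_sum => p pc _; apply: supU; split.
  by rewrite size_map; case: (hc p pc).
by apply/allP => _ /mapP[g gp ->]; apply: hK gp.
Qed.

Definition ofM (z : W) : chainN := [seq (map (@oval A N) k, z@_k) | k <- msupp z].

Lemma toM_ofM z : toM (ofM z) = z.
Proof.
rewrite /toM /ofM big_map [RHS]gen_sum; apply: eq_bigr => k _ /=; congr (gen _ _).
by rewrite -map_comp -[RHS]map_id; apply: eq_map => g /=; exact: ovalK.
Qed.

Lemma ofM_deg i K z : sup (wd K i) z -> in_deg i (ofM z).
Proof.
move=> hz p /mapP[k kz ->] /=; have [|sk _] := hz k; first by rewrite mcoeff_neq0.
by split; [rewrite size_map|exact: okw_oval].
Qed.
End Level.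

Section Step.
Variable n : nat.
Local Notation N := (n + 1)%N.
Local Notation G := (ortho A N).
Local Notation chn := (chain (Ogrp A n) M).
Local Notation sw := (map (@stab A n)).
Local Notation sc := (@mapc (Ogrp A n) (Ogrp A N) M (@stab A n)).
Local Notation bdn := (@bd (Ogrp A n) M (@act n)).
Local Notation bdN := (@bd (Ogrp A N) M (@act N)).

Lemma stab_inj : injective (@stab A n).
Proof. by move=> f g /eq_block_mx[]. Qed.
Lemma stab_mul f g : stab (f *m g) = stab f *m stab g :> 'M[A]_N.
Proof. by rewrite /stab mulmx_block !mul0mx !mulmx0 !addr0 !add0r mulmx1. Qed.
Lemma stab1 : stab 1%:M = 1%:M :> 'M[A]_N.
Proof. by rewrite /stab -scalar_mx_block. Qed.
Lemma stab_tr (f : 'M[A]_n) : (stab f)^T = stab f^T.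
Proof. by rewrite /stab tr_block_mx !trmx0 trmx1. Qed.
Lemma orth_stab (f : 'M[A]_n) : orth (stab f) <-> orth f.
Proof.
rewrite !orthP // stab_tr -stab_mul; split=> [|/eqP->]; last by rewrite stab1.
by rewrite -stab1 => /eqP/stab_inj/eqP.
Qed.
Lemma stab_invmx (f : 'M[A]_n) : orth f -> invmx (stab f) = stab (invmx f).
Proof. by move=> hf; rewrite !orth_invmx ?stab_tr //; apply/orth_stab. Qed.

Lemma tail_last : tail A N n = [:: e_ A N n].
Proof. by rewrite /tail addKn. Qed.
Lemma e_last : e_ A N n = row_mx 0 1%:M.
Proof.
apply/rowP => j; rewrite !mxE; case: splitP => k ->; rewrite !mxE.
  by rewrite ltn_eqF.
by rewrite ord1 addn0 !eqxx.
Qed.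

Lemma Kn_stab (f : 'M[A]_n) : orth f -> Kn n (enc (stab f)).
Proof.
move=> hf; rewrite /Kn /= tail_last /= andbT /actv encK //; last by apply/orth_stab.
by rewrite e_last /stab mul_row_block !mul0mx mulmx0 mul1mx addr0 add0r.
Qed.

Lemma Kn_full m g : (n < m)%N -> @Kn A N m g.
Proof. by move=> lt_nm; apply/allP => x; rewrite /tail (_ : N - m = 0)%N //; lia. Qed.

Definition res (g : G) : 'M[A]_n := ulsubmx (oval g : 'M[A]_(n + 1)).

(** If [g] fixes the last basis vector, so does its inverse [g^T]; hence both the last row and the
    last column of [g] are standard. *)
Lemma stab_res g : Kn n g -> stab (res g) = oval g.
Proof.
rewrite /Kn /= tail_last /= andbT /actv => /eqP; rewrite e_last => e1.
have e2 : row_mx 0 1%:M *m (oval g)^T = row_mx 0 1%:M :> 'M[A]_(1, N).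
  by rewrite -{1}e1 -mulmxA ortho_tr' mulmx1.
rewrite /stab /res; move: e1 e2; rewrite -{1 2 4}[oval g]submxK.
rewrite tr_block_mx !mul_row_block !mul0mx !mul1mx !add0r.
move=> /eq_row_mx[-> ->] /eq_row_mx[e _].
by rewrite -[ursubmx _]trmxK e trmx0.
Qed.

Lemma mapc_bd (c : chn) : okc c -> bdN (sc c) = sc (bdn c).
Proof.
move=> hc; rewrite /bd /mapc map_flatten -!map_comp; congr flatten.
apply/eq_in_map => -[s m] sin /=; have hs := hc _ sin.
case: s {sin} hs => [|g r] // hs; rewrite /bd_term /=; congr (_ :: _).
  congr (_, _); have hg : orth g by apply: hs; rewrite mem_head.
  rewrite stab_invmx //; have [_ [_ [_ h]]] := actO n; apply: h.
  by rewrite orth_invmx // -(encK hg); exact: orth_ovalT.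
have E j : @face (Ogrp A N) (sw (g :: r)) j = sw (@face (Ogrp A n) (g :: r) j).
  rewrite /face size_map; case: eqP => _; first by rewrite map_take.
  have nthE i : nth (@gone (Ogrp A N)) (sw (g :: r)) i = stab (nth (@gone (Ogrp A n)) (g :: r) i).
    have [h|h] := ltnP i (size (g :: r)); first exact: nth_map.
    by rewrite !nth_default ?size_map //= stab1.
  by rewrite map_cat map_take !nthE /= stab_mul map_drop.
have F l l' : l = l' -> [seq (@face (Ogrp A N) (sw (g :: r)) j, sgn j m) | j <- l] =
    [seq (sw q.1, q.2) | q <- [seq (@face (Ogrp A n) (g :: r) j, sgn j m) | j <- l']].
  by move=> ->; rewrite -map_comp; apply: eq_map => j; rewrite E.
by apply: (F (iota 1 (size (sw (g :: r)))) (iota 1 (size (g :: r)))); rewrite size_map.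
Qed.

Lemma okc_sc (c : chn) : okc c -> okc (sc c).
Proof.
move=> hc p /mapP[q qc ->] /= g /mapP[f fq ->].
by apply/orth_stab; apply: hc fq.
Qed.

Lemma coef_sc (c : chn) s : coef (sc c) (sw s) = coef c s.
Proof.
rewrite /coef /mapc big_map /=; apply: eq_bigl => p.
by rewrite (inj_eq (inj_map stab_inj)).
Qed.

(* Chains of words fixing the last basis vector, pulled back along [stab]. *)
Definition ofM1 (z : {malg M[seq G]}) : chn := [seq (map res k, z@_k) | k <- msupp z].

Lemma sc_ofM1 i z : sup (wd (@Kn A N n) i) z -> sc (ofM1 z) = ofM z.
Proof.
move=> hz; rewrite /ofM1 /ofM /mapc -map_comp; apply/eq_in_map => k kz /=.
have [|_ /allP Kk] := hz k; first by rewrite mcoeff_neq0.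
by congr (_, _); rewrite -map_comp; apply/eq_in_map => g /Kk /= /stab_res.
Qed.

Lemma ofM1_deg i z : sup (wd (@Kn A N n) i) z -> in_deg i (ofM1 z).
Proof.
move=> hz p /mapP[k kz ->] /=; have [|sk /allP Kk] := hz k; first by rewrite mcoeff_neq0.
split=> [|_ /mapP[g gk ->]]; first by rewrite size_map.
by apply/orth_stab; rewrite stab_res ?Kk //; exact: orth_oval.
Qed.

Lemma stab_in_deg i (c : chn) : in_deg i c -> in_deg i (sc c).
Proof.
move=> hc p /mapP[q /hc[sq hq] ->] /=; split; first by rewrite size_map.
by move=> _ /mapP[f /hq hf ->]; apply/orth_stab.
Qed.

Lemma sup_sc i (c : chn) : in_deg i c -> sup (wd (@Kn A N n) i) (toM (sc c)).
Proof.
move=> hc; apply: toM_sup; first exact: stab_in_deg.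
by move=> p g /mapP[q /hc[_ hq] ->] /mapP[f /hq hf ->]; exact: Kn_stab.
Qed.

Lemma toM_full m i (c : chain (Ogrp A N) M) : (n < m)%N -> in_deg i c ->
  sup (wd (@Kn A N m) i) (toM c).
Proof. by move=> lt_nm hc; apply: toM_sup => // p g _ _; exact: Kn_full. Qed.

Local Notation va := (@actv A N).
Local Notation ma := (@ma N).
Local Notation db := (db va ma).

Lemma bd_toM0 (c : chain (Ogrp A N) M) : okc c -> @is_cycle (Ogrp A N) M (@act N) c <-> db (toM c) = 0.
Proof.
move=> hc; rewrite -toM_bd //; split=> [h|h s].
  have -> : (0 : {malg M[seq G]}) = toM [::] by rewrite /toM big_nil.
  by apply: eq_toM => // [|s]; [exact: okc_bd|rewrite h /coef big_nil].
have -> : 0 = coef ([::] : chain (Ogrp A N) M) s by rewrite /coef big_nil.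
by apply: toM_eq => //; [exact: okc_bd|rewrite h /toM big_nil].
Qed.

Lemma sc_cycle (c : chn) : okc c -> db (toM (sc c)) = 0 <-> @is_cycle (Ogrp A n) M (@act n) c.
Proof.
move=> hc; rewrite -bd_toM0; last exact: okc_sc.
split=> h s; first by rewrite -coef_sc -mapc_bd // h.
rewrite mapc_bd //; case: (okwP s) => hs; last first.
  by rewrite coef_bad //; apply: okc_sc; exact: okc_bd.
have [[t e]|nt] : (exists t, s = sw t) \/ (forall t, s <> sw t).
- pose t0 := [seq res (enc f) | f : 'M[A]_N <- s].
  have [e|ne] := eqVneq s (sw t0); first by left; exists t0.
  right=> t e; case/eqP: ne; rewrite /t0 -map_comp -[LHS]map_id; apply/eq_in_map => f fs /=.
  rewrite stab_res ?encK //; first exact: hs.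
  move: fs; rewrite e => /mapP[f0 f0t ->]; apply/Kn_stab/orth_stab/hs.
  by rewrite e map_f.
- by rewrite e coef_sc h.
rewrite /coef big_seq_cond big1 // => p /andP[/mapP[q _ ->] /eqP e].
by case: (nt q.1).
Qed.

Lemma bridge_surj i : surj_at va ma (@Kn A N) n i -> stab_surj act n i.
Proof.
move=> S c2 hc2 cy2; have ok2 := in_deg_okc hc2.
have [c [b [hc hb dc e]]] := S (toM c2) (toM_full (ltnSn n) hc2) ((bd_toM0 ok2).1 cy2).
have hc1 := ofM1_deg hc; have ok1 := in_deg_okc hc1.
exists (ofM1 c); split => //; split.
  by apply/sc_cycle => //; rewrite (sc_ofM1 hc) toM_ofM.
have hb' : in_deg i.+1 (ofM (- b)) by apply: ofM_deg (supN hb).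
exists (ofM (- b)); split => //; apply: toM_eq => //.
- by apply: okc_bd => //; exact: in_deg_okc hb'.
- move=> p; rewrite mem_cat => /orP[pc|/mapP[q qc ->]]; last exact: (ok2 q qc).
  exact: (okc_sc ok1 pc).
- rewrite toM_bd //; last exact: in_deg_okc hb'.
  rewrite toM_ofM toM_cat toM_neg (sc_ofM1 hc) toM_ofM e (zlinN (dbB _ (@maB N))).
  zmod.
Qed.

Lemma bridge_inj i : inj_at va ma (@Kn A N) n i ->
  @Hinj (Ogrp A n) (Ogrp A N) M (@act n) (@act N) (@stab A n) i.
Proof.
move=> I c1 hc1 cy1 [b [hb eb]]; have ok1 := in_deg_okc hc1; have okb := in_deg_okc hb.
have [|b' hb' e] := I (toM (sc c1)) (toM b) (sup_sc hc1) (toM_full (ltnSn n) hb).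
  rewrite -toM_bd //; apply: eq_toM => //; first exact: okc_sc.
  exact: okc_bd.
have hb1 := ofM1_deg hb'; have okb1 := in_deg_okc hb1.
exists (ofM1 b'); split => // s.
rewrite -coef_sc -mapc_bd // -[RHS]coef_sc; apply: toM_eq => //.
- by apply: okc_bd => //; exact: okc_sc.
- exact: okc_sc.
- by rewrite toM_bd ?(sc_ofM1 hb') ?toM_ofM //; rewrite -(sc_ofM1 hb'); exact: okc_sc.
Qed.
End Step.

Hypothesis loc : forall a b : A, a + b \is a GRing.unit ->
  (a \is a GRing.unit) || (b \is a GRing.unit).

(** All levels that occur lie in the ambient size [n + 1], and [1 < s] makes the slope [s.+1] at
    least 3, as the zigzags require. *)
Theorem stability_perp_unit_vec s c n i : (1 < s)%N -> (0 < c)%N -> perp_unit_vec A s c ->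
  ((s.+1 * i + c <= n.+1)%N -> stab_surj act n i) /\
  ((s.+1 * i + s.+1 + c <= n.+1)%N -> stab_iso act n i).
Proof.
move=> s_gt1 c_gt0 core; pose N := (n + 1)%N.
have [|S I] := @stability_frames (ortho A N) 'rV[A]_N (@actv A N) M (@ma N)
  (@actvM A N) (@actv1 A N) (@maB N) (@maM N) (@ma1 N)
  (@perpv A N) (@Pn A N) (@Kn A N) (@st A N) N (@Kn_mul A N) (@Kn_inv A N)
  (fun m a w g _ => @fr_act A N unit2 m a w g) (@st_fr A N unit2) (@st_trans A N unit2 loc)
  (@stabP A N unit2) (@st_behead A N unit2)
  (fun m a j => @st_face A N unit2 M (@ma N) m a j (@ma_comm N))
  s.+1 c s_gt1 c_gt0 _ i.
  by move=> m d; apply: acyc_Pn => //; exact: ltnW.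
have lt_n : (n < N)%N by rewrite /N addn1.
split=> h; first exact/bridge_surj/S.
split; last exact/bridge_inj/I.
by apply/bridge_surj/S => //; lia.
Qed.
End Bridge.

(** * Unit vectors orthogonal to given vectors *)

Section Saturation.
Variable A : idomainType.
Hypothesis total : forall a b : A, (exists c, b = c * a) \/ (exists c, a = c * b).

Lemma min_dvd (s : seq A) : s != [::] ->
  exists2 x, x \in s & forall y, y \in s -> exists c, y = c * x.
Proof.
elim: s => // x s IH _; case: (eqVneq s [::]) => [->|/IH[z zs hz]].
  by exists x; rewrite ?mem_head // => y; rewrite inE => /eqP->; exists 1; rewrite mul1r.
have [[c e]|[c e]] := total x z.
  exists x; rewrite ?mem_head // => y; rewrite inE => /orP[/eqP->|/hz[d ->]].
    by exists 1; rewrite mul1r.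
  by exists (d * c); rewrite e mulrA.
exists z; rewrite ?inE ?zs ?orbT // => y; rewrite inE => /orP[/eqP->|/hz //].
by exists c.
Qed.

(* The last clause says that [G] spans no more than the saturation of [U]. *)
Lemma saturation m n (U : 'M[A]_(m, n)) :
  exists r (C : 'M_(m, r)) (G : 'M_(r, n)) (R : 'M_(n, r)),
    [/\ (r <= m)%N, U = C *m G, G *m R = 1%:M &
        forall p (E : 'M_(n, p)), U *m E = 0 -> G *m E = 0].
Proof.
elim: m U => [|m IH] U.
  exists 0%N, 0, 0, 0; split=> //; first by apply/matrixP => -[].
    by apply/matrixP => -[].
  by move=> p E _; rewrite mul0mx.
have [->|U0] := eqVneq U 0.
  exists 0%N, 0, 0, 0; split=> //; first by rewrite mul0mx.
    by apply/matrixP => -[].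
  by move=> p E _; rewrite mul0mx.
pose s := [seq U ij.1 ij.2 | ij : 'I_m.+1 * 'I_n].
have [i0 [j0 U00]] : exists i j, U i j != 0 by apply/matrix0Pn.
(* Gaussian elimination: the pivot [a] divides every entry, so its row is [a] times a row [gv] with
   entry 1 in column [j]. *)
have [|a /mapP[[i j] _ /= ea] ha] := min_dvd (s := s).
  suff : U i0 j0 \in s by case: s.
  by rewrite -[U _ _]/((fun ij => U ij.1 ij.2) (i0, j0)); apply: map_f; rewrite mem_enum.
have dvd i' j' : exists c, U i' j' = c * a.
  apply: ha; rewrite -[U _ _]/((fun ij => U ij.1 ij.2) (i', j')); apply: map_f.
  by rewrite mem_enum.
have a0 : a != 0.
  by apply: contraNneq U00 => e; have [c ->] := dvd i0 j0; rewrite e mulr0.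
have [g hg] : exists g : 'I_n -> A, forall t, U i t = g t * a by apply: (@fin_all_exists _ _ (fun t u => U i t = u * a)).
pose gv : 'rV[A]_n := \row_t g t.
have gvj : gv 0 j = 1.
  by rewrite mxE; apply: (mulIf a0); rewrite mul1r -hg ea.
pose ej : 'cV[A]_n := delta_mx j 0.
have gej : gv *m ej = 1%:M by rewrite /ej -colE [LHS]mx11_scalar !mxE -gvj mxE.
pose X : 'M[A]_(1 + m, n) := xrow 0 i U.
have eX : usubmx X = a *: gv.
  apply/rowP => t; rewrite !mxE.
  have -> : lshift m (0 : 'I_1) = 0 :> 'I_m.+1 by exact: val_inj.
  by rewrite (@tpermL _ (0 : 'I_m.+1)) hg mulrC.
pose U1 := dsubmx X; pose U2 := U1 - U1 *m ej *m gv.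
have U2e : U2 *m ej = 0 by rewrite mulmxBl -(mulmxA _ gv) gej mulmx1 subrr.
have [r [C [G [R [le_rm eU2 GR hE]]]]] := IH U2.
(* The last clause of the induction hypothesis transfers the vanishing of column [j] from [U2] to
   [G], which makes the new right inverse computable by blocks. *)
have Ge := hE _ _ U2e.
pose T := tperm_mx 0 i : 'M[A]_(1 + m).
have TT : T *m T = 1%:M by rewrite -perm_mxM tperm2 perm_mx1.
have eT : U = T *m X by rewrite /X xrowE mulmxA TT mul1mx.
have eXX : X = block_mx a%:M 0 (U1 *m ej) C *m col_mx gv G.
  rewrite mul_block_col mul0mx addr0 mul_scalar_mx -eX -eU2 /U2 addrC subrK.
  by rewrite vsubmxK.
exists (1 + r)%N, (T *m block_mx a%:M 0 (U1 *m ej) C), (col_mx gv G),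
  (row_mx ej (R - ej *m (gv *m R))); split.
- by rewrite add1n.
- by rewrite -mulmxA -eXX.
- rewrite mul_col_row gej Ge !mulmxBr GR !mulmxA gej mul1mx subrr Ge !mul0mx subr0.
  by rewrite -scalar_mx_block.
- move=> p E UE0; have XE : X *m E = 0 by rewrite -[X]mul1mx -TT -!mulmxA (mulmxA T X) -eT UE0 mulmx0.
  have gE : gv *m E = 0.
    have : usubmx X *m E = 0 by rewrite mul_usub_mx XE linear0.
    rewrite eX -scalemxAl => /eqP; rewrite scalemx_eq0 (negbTE a0) => /eqP //.
  have U1E : U1 *m E = 0 by rewrite mul_dsub_mx XE linear0.
  by rewrite mul_col_mx gE hE ?col_mx0 // mulmxBl U1E -(mulmxA _ gv) gE mulmx0 subr0.
Qed.
End Saturation.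

(** * Reduction modulo the maximal ideal, lifting, and Gram matrices *)

Section Residue.
Variables (A : idomainType) (k : fieldType) (pi : {rmorphism A -> k}).
Hypothesis resP : residue_field pi.
Hypothesis unit2 : (2%:R : A) \is a GRing.unit.
Local Notation "M ^p" := (map_mx pi M) (at level 2, format "M ^p").

Lemma pi_unit a : (a \is a GRing.unit) = (pi a != 0).
Proof.
have [_ h] := resP; apply/idP/idP => [ua|pa].
  by apply/eqP => /(h a); rewrite /maxid ua.
by apply: contraNT pa => na; apply/eqP/(h a).
Qed.

Lemma residue_loc (a b : A) : a + b \is a GRing.unit -> (a \is a GRing.unit) || (b \is a GRing.unit).
Proof.
rewrite (pi_unit a) (pi_unit b) (pi_unit (a + b)) rmorphD -negb_and.
by apply: contraNN => /andP[/eqP-> /eqP->]; rewrite addr0.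
Qed.

Lemma res2 : (2%:R : k) != 0.
Proof. by have := unit2; rewrite pi_unit rmorph_nat. Qed.

Lemma map_unitmx_pi n (X : 'M[A]_n) : (X \in unitmx) = (X^p \in unitmx).
Proof. by rewrite !unitmxE pi_unit det_map_mx unitfE. Qed.

Lemma lift_mx m n (X : 'M[k]_(m, n)) : exists Y : 'M[A]_(m, n), Y^p = X.
Proof.
have [f hf] : exists f : 'I_m * 'I_n -> A, forall ij, pi (f ij) = X ij.1 ij.2.
  by apply: (@fin_all_exists _ _ (fun ij u => pi u = X ij.1 ij.2)) => ij; case: resP => h _; exact: h.
by exists (\matrix_(i, j) f (i, j)); apply/matrixP => i j; rewrite !mxE hf.
Qed.

(** Any lift is corrected by means of the right inverse of [G]; the correction vanishes modulo the
    maximal ideal because [X] satisfies the equation there. *)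
Lemma lift_ker t r l (G : 'M[A]_(r, l)) (R : 'M[A]_(l, r)) (X : 'M[k]_(t, l)) :
  G *m R = 1%:M -> X *m (G^p)^T = 0 ->
  exists2 Y : 'M[A]_(t, l), Y^p = X & Y *m G^T = 0.
Proof.
move=> GR XG; have [Y0 eY] := lift_mx X; exists (Y0 - Y0 *m G^T *m R^T).
  by rewrite map_mxB !map_mxM eY -map_trmx XG mul0mx subr0.
by rewrite mulmxBl -[_ *m R^T *m _]mulmxA -trmx_mul GR trmx1 mulmx1 subrr.
Qed.

Lemma lift_ker_supp t r l (P : 'M[A]_l) (G : 'M[A]_(r, l)) (R : 'M[A]_(l, r)) (X : 'M[k]_(t, l)) :
  G *m R = 1%:M -> G *m P = G -> P^T = P -> P *m P = P -> X *m (G^p)^T = 0 -> X *m P^p = X ->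
  exists Y : 'M[A]_(t, l), [/\ Y^p = X, Y *m G^T = 0 & Y *m P = Y].
Proof.
move=> GR GP PT PP XG XP; have [Y eY YG] := lift_ker GR XG.
exists (Y *m P); split; first by rewrite map_mxM eY.
  by rewrite -mulmxA -{1}PT -trmx_mul GP.
by rewrite -mulmxA PP.
Qed.

(** The matrix form of the condition defining [m_A]: the rows of [X] are a basis of a non-singular
    submodule. It passes easily between [A], [k] and [K]. *)
Definition gram_unit_vec (m : nat) := forall t l (X : 'M[A]_(t, l)), (m <= t)%N ->
  X *m X^T \in unitmx -> exists y : 'rV_t, dot (y *m X) (y *m X) = 1.

(** If the rows of [C *m S] form a basis of the row space, then by symmetry [S] factors through
    [C *m S *m C^T], which therefore has the rank of [S]. *)
Lemma sym_minor (F : fieldType) n (S : 'M[F]_n) : S^T = S ->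
  exists C : 'M[F]_(\rank S, n), C *m S *m C^T \in unitmx.
Proof.
move=> sS.
have key r (D : 'M_(n, r)) (C : 'M_(r, n)) : S = D *m (C *m S) ->
    (\rank S <= \rank (C *m S *m C^T))%N.
  move=> e1; have e2 : S *m C^T *m D^T = S by rewrite -{2}sS {2}e1 !trmx_mul sS.
  have e3 : S = D *m (C *m S *m C^T) *m D^T.
    by rewrite [LHS]e1 -[in LHS]e2 !mulmxA.
  rewrite {1}e3; apply: leq_trans (mxrankM_maxl _ _) _.
  exact: mxrankM_maxr.
exists (row_base S *m pinvmx S); rewrite -row_full_unit -col_leq_rank.
apply: (key _ (col_base S)).
by rewrite mulmxKpV ?eq_row_base // mulmx_base.
Qed.

Hypothesis total : forall a b : A, (exists c, b = c * a) \/ (exists c, a = c * b).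

(** Modulo the maximal ideal the complement of [G] has dimension at least [l - r], and its radical
    has dimension at most [r]. What is left, at least [l - 2 * r], explains the value 2 of [s]. *)
Lemma gram_perp_unit_vec m : gram_unit_vec m -> perp_unit_vec A 2 m.
Proof.
move=> un l q U le_l; have [r [C0 [G [R [le_r eU GR _]]]]] := saturation total U.
have [B rB BG] : exists2 B : 'M_l, (l - r <= \rank B)%N & B *m (G^p)^T = 0.
  by exists (kermx (G^p)^T); rewrite ?mulmx_ker // mxrank_ker leq_sub2l // rank_leq_col.
have [C] := @sym_minor _ _ (B *m B^T) (etrans (trmx_mul _ _) (congr1 (mulmx^~ _) (trmxK B))).
have rS : (m <= \rank (B *m B^T))%N.
  apply: leq_trans (mxrank_mul_min _ _); rewrite mxrank_tr.
  by move: (\rank B) rB => rk h; lia.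
move: (\rank _) rS C => t rS C uC.
have [|X eX XG] := @lift_ker _ _ _ G R (C *m B) GR; first by rewrite -mulmxA BG mulmx0.
have [|y hy] := un _ _ X rS.
  rewrite map_unitmx_pi map_mxM -map_trmx eX trmx_mul.
  by move: uC; rewrite !mulmxA.
exists (y *m X) => //.
by rewrite eU trmx_mul mulmxA -(mulmxA y) XG mulmx0 mul0mx.
Qed.

Lemma unit_vec_gram m : unit_vec_prop A m -> gram_unit_vec m.
Proof.
move=> uv t l X le_mt uS; set S := X *m X^T in uS.
pose V (x : 'rV[A]_l) := exists y : 'rV_t, x = y *m X.
have Xy (y : 'rV_t) : y *m X *m X^T *m invmx S = y by rewrite -(mulmxA y) -/S mulmxK.
have sV : submod V.
  split; first by exists 0; rewrite mul0mx.
  split=> [_ _ [y ->] [z ->]|a _ [y ->]]; first by exists (y + z); rewrite mulmxDl.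
  by exists (a *: y); rewrite scalemxAl.
have [|||v [[y ->] hq]] := uv l V; last by exists y; rewrite -qE_dot.
- split=> //; exists (fun z => z *m X^T = 0); split.
    split; first by rewrite mul0mx.
    split=> [x y hx hy|a x hx]; first by rewrite mulmxDl hx hy addr0.
    by rewrite -scalemxAl hx scaler0.
  split=> [_ [y ->] h|z]; first by rewrite -(Xy y) h mul0mx mul0mx.
  exists (z *m X^T *m invmx S *m X), (z - z *m X^T *m invmx S *m X); split.
    by exists (z *m X^T *m invmx S).
  by rewrite mulmxBl -(mulmxA _ X) -/S mulmxKV // subrr addrC subrK.
- move=> phi phiD phiZ.
  pose f : 'rV[A]_t := \row_i phi (row i X).
  have phiE (y : 'rV_t) : phi (y *m X) = (y *m f^T) 0 0.
    rewrite mulmx_sum_row mxE.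
    have phi0 : phi 0 = 0 by rewrite -(scale0r (0 : 'rV_l)) phiZ ?mul0r //; exists 0; rewrite mul0mx.
    suff [_ ->] : V (\sum_i y 0 i *: row i X) /\
       phi (\sum_i y 0 i *: row i X) = \sum_i y 0 i * f^T i 0 by [].
    elim/big_rec2: _ => [|i a x _ [Vx ex]]; first by split=> //; exact: sV.1.
    have Vi : V (row i X) by exists (delta_mx 0 i); rewrite rowE.
    have Vyi : V (y 0 i *: row i X) by apply: sV.2.2.
    by split; [exact: sV.2.1|rewrite phiD // phiZ // ex !mxE].
  have bEE (x z : 'rV[A]_l) : bE x z = 2%:R * dot x z.
    by rewrite /bE !qE_dot dotDl !dotDr (dotC z x); ring.
  (* The polar form is twice the dot product, whence the factor 1/2 in the vector representing
     [phi]. *)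
  exists ((2%:R^-1 *: f *m invmx S) *m X); split=> [|x' [[y' ->] h]].
    split; first by eexists.
    move=> _ [y ->]; rewrite bEE phiE /dot trmx_mul mulmxA -(mulmxA _ X) -/S mulmxKV //.
    by rewrite -scalemxAl mxE mulVKr // -[f *m y^T]trmxK trmx_mul trmxK mxE.
  suff -> : y' = 2%:R^-1 *: f *m invmx S by [].
  rewrite -(Xy y') -(mulmxA y') -/S; congr (_ *m _); apply/rowP => i.
  have Vi : V (row i X) by exists (delta_mx 0 i); rewrite rowE.
  have := h _ Vi; rewrite bEE dot_row -mulmxA -/S => e.
  by rewrite !mxE -e mulKr // mxE.
- exists (fun j => row (widen_ord le_mt j) X); split.
    by move=> j; exists (delta_mx 0 (widen_ord le_mt j)); rewrite rowE.
  move=> a [p [b [u [hb e]]]] j.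
  have [y hy] : exists y : 'I_p -> 'rV[A]_t, forall i, u i = y i *m X.
    by apply: (@fin_all_exists _ _ (fun i y => u i = y *m X)) => i; case: (hb i) => _ [y]; exists y.
  pose a' : 'rV[A]_t := \sum_j a j *: delta_mx 0 (widen_ord le_mt j).
  have ea : a' *m X = (\sum_i b i *: y i) *m X.
    rewrite !mulmx_suml; under eq_bigr do rewrite -scalemxAl -rowE.
    by rewrite e; apply: eq_bigr => i _; rewrite hy scalemxAl.
  have {}ea : a' = \sum_i b i *: y i by rewrite -(Xy a') ea Xy.
  have : a' 0 (widen_ord le_mt j) = a j.
    rewrite summxE (bigD1 j) //= !mxE !eqxx mulr1 big1 ?addr0 // => i ij.
    by rewrite !mxE eqxx /= -val_eqE /= eq_sym val_eqE (negbTE ij) mulr0.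
  rewrite /maxid pi_unit negbK => <-; rewrite ea summxE rmorph_sum big1 // => i _.
  have [hbi _] := hb i; rewrite mxE rmorphM.
  by move: hbi; rewrite /maxid pi_unit negbK => /eqP ->; rewrite mul0r.
Qed.
End Residue.

(** * Descent from the quotient field to the valuation ring *)

Section Integrality.
Variables (A : idomainType) (K : fieldType) (iota : {rmorphism A -> K}).
Hypothesis valA : valuation_ring iota.
Hypothesis unit2 : (2%:R : A) \is a GRing.unit.
Hypothesis loc : forall a b : A, a + b \is a GRing.unit ->
  (a \is a GRing.unit) || (b \is a GRing.unit).

Lemma val_total (a b : A) : (exists c, b = c * a) \/ (exists c, a = c * b).
Proof.
have [inj [_ hv]] := valA.
have [->|a0] := eqVneq a 0; first by right; exists 0; rewrite mul0r.
have [->|b0] := eqVneq b 0; first by left; exists 0; rewrite mul0r.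
have ia : iota a != 0 by rewrite -(rmorph0 iota) (inj_eq inj).
have ib : iota b != 0 by rewrite -(rmorph0 iota) (inj_eq inj).
have [|[c e]|[c e]] := hv (iota b / iota a); first by rewrite mulf_neq0 ?invr_neq0.
  by left; exists c; apply: inj; rewrite rmorphM -e divfK.
by right; exists c; apply: inj; rewrite rmorphM -e invf_div divfK.
Qed.

Section Form.
Variables (t : nat) (S : 'M[A]_t) (u : A).
Hypotheses (sS : S^T = S) (uS : S \in unitmx).
Definition bS (x y : 'rV[A]_t) : A := (x *m S *m y^T) 0 0.
Lemma bSC x y : bS x y = bS y x.
Proof.
rewrite /bS -[x *m S *m y^T]trmxK [LHS]mxE !trmx_mul trmxK sS.
by rewrite mulmxA.
Qed.
Lemma bSDl x y z : bS (x + y) z = bS x z + bS y z.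
Proof. by rewrite /bS !mulmxDl mxE. Qed.
Lemma bSZl c x z : bS (c *: x) z = c * bS x z.
Proof. by rewrite /bS -!scalemxAl mxE. Qed.
Lemma bSDr x y z : bS z (x + y) = bS z x + bS z y.
Proof. by rewrite bSC bSDl !(bSC z). Qed.
Lemma bSZr c x z : bS z (c *: x) = c * bS z x.
Proof. by rewrite bSC bSZl bSC. Qed.

(* Explicit point on the quadric [q = u]: reflecting the solution [v0 / d] in
   [v0 + d w], where [B(v0, w) = 1], makes it integral. *)
Lemma integral_point_prim (v0 : 'rV[A]_t) (d : A) j : v0 0 j = 1 -> bS v0 v0 = d ^+ 2 * u ->
  exists y, bS y y = u.
Proof.
move=> v0j q0; have [ud|nud] := boolP (d \is a GRing.unit).
  by exists (d^-1 *: v0); rewrite bSZl bSZr q0 expr2 -!mulrA !mulKr.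
have [w bw] : exists w, bS v0 w = 2%:R^-1.
  exists (2%:R^-1 *: (delta_mx 0 j *m invmx S)).
  by rewrite bSC bSZl /bS mulmxKV // -rowE !mxE v0j mulr1.
(* The value of [bS] on [v0 + d w] is [d * D]. The factor [d] cancels when [v0 / d] is reflected,
   which leaves the coefficients [a / D] and [b / D]; [D] is a unit because [d] is not. *)
pose c := bS w w; pose D := 1 + d * u + d * c.
have uD : D \is a GRing.unit.
  have /orP[//|] : (D \is a GRing.unit) || (- (d * (u + c)) \is a GRing.unit).
    by apply: loc; have -> : D + - (d * (u + c)) = 1 by [rewrite /D; ring]; rewrite unitr1.
  by rewrite unitrN unitrM (negbTE nud).
pose a := c - u; pose b := - (2%:R * d * u + 1).
exists (D^-1 *: (a *: v0 + b *: w)); rewrite bSZl bSZr.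
have -> : bS (a *: v0 + b *: w) (a *: v0 + b *: w) = D * (D * u).
  rewrite bSDl !bSDr !bSZl !bSZr q0 (bSC w v0) bw -/c.
  transitivity (a ^+ 2 * d ^+ 2 * u + a * b * (2%:R * 2%:R^-1) + b ^+ 2 * c); first by ring.
  by rewrite divrr // /a /b /D; ring.
by rewrite !mulKr.
Qed.
End Form.

Lemma integral_point t (S : 'M[A]_t) (u : A) (y : 'rV[K]_t) : S^T = S -> S \in unitmx ->
  (y *m map_mx iota S *m y^T) 0 0 = iota u ->
  exists y' : 'rV[A]_t, bS S y' y' = u.
Proof.
move=> sS uS hy; have [inj [frac _]] := valA.
have [ab hab] : exists ab : 'I_t -> A * A, forall i, (ab i).2 != 0 /\ y 0 i = iota (ab i).1 / iota (ab i).2.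
  apply: (@fin_all_exists _ _ (fun i ab => ab.2 != 0 /\ y 0 i = iota ab.1 / iota ab.2)) => i.
  by have [a [b hb]] := frac (y 0 i); exists (a, b).
pose d := \prod_i (ab i).2; pose x : 'rV[A]_t := \row_i ((ab i).1 * \prod_(j | j != i) (ab j).2).
have d0 : d != 0 by apply/prodf_neq0 => i _; case: (hab i).
have ex : map_mx iota x = iota d *: y.
  apply/rowP => i; rewrite !mxE; have [b0 ->] := hab i.
  have ib : iota (ab i).2 != 0 by rewrite -(rmorph0 iota) (inj_eq inj).
  have ed : d = (ab i).2 * \prod_(j | j != i) (ab j).2 by rewrite /d (bigD1 i).
  rewrite ed (rmorphM iota) (rmorphM iota (ab i).2).
  by field.
have qx : bS S x x = d ^+ 2 * u.
  apply: inj; rewrite rmorphM rmorphXn -hy.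
  transitivity ((map_mx iota x *m map_mx iota S *m (map_mx iota x)^T) 0 0).
    by rewrite map_trmx -!map_mxM mxE.
  by rewrite ex linearZ /= -!scalemxAl -scalemxAr scalerA mxE expr2.
(* The common denominator and the numerators are divided by one of them that divides all. If it is
   the denominator, the point is already integral; otherwise some coordinate becomes 1. *)
clearbody x; pose s := d :: [seq x 0 i | i : 'I_t].
have [|z zs hz] := min_dvd val_total (s := s); first by [].
have z0 : z != 0.
  by apply: contraNneq d0 => e; have [|c ->] := hz d; rewrite ?mem_head // e mulr0.
have [f hf] : exists f : 'I_t -> A, forall i, x 0 i = f i * z.
  apply: (@fin_all_exists _ _ (fun i c => x 0 i = c * z)) => i; apply: hz.
  by rewrite in_cons; apply/orP; right; apply: map_f; rewrite mem_enum.
pose v0 : 'rV[A]_t := \row_i f i.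
have exz : x = z *: v0 by apply/rowP => i; rewrite !mxE hf mulrC.
have zz : z ^+ 2 != 0 by rewrite expf_neq0.
have [c ed] := hz d (mem_head _ _).
have q0 : bS S v0 v0 = c ^+ 2 * u.
  by apply: (mulfI zz); rewrite mulrA -exprMn mulrC -[z * c]mulrC -ed -qx exz (bSZl S) (bSZr sS); ring.
move: zs; rewrite in_cons => /orP[/eqP ezd|/mapP[j _ ezj]].
  exists v0; rewrite q0 (_ : c = 1) ?expr1n ?mul1r //.
  by apply: (mulIf z0); rewrite -ed mul1r.
apply: (integral_point_prim sS uS _ q0 (j := j)).
by rewrite mxE; apply: (mulIf z0); rewrite mul1r -hf.
Qed.

Lemma gram_unit_vec_field m : gram_unit_vec K m -> gram_unit_vec A m.
Proof.
move=> un t l X le_mt uX; have [inj _] := valA.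
have [|y hy] := un t l (map_mx iota X) le_mt.
  by rewrite map_trmx -map_mxM unitmxE det_map_mx unitfE -(rmorph0 iota) (inj_eq inj);
     apply: contraTneq uX; rewrite unitmxE => ->; rewrite unitr0.
have [||y' hy'] := @integral_point t (X *m X^T) 1 y _ uX.
- by rewrite trmx_mul trmxK.
- by rewrite rmorph1 -hy /dot trmx_mul map_mxM -map_trmx !mulmxA.
by exists y'; rewrite -hy' /dot /bS trmx_mul !mulmxA.
Qed.

(** The identity form as a case of [integral_point]: a bound on the number of squares in [K]
    descends to [A]. *)
Lemma sum_sq_integral p (x : A) : sum_sq p (iota x) -> sum_sq p x.
Proof.
case=> v hv; have [|||y' hy'] := @integral_point p 1%:M x (\row_i v i).
- by rewrite trmx1.
- exact: unitmx1.
- rewrite map_mx1 mulmx1 hv mxE; apply: eq_bigr => i _.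
  by rewrite !mxE expr2.
exists (fun i => y' 0 i); rewrite -hy' /bS mulmx1 mxE; apply: eq_bigr => i _.
by rewrite !mxE expr2.
Qed.
End Integrality.

(** * Pythagoras numbers *)

Section SumsOfSquares.
Variable A : comUnitRingType.
Implicit Types x y : A.

Lemma is_sosP x : is_sos x <-> exists s : seq A, x = \sum_(a <- s) a ^+ 2.
Proof.
split=> [[p [v ->]]|[s ->]].
  by exists [seq v j | j <- index_enum 'I_p]; rewrite big_map.
exists (size s), (fun j => s`_j).
by rewrite (big_nth 0) big_mkord.
Qed.

Lemma sos_add x y : is_sos x -> is_sos y -> is_sos (x + y).
Proof.
move=> /is_sosP[s ->] /is_sosP[t ->]; apply/is_sosP.
by exists (s ++ t); rewrite big_cat.
Qed.
Lemma sos_sq x : is_sos (x ^+ 2).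
Proof. by apply/is_sosP; exists [:: x]; rewrite big_seq1. Qed.
Lemma sos0 : is_sos (0 : A).
Proof. by apply/is_sosP; exists [::]; rewrite big_nil. Qed.
Lemma sos_sqM x y : is_sos y -> is_sos (x ^+ 2 * y).
Proof.
move=> /is_sosP[s ->]; apply/is_sosP; exists [seq x * a | a <- s].
by rewrite big_map mulr_sumr; apply: eq_bigr => a _; rewrite exprMn.
Qed.
Lemma sos_mul x y : is_sos x -> is_sos y -> is_sos (x * y).
Proof.
move=> /is_sosP[s ->] hy; rewrite mulr_suml.
by elim/big_rec: _ => [|a z _ hz]; [exact: sos0|apply: sos_add => //; exact: sos_sqM].
Qed.
Lemma sos_nat n : is_sos (n%:R : A).
Proof.
elim: n => [|n IH]; first exact: sos0.
by rewrite -natr1; apply: sos_add => //; rewrite -(expr1n _ 2); exact: sos_sq.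
Qed.
Lemma sos_dot n (v : 'rV[A]_n) : is_sos (dot v v).
Proof.
rewrite dotE; elim/big_rec: _ => [|i z _ hz]; first exact: sos0.
by apply: sos_add => //; rewrite -expr2; exact: sos_sq.
Qed.
End SumsOfSquares.

(** * Anisotropic and transverse vectors over a field *)

Section Linear.
Variable F : fieldType.

Lemma row_free_col1 r l (v : 'rV[F]_l) (H : 'M[F]_(r, l)) : row_free H ->
  row_free (col_mx v H) = ~~ (v <= H)%MS.
Proof.
move=> fH; rewrite -row_leq_rank -addsmxE; have rH : \rank H = r by apply/eqP.
have [vH|nvH] := boolP (v <= H)%MS.
  have /mxrankS : (v + H <= H)%MS by rewrite addsmx_sub vH submx_refl.
  by rewrite rH leqNgt add1n => /negbTE.
rewrite add1n -{1}rH; apply: rank_ltmx; rewrite ltmxE addsmxSr /=.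
by apply: contra nvH; apply: submx_trans (addsmxSl _ _).
Qed.

(** A subspace of more than half the dimension cannot be totally isotropic. *)
Lemma anisotropic_vector l m (B : 'M[F]_(m, l)) : (2%:R : F) != 0 -> (l < 2 * \rank B)%N ->
  exists2 h : 'rV_l, (h <= B)%MS & dot h h != 0.
Proof.
move=> c2 ltl; have S0 : B *m B^T != 0.
  rewrite -mxrank_eq0 -lt0n; apply: leq_trans (mxrank_mul_min _ _).
  by rewrite mxrank_tr; move: (\rank B) ltl => rk h; lia.
have [i [j Sij]] : exists i j, (B *m B^T) i j != 0 by apply/matrix0Pn.
have eij i' j' : (B *m B^T) i' j' = dot (row i' B) (row j' B).
  by rewrite dot_row -row_mul [RHS]mxE.
rewrite eij in Sij.
have [qi|qi] := eqVneq (dot (row i B) (row i B)) 0; last by exists (row i B); rewrite ?row_sub.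
have [qj|qj] := eqVneq (dot (row j B) (row j B)) 0; last by exists (row j B); rewrite ?row_sub.
exists (row i B + row j B); first by rewrite addmx_sub ?row_sub.
rewrite dotDl !dotDr qi qj (dotC (row j B)) add0r addr0 -mulr2n -mulr_natl.
by rewrite mulf_neq0.
Qed.

(** The linear conditions give some [z1]. If it is isotropic, an anisotropic [h] orthogonal to [x],
    [y] and [H] helps: the norms of [z1 + h] and [z1 - h] add up to twice that of [h]. The
    complement of these [r + 2] vectors exceeds half the dimension once [2 * r + 5 <= l]. *)
Lemma transverse l r (H : 'M[F]_(r, l)) (x y : 'rV[F]_l) : (2%:R : F) != 0 ->
  row_free (col_mx x H) -> row_free (col_mx y H) -> (2 * r + 5 <= l)%N ->
  exists z : 'rV_l, [/\ z *m H^T = 0, dot z z != 0, dot x z != 0 & dot y z != 0].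
Proof.
move=> c2 fx fy le_l.
have ex v : row_free (col_mx v H) -> exists2 w : 'rV_l, w *m H^T = 0 & dot v w != 0.
  move=> fv; have : kermx H^T *m v^T != 0.
    apply/negP => /eqP e; have : kermx H^T *m (col_mx v H)^T = 0.
      by rewrite tr_col_mx mul_mx_row e mulmx_ker row_mx0.
    move/mulmx0_rank_max; rewrite mxrank_tr mxrank_ker mxrank_tr.
    by have := rank_leq_row H; move: fv; rewrite /row_free => /eqP ->; lia.
  case/matrix0Pn => i [j]; rewrite ord1 => h; exists (row i (kermx H^T)).
    by rewrite -row_mul mulmx_ker row0.
  by rewrite dotC /dot -row_mul mxE.
have [wx hx qx] := ex x fx; have [wy hy qy] := ex y fy.
have [z1 [h1 x1 y1]] : exists z : 'rV_l, [/\ z *m H^T = 0, dot x z != 0 & dot y z != 0].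
  have [e1|] := eqVneq (dot y wx) 0; last by exists wx.
  have [e2|] := eqVneq (dot x wy) 0; last by exists wy.
  by exists (wx + wy); rewrite mulmxDl hx hy !dotDr e1 e2 !add0r addr0.
have [q1|] := eqVneq (dot z1 z1) 0; last by exists z1.
pose T := col_mx (col_mx x y) H.
have [|h hB qh] := @anisotropic_vector l _ (kermx T^T) c2.
  by rewrite mxrank_ker mxrank_tr; have := rank_leq_row T; lia.
have hT : h *m T^T = 0 by apply/sub_kermxP.
move: hT; rewrite /T !tr_col_mx !mul_mx_row => /eqP; rewrite !row_mx_eq0.
case/andP => /andP[/eqP hx0 /eqP hy0] /eqP hH.
have xh : dot x h = 0 by rewrite dotC /dot hx0 mxE.
have yh : dot y h = 0 by rewrite dotC /dot hy0 mxE.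
have [e|ne] := eqVneq (dot (z1 + h) (z1 + h)) 0; last first.
  exists (z1 + h); split=> //; first by rewrite mulmxDl h1 hH addr0.
    by rewrite dotDr xh addr0.
  by rewrite dotDr yh addr0.
exists (z1 - h); split; [by rewrite mulmxBl h1 hH subr0| |by rewrite dotBr xh subr0|by rewrite dotBr yh subr0].
apply: contra c2 => /eqP e'; move: e e'.
rewrite !dotDl !dotDr !dotNl !dotNr q1 (dotC h z1) => e e'.
have E := congr2 +%R e e'; rewrite addr0 in E.
have : 2%:R * dot h h = 0 by rewrite -[RHS]E; ring.
by move/eqP; rewrite mulf_eq0 (negbTE qh) orbF.
Qed.
End Linear.

(** * Witt extension and compression into few coordinates *)

Section Compression.
Variables (A : idomainType) (k : fieldType) (pi : {rmorphism A -> k}).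
Hypothesis resP : residue_field pi.
Hypothesis unit2 : (2%:R : A) \is a GRing.unit.
Local Notation "M ^p" := (map_mx pi M) (at level 2, format "M ^p").
Let loc := residue_loc resP.
Let c2 : (2%:R : k) != 0 := res2 resP unit2.

Lemma pi_dot l (x y : 'rV[A]_l) : pi (dot x y) = dot x^p y^p.
Proof. by rewrite /dot map_trmx -map_mxM [RHS]mxE. Qed.

Lemma mulmx_refl_fix r l (H : 'M[A]_(r, l)) z : z *m H^T = 0 -> H *m refl z = H.
Proof.
move=> h; have h' : H *m z^T = 0 by rewrite -[H]trmxK -trmx_mul h trmx0.
by rewrite /refl mulmxBr mulmx1 -scalemxAr mulmxA h' mul0mx scaler0 subr0.
Qed.

(** If [x - y] has non-unit norm, [y] is first reflected in a [z] orthogonal to [H]. This adds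
    [4 (x.z)(y.z) / (z.z)] to the norm, a unit for transverse [z]. *)
Lemma witt r l (H : 'M[A]_(r, l)) (RH : 'M[A]_(l, r)) (x y : 'rV[A]_l) :
  H *m RH = 1%:M -> (2 * r + 5 <= l)%N ->
  row_free (col_mx x H)^p -> row_free (col_mx y H)^p ->
  x *m H^T = y *m H^T -> dot x x = dot y y ->
  exists g : ortho A l, H *m g = H /\ x *m g = y.
Proof.
move=> HR le_l fx fy exy qxy.
have hxy : (x - y) *m H^T = 0 by rewrite mulmxBl exy subrr.
have [u|nu] := boolP (dot (x - y) (x - y) \is a GRing.unit).
  by exists (orefl u); split; [exact: mulmx_refl_fix|exact: refl_swap].
rewrite !map_col_mx in fx fy.
have [zb [zH qz xz yz]] := transverse c2 fx fy le_l.
have [z ez hz] := lift_ker resP HR zH.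
have uz : dot z z \is a GRing.unit by rewrite (pi_unit resP) pi_dot ez.
have ux : dot x z \is a GRing.unit by rewrite (pi_unit resP) pi_dot ez.
have uy : dot y z \is a GRing.unit by rewrite (pi_unit resP) pi_dot ez.
pose y' := y *m refl z.
have ey' : y' = y - (2%:R * dot y z / dot z z) *: z by rewrite /y' mul_refl.
have qy' : dot y' y' = dot y y by exact: (dot_ortho (orefl uz)).
have y'z : y' *m refl z = y by rewrite /y' -mulmxA refl_refl // mulmx1.
have hxy' : (x - y') *m H^T = 0.
  by rewrite ey' !mulmxBl -scalemxAl hz scaler0 subr0 exy subrr.
have u' : dot (x - y') (x - y') \is a GRing.unit.
  have e : dot (x - y') (x - y') =
      dot (x - y) (x - y) + 2%:R * 2%:R * dot x z * dot y z / dot z z.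
    rewrite !dotBl !dotBr qy' (dotC y' x) (dotC y x) ey' dotBr dotZr.
    by ring.
  rewrite e (pi_unit resP) rmorphD; move: nu; rewrite (pi_unit resP) negbK => /eqP->.
  by rewrite add0r -(pi_unit resP) !unitrM unitrV unit2 ux uy uz.
exists (orefl u' * orefl uz)%g; rewrite ovalM /= !mulmxA; split.
  by rewrite !mulmx_refl_fix.
by rewrite (@refl_swap _ _ x y') // qy'.
Qed.

Variable p : nat.
Hypothesis p_gt1 : (1 < p)%N.
Hypothesis sosA : forall x : A, is_sos x -> sum_sq p x.

Lemma pid_sym (R : pzSemiRingType) l L : (pid_mx L : 'M[R]_l)^T = pid_mx L.
Proof. by rewrite tr_pid_mx. Qed.
Lemma pid_idem (R : pzSemiRingType) l L L' : (L <= L')%N ->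
  (pid_mx L : 'M[R]_l) *m (pid_mx L' : 'M_l) = pid_mx L.
Proof.
by move=> h; rewrite mul_pid_mx; apply/matrixP => i j; rewrite !mxE; congr (_%:R);
  have := ltn_ord i; have := ltn_ord j; case: eqP => //= _; lia.
Qed.

(* Take [y = c ^+ 2 / D] with [D = b ^+ 2 + c ^+ 2 * g + t]; as [D] changes by 1
   from [t = 2] to [t = 3], it is a unit for one of these two values. *)
Lemma sos_residual (c b g : A) : is_sos g ->
  exists y, y \is a GRing.unit = (c \is a GRing.unit) /\
            is_sos (c ^+ 2 - y * b - y ^+ 2 * g).
Proof.
move=> sg.
pose E t : A := b ^+ 2 + c ^+ 2 * g + t%:R.
have [t [t2 uE]] : exists t, (2 <= t)%N /\ E t \is a GRing.unit.
  have /loc/orP[h|h] : E 3 + - E 2 \is a GRing.unit.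
  - by have -> : E 3 + - E 2 = 1 by [rewrite /E; ring]; rewrite unitr1.
  - by exists 3.
  - by exists 2; rewrite -unitrN.
pose D := E t; exists (c ^+ 2 / D); split.
  by rewrite unitrM unitrV uE andbT unitrX_pos.
pose h : A := 2%:R^-1.
have hh : 2%:R * h = 1 by rewrite divrr.
have sD : is_sos D.
  by apply: sos_add; [apply: sos_add; [exact: sos_sq|exact: sos_sqM]|exact: sos_nat].
(* This is [(b - 1/2)^2 + 3/4 + (t - 2)], a sum of squares as soon as [t] is at least 2. *)
have e1 : b ^+ 2 - b + t%:R - 1 = (b - h) ^+ 2 + (h ^+ 2 * 3%:R + (t - 2)%:R).
  have -> : t%:R = (t - 2)%:R + (2%:R * h) * (2%:R * h) * 2%:R :> A.
    by rewrite hh !mul1r -natrD subnK.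
  transitivity (b ^+ 2 - b * (2%:R * h) + (t - 2)%:R + 2%:R * h * (2%:R * h) * 2%:R
    - (2%:R * h) * (2%:R * h)); first by rewrite hh; ring.
  by ring.
have s1 : is_sos (b ^+ 2 - b + t%:R - 1).
  rewrite e1; apply: sos_add; first exact: sos_sq.
  by apply: sos_add; [apply: sos_sqM|]; exact: sos_nat.
(* After the factor [(c / D)^2] is taken out, [D^2 - b D - c^2 g] remains; splitting it as
   [D (D - b - 1) + (D - c^2 g)] exhibits sums of squares. *)
have -> : c ^+ 2 - c ^+ 2 / D * b - (c ^+ 2 / D) ^+ 2 * g =
    (c / D) ^+ 2 * (D * (b ^+ 2 - b + t%:R - 1) + D * (c ^+ 2 * g) + (b ^+ 2 + t%:R)).
  have -> : D * (b ^+ 2 - b + t%:R - 1) + D * (c ^+ 2 * g) + (b ^+ 2 + t%:R) =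
      D ^+ 2 - b * D - c ^+ 2 * g by rewrite /D /E; ring.
  transitivity (c ^+ 2 * (D * D^-1) ^+ 2 - c ^+ 2 * D^-1 * b * (D * D^-1) - (c ^+ 2 * D^-1) ^+ 2 * g).
    by rewrite divrr // expr1n !mulr1.
  by ring.
apply: sos_sqM; apply: sos_add; last by apply: sos_add; [exact: sos_sq|exact: sos_nat].
apply: sos_add; first exact: sos_mul.
by apply: sos_mul => //; exact: sos_sqM.
Qed.

Lemma dot_split l L (x : 'rV[A]_l) :
  let a := x *m (pid_mx L : 'M_l) in dot x x = dot a a + dot (x - a) (x - a).
Proof.
move=> a; have e : dot a x = dot a a.
  by rewrite /a [RHS]dot_mulr pid_sym -mulmxA pid_idem // dot_mulr pid_sym.
by rewrite !dotBl !dotBr (dotC x a) e; ring.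
Qed.

(** The vectors supported on the first [L] coordinates and orthogonal to [H] have dimension at least
    [L - r], more than the row space of [H]. *)
Lemma free_outside r l (H : 'M[k]_(r, l)) (L : nat) : (2 * r < L)%N -> (L <= l)%N ->
  exists w : 'rV_l, [/\ w *m H^T = 0, w *m pid_mx L = w & ~~ (w <= H)%MS].
Proof.
move=> lt_L le_L; pose W := (kermx H^T :&: (pid_mx L : 'M_l))%MS.
have : ~~ (W <= H)%MS.
  apply/negP => /mxrankS; have := mxrank_sum_cap (kermx H^T) (pid_mx L : 'M[k]_l).
  have := rank_leq_col (kermx H^T + (pid_mx L : 'M[k]_l))%MS.
  rewrite mxrank_ker mxrank_tr rank_pid_mx //.
  by have := rank_leq_row H; rewrite -/W; lia.
case/row_subPn => i hi; exists (row i W); split => //.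
  by apply/sub_kermxP; apply: submx_trans (row_sub i W) (capmxSl _ _).
have /submxP[D ->] : (row i W <= (pid_mx L : 'M_l))%MS.
  exact: submx_trans (row_sub i W) (capmxSr _ _).
by rewrite -mulmxA pid_idem.
Qed.

(** The part of [x] beyond [L] is replaced by [p] new coordinates with the same sum of squares;
    [witt] then carries [x] to the new vector. The first [L] coordinates alone must stay independent
    of [H] over [k], so they may first be shifted by a multiple of some [h]. *)
Lemma compress_step r l (H : 'M[A]_(r, l)) (RH : 'M[A]_(l, r)) (x : 'rV[A]_l) (L : nat) :
  H *m RH = 1%:M -> (2 * r < L)%N -> (L + p <= l)%N -> (2 * r + 5 <= l)%N ->
  H *m pid_mx L = H -> row_free (col_mx x H)^p ->
  exists g : ortho A l, H *m g = H /\ x *m g *m pid_mx (L + p) = x *m g.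
Proof.
move=> HR lt_L le_l le_l' HL fx.
have fH : row_free H^p by apply/row_freeP; exists RH^p; rewrite -map_mxM HR map_mx1.
set a := x *m (pid_mx L : 'M_l); set b := x - a.
have aL : a *m pid_mx L = a by rewrite /a -mulmxA pid_idem.
have aH : a *m H^T = x *m H^T by rewrite /a -mulmxA -[pid_mx L]pid_sym -trmx_mul HL.
have [a' [a'L a'H fa' sa']] : exists a', [/\ a' *m pid_mx L = a', a' *m H^T = x *m H^T,
    row_free (col_mx a' H)^p & is_sos (dot x x - dot a' a')].
  have exx : dot x x = dot a a + dot b b by exact: dot_split.
  have [fa|nfa] := boolP (row_free (col_mx a H)^p).
    by exists a; split => //; rewrite exx addrAC subrr add0r; exact: sos_dot.
  rewrite map_col_mx row_free_col1 // negbK in nfa.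
  have b0 : b^p != 0.
    apply: contraL fx => /eqP e; rewrite map_col_mx row_free_col1 // negbK.
    by move: e; rewrite map_mxB => /eqP; rewrite subr_eq0 => /eqP ->.
  have [i0 [j]] : exists i j, b^p i j != 0 by apply/matrix0Pn.
  (* Since [x] is independent of [H] but [a] is not, [b] has a unit entry [c]. Its square is what
     [sos_residual] trades for a shift by [y *: h] with [y] a unit. *)
  rewrite ord1 mxE -(pi_unit resP) => uc; set c := b 0 j in uc.
  have sb : is_sos (dot b b - c ^+ 2).
    rewrite dotE (bigD1 j) //= -expr2 addrAC subrr add0r.
    elim/big_rec: _ => [|i z _ hz]; first exact: sos0.
    by apply: sos_add => //; rewrite -expr2; exact: sos_sq.
  have [|w [wH wL nw]] := @free_outside r l H^p L lt_L; first by lia.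
  have [||h [eh hH hL]] := lift_ker_supp resP HR HL (pid_sym _ _ _) _ wH; first exact: pid_idem.
    by rewrite map_pid_mx.
  have [y [uy sy]] := sos_residual c (2%:R * dot a h) (sos_dot h).
  rewrite uc in uy; exists (a + y *: h); split.
  - by rewrite mulmxDl aL -scalemxAl hL.
  - by rewrite mulmxDl aH -scalemxAl hH scaler0 addr0.
  - rewrite map_col_mx row_free_col1 //; apply: contra nw => ha.
    have : ((y *: h)^p <= H^p)%MS.
      by rewrite -(addrK a^p (y *: h)^p) -map_mxD addrC addmx_sub ?eqmx_opp // addrC.
    by rewrite map_mxZ eh eqmx_scale // -(pi_unit resP).
  - have -> : dot x x - dot (a + y *: h) (a + y *: h) =
      (dot b b - c ^+ 2) + (c ^+ 2 - y * (2%:R * dot a h) - y ^+ 2 * dot h h).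
      by rewrite exx !dotDl !dotDr !dotZl !dotZr (dotC h a); ring.
    exact: sos_add.
have [v ev] := sosA sa'; pose z : 'rV[A]_p := \row_i v i.
have qz : dot z z = dot x x - dot a' a'.
  by rewrite ev dotE; apply: eq_bigr => i _; rewrite !mxE expr2.
(* Embeds [A^p] as the coordinates from [L] to [L + p - 1]. *)
pose Q : 'M[A]_(p, l) := \matrix_(i, j) (j == L + i :> nat)%N%:R.
have QQ : Q *m Q^T = 1%:M.
  apply/matrixP => i j; rewrite !mxE.
  have hi : (L + i < l)%N by have := ltn_ord i; lia.
  rewrite (bigD1 (Ordinal hi)) //= !mxE eqxx mul1r big1 ?addr0 => [|t /negbTE nt].
    by rewrite /= eqn_add2l val_eqE.
  by rewrite !mxE; move: nt; rewrite -val_eqE /= => ->; rewrite mul0r.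
have QL : Q *m (pid_mx L : 'M_l) = 0.
  apply/matrixP => i j; rewrite !mxE big1 // => t _; rewrite !mxE.
  case: eqP => [e|_]; last by rewrite mul0r.
  by rewrite mul1r; case: eqP => //= _; rewrite e ltnNge leq_addr.
have QLp : Q *m pid_mx (L + p) = Q.
  apply/matrixP => i j; rewrite !mxE (bigD1 j) //= !mxE eqxx /=.
  rewrite big1 ?addr0 => [|t /negbTE nt]; last by rewrite !mxE val_eqE nt mulr0.
  by case: eqP => [->|_]; rewrite ?mul0r // ltn_add2l ltn_ord mulr1.
pose y := a' + z *m Q.
have QH : Q *m H^T = 0 by rewrite -HL trmx_mul pid_sym mulmxA QL mul0mx.
have yH : y *m H^T = x *m H^T by rewrite mulmxDl a'H -mulmxA QH mulmx0 addr0.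
have cross : dot a' (z *m Q) = 0.
  by rewrite -a'L dot_mulr pid_sym -mulmxA QL mulmx0 dot0r.
have qy : dot y y = dot x x.
  rewrite dotDl !dotDr cross (dotC _ a') cross dot_mulr -mulmxA QQ mulmx1 qz.
  by ring.
have yL : y *m pid_mx L = a' by rewrite mulmxDl a'L -mulmxA QL mulmx0 addr0.
have fy : row_free (col_mx y H)^p.
  rewrite -row_leq_rank; apply: leq_trans (mxrankM_maxl _ (pid_mx L : 'M[A]_l)^p).
  by rewrite -map_mxM mul_col_mx yL HL row_leq_rank.
have [g [Hg xg]] := witt HR le_l' fx fy (esym yH) (esym qy).
exists g; split=> //; rewrite xg /y mulmxDl -[_ *m Q *m _]mulmxA QLp.
by rewrite -{1}a'L -mulmxA pid_idem ?leq_addr // a'L.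
Qed.

(** With [2 <= p], the one coordinate beyond [r * p] keeps the support larger than [2 * r], as
    [free_outside] demands; the 4 leaves room for [2 * r + 5 <= l] in [witt]. *)
Lemma compress r l (G : 'M[A]_(r, l)) (R : 'M[A]_(l, r)) : G *m R = 1%:M ->
  (r * p + 4 <= l)%N -> exists g : ortho A l, G *m g *m pid_mx (r * p).+1 = G *m g.
Proof.
elim: r G R => [|r IH] G R GR le_l; first by exists 1%g; apply/matrixP => -[].
have le_p : (2 * r <= r * p)%N by rewrite mulnC leq_mul2l p_gt1 orbT.
rewrite mulSn in le_l.
pose x0 : 'rV_l := usubmx (G : 'M_(1 + r, l)); pose G0 : 'M_(r, l) := dsubmx (G : 'M_(1 + r, l)).
pose R0 : 'M_(l, r) := rsubmx (R : 'M_(l, 1 + r)).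
have eG : G = col_mx x0 G0 by rewrite vsubmxK.
have G0R0 : G0 *m R0 = 1%:M.
  pose Rl : 'M_(l, 1) := lsubmx (R : 'M_(l, 1 + r)).
  have eR : R = row_mx Rl R0 by rewrite hsubmxK.
  have E : col_mx x0 G0 *m row_mx Rl R0 = 1%:M by rewrite -eG -eR.
  by move: E; rewrite mul_col_row (scalar_mx_block 1 r) => /eq_block_mx[].
have [|g0 hg0] := IH G0 R0 G0R0; first by lia.
have [||||||g1 [Hg1 xg1]] := @compress_step r l (G0 *m g0) (g0^T *m R0) (x0 *m g0) (r * p).+1.
- by rewrite mulmxA -(mulmxA G0) ortho_tr' mulmx1.
- by lia.
- by lia.
- by lia.
- exact: hg0.
- rewrite -mul_col_mx -eG; apply/row_freeP; exists (g0^T *m R)^p.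
  by rewrite -map_mxM mulmxA -(mulmxA G) ortho_tr' mulmx1 GR map_mx1.
have E : (G : 'M_(1 + r, l)) *m g0 *m g1 = col_mx (x0 *m g0 *m g1) (G0 *m g0).
  by rewrite eG !mul_col_mx Hg1.
have F : col_mx (x0 *m g0 *m g1) (G0 *m g0) *m pid_mx (r.+1 * p).+1 =
    col_mx (x0 *m g0 *m g1) (G0 *m g0).
  have hG : G0 *m g0 *m pid_mx ((r * p).+1 + p) = G0 *m g0.
    by rewrite -hg0 -[LHS]mulmxA pid_idem // leq_addr.
  by rewrite mul_col_mx mulSn (addnC p) -addSn xg1 hG.
exists (g0 * g1)%g; have -> : G *m (g0 * g1)%g = col_mx (x0 *m g0 *m g1) (G0 *m g0).
  by rewrite ovalM mulmxA; exact: E.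
exact: F.
Qed.

Hypothesis total : forall a b : A, (exists c, b = c * a) \/ (exists c, a = c * b).

Lemma perp_unit_vec_sos : perp_unit_vec A p 4.
Proof.
move=> l q U le_l; have [r [C0 [G [R [le_r eU GR _]]]]] := saturation total U.
have le_rp : (r * p <= p * q)%N by rewrite mulnC leq_mul2l le_r orbT.
have [|g hg] := compress GR; first by lia.
have lt_l : (l.-1 < l)%N by lia.
pose j := Ordinal lt_l; exists (delta_mx 0 j *m g^T).
  rewrite -ovalV dot_ortho dotE (bigD1 j) //= big1 => [|i /negbTE ij]; rewrite !mxE ?eqxx.
    by rewrite mulr1 addr0.
  by rewrite ij mul0r.
rewrite eU trmx_mul mulmxA -(mulmxA _ g^T) -trmx_mul -hg trmx_mul pid_sym mulmxA.
suff -> : delta_mx 0 j *m pid_mx (r * p).+1 = 0 :> 'rV[A]_l by rewrite !mul0mx.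
apply/rowP => i; rewrite -rowE !mxE /= ltnNge (_ : (r * p).+1 <= l.-1)%N ?andbF //.
by lia.
Qed.
End Compression.

Lemma sum_sq_le (A : comUnitRingType) p q (x : A) : (p <= q)%N -> sum_sq p x -> sum_sq q x.
Proof.
move=> le_pq [v ->]; exists (fun j : 'I_q => if insub (j : nat) is Some i then v i else 0).
transitivity (\sum_(i < p) (if insub (i : nat) is Some i then v i else 0) ^+ 2).
  by apply: eq_bigr => i _; rewrite valK.
rewrite (big_ord_widen _ (fun j => (if insub j is Some i then v i else 0) ^+ 2) le_pq) big_mkcond /=.
apply: eq_bigr => i _; case: ifP => // nip.
by rewrite insubN ?nip // expr0n.
Qed.

Section ResidueField.
Variable F : fieldType.
(** A field is its own residue field, so the preceding results also apply over [k] and [K]. *)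
Lemma field_residue : residue_field (idfun : {rmorphism F -> F}).
Proof.
split=> [y|a]; first by exists y.
by rewrite /maxid unitfE negbK; split=> /eqP.
Qed.
Lemma field_total (a b : F) : (exists c, b = c * a) \/ (exists c, a = c * b).
Proof.
have [->|a0] := eqVneq a 0; first by right; exists 0; rewrite mul0r.
by left; exists (b / a); rewrite divfK.
Qed.
End ResidueField.

(** * Lifting unit vectors over a henselian ring *)

Section Hensel.
Variables (A : idomainType) (k : fieldType) (pi : {rmorphism A -> k}).
Hypothesis resP : residue_field pi.
Hypothesis unit2 : (2%:R : A) \is a GRing.unit.
Hypothesis total : forall a b : A, (exists c, b = c * a) \/ (exists c, a = c * b).
Hypothesis hens : henselian pi.

Lemma hensel_sqrt (u : A) : pi u = 1 -> exists a, a ^+ 2 = u /\ pi a = 1.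
Proof.
move=> pu; have [||a [ra pa]] := @hens ('X^2 - u%:P) 1.
- by rewrite /root rmorphB /= map_polyXn map_polyC /= pu !hornerE expr1n subrr.
- rewrite /root rmorphB /= map_polyXn map_polyC /= derivB derivXn derivC subr0.
  by rewrite !hornerE /= (res2 resP unit2).
exists a; split=> //; apply/eqP; rewrite -subr_eq0.
by move: ra; rewrite /root !hornerE.
Qed.

Lemma perp_unit_vec_hensel s c : perp_unit_vec k s c -> perp_unit_vec A s c.
Proof.
move=> core l q U le_l; have [r [C0 [G [R [le_r eU GR _]]]]] := saturation total U.
have le_sr : (s * r <= s * q)%N by rewrite leq_mul2l le_r orbT.
have [|v qv vG] := core l r (map_mx pi G); first by lia.
have [w ew wG] := lift_ker resP GR vG.
have [|a [ea pa]] := hensel_sqrt (u := dot w w); first by rewrite pi_dot ew.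
have ua : a \is a GRing.unit by rewrite (pi_unit resP) pa oner_neq0.
exists (a^-1 *: w).
  by rewrite dotZl dotZr -ea expr2 mulKr // mulVr.
by rewrite eU trmx_mul mulmxA -scalemxAl wG scaler0 mul0mx.
Qed.
End Hensel.

Lemma perp_unit_vec_pyth (A : idomainType) (k : fieldType) (pi : {rmorphism A -> k}) p :
  residue_field pi -> (2%:R : A) \is a GRing.unit ->
  (forall a b : A, (exists c, b = c * a) \/ (exists c, a = c * b)) ->
  (forall x : A, is_sos x -> sum_sq p x) -> perp_unit_vec A (maxn 2 p) 4.
Proof.
move=> resP unit2 total hp; apply: (perp_unit_vec_sos resP unit2 _ _ total); first exact: leq_maxl.
by move=> x /hp; apply: sum_sq_le; exact: leq_maxr.
Qed.

(** * The six stability ranges *)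

Theorem theorem3p10 (A : idomainType) (K : fieldType) (iota : {rmorphism A -> K})
  (k : fieldType) (pi : {rmorphism A -> k})
  (M : zmodType) (act : forall n : nat, 'M[A]_n -> M -> M) :
  valuation_ring iota -> residue_field pi -> (2%:R : A) \is a GRing.unit ->
  Oinf_module act -> comm_trivial act ->
  forall n i : nat,
  (* (i) *)
      (forall m, m_is A m ->
        ((i%:Z * 3 <= n%:Z - m%:Z - 2) -> stab_surj act n i) /\
        ((i%:Z * 3 <= n%:Z - m%:Z - 4) -> stab_iso act n i)) /\
      (* (ii) *)
      (henselian pi -> forall p, pyth_is k p ->
        ((i%:Z * (2 * p%:Z + 1) <= n%:Z - 2 * p%:Z - 2 * p%:Z - 2) -> stab_surj act n i) /\
        ((i%:Z * (2 * p%:Z + 1) <= n%:Z - 2 * p%:Z - 2 * p%:Z - 4) -> stab_iso act n i)) /\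
      (* (iii) *)
      (formally_real k -> henselian pi -> forall p, pyth_is k p ->
        ((i%:Z * (maxn 3 p.+1)%:Z <= n%:Z - p%:Z - (maxn 3 p.+1)%:Z) -> stab_surj act n i) /\
        ((i%:Z * (maxn 3 p.+1)%:Z <= n%:Z - p%:Z - 2 - (maxn 3 p.+1)%:Z) -> stab_iso act n i)) /\
      (* (iv) *)
      (forall m, m_is K m ->
        ((i%:Z * 3 <= n%:Z - m%:Z - 2) -> stab_surj act n i) /\
        ((i%:Z * 3 <= n%:Z - m%:Z - 4) -> stab_iso act n i)) /\
      (* (v) *)
      (forall p, pyth_is K p ->
        ((i%:Z * (2 * p%:Z + 1) <= n%:Z - 2 * p%:Z - 2 * p%:Z - 2) -> stab_surj act n i) /\
        ((i%:Z * (2 * p%:Z + 1) <= n%:Z - 2 * p%:Z - 2 * p%:Z - 4) -> stab_iso act n i)) /\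
      (* (vi) *)
      (formally_real K -> forall p, pyth_is K p ->
        ((i%:Z * (maxn 3 p.+1)%:Z <= n%:Z - p%:Z - (maxn 3 p.+1)%:Z) -> stab_surj act n i) /\
        ((i%:Z * (maxn 3 p.+1)%:Z <= n%:Z - p%:Z - 2 - (maxn 3 p.+1)%:Z) -> stab_iso act n i)).
Proof.
move=> valA resP unit2 actO actC n i.
have loc := residue_loc resP; have total := val_total valA.
have unit2K : (2%:R : K) \is a GRing.unit by rewrite -(rmorph_nat iota) rmorph_unit.
have unit2k : (2%:R : k) \is a GRing.unit by rewrite unitfE (res2 resP unit2).
have stab s c := @stability_perp_unit_vec A M act unit2 actO actC loc s c n i.
(* The stated ranges lie inside [3 i + m <= n + 1] and [3 i + 3 + m <= n + 1]. *)
have stab_m m : (1 <= m)%N -> perp_unit_vec A 2 m ->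
    ((i%:Z * 3 <= n%:Z - m%:Z - 2) -> stab_surj act n i) /\
    ((i%:Z * 3 <= n%:Z - m%:Z - 4) -> stab_iso act n i).
  by move=> m1 core; have [S I] := stab 2%N m isT m1 core; split=> h; [apply: S|apply: I]; lia.
have stab_p p : (1 <= p)%N -> perp_unit_vec A (maxn 2 p) 4 ->
    ((i%:Z * (maxn 3 p.+1)%:Z <= n%:Z - p%:Z - (maxn 3 p.+1)%:Z) -> stab_surj act n i) /\
    ((i%:Z * (maxn 3 p.+1)%:Z <= n%:Z - p%:Z - 2 - (maxn 3 p.+1)%:Z) -> stab_iso act n i).
  move=> p1 core; have [|S I] := stab (maxn 2 p) 4%N _ isT core; first exact: leq_maxl.
  have e : maxn 3 p.+1 = (maxn 2 p).+1 by rewrite maxnSS.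
  by rewrite e; split=> h; [apply: S|apply: I]; move: h; move: (maxn 2 p) (leq_maxl 2 p) => t; lia.
(* For [1 <= p] the slope [max(3, p + 1)] is at most [2 p + 1], so the ranges of (ii) and (v) lie
   inside those of (iii) and (vi). *)
have stab_2p p : (1 <= p)%N -> perp_unit_vec A (maxn 2 p) 4 ->
    ((i%:Z * (2 * p%:Z + 1) <= n%:Z - 2 * p%:Z - 2 * p%:Z - 2) -> stab_surj act n i) /\
    ((i%:Z * (2 * p%:Z + 1) <= n%:Z - 2 * p%:Z - 2 * p%:Z - 4) -> stab_iso act n i).
  move=> p1 core; have [S I] := stab_p p p1 core.
  have le_3p : (maxn 3 p.+1 <= 2 * p + 1)%N by lia.
  have le_i : (i * maxn 3 p.+1 <= i * (2 * p + 1))%N by rewrite leq_mul2l le_3p orbT.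
  by split=> h; [apply: S|apply: I]; move: h le_3p le_i; move: (maxn 3 p.+1) => t; lia.
(* A sum of squares in [A] needs only [p] squares over [K], hence over [A] by integrality, so
   compression runs over [A] itself. *)
have core_K p : pyth_is K p -> perp_unit_vec A (maxn 2 p) 4.
  move=> [_ [hp _]]; apply: (perp_unit_vec_pyth resP unit2 total) => x [q [v ev]].
  apply: (sum_sq_integral valA unit2 loc); apply: hp; exists q, (fun j => iota (v j)).
  by rewrite ev rmorph_sum; apply: eq_bigr => j _; rewrite rmorphXn.
have core_k p : henselian pi -> pyth_is k p -> perp_unit_vec A (maxn 2 p) 4.
  move=> hens [_ [hp _]]; apply: (perp_unit_vec_hensel resP unit2 total hens).
  exact: (perp_unit_vec_pyth (field_residue k) unit2k (@field_total k) hp).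
split; [|split; [|split; [|split; [|split]]]].
- move=> m [m1 [uv _]]; apply: stab_m => //.
  exact: (gram_perp_unit_vec resP unit2 total (unit_vec_gram resP unit2 uv)).
- by move=> hens p hp; apply: stab_2p; [case: hp|exact: core_k].
- by move=> _ hens p hp; apply: stab_p; [case: hp|exact: core_k].
- move=> m [m1 [uv _]]; apply: stab_m => //; apply: (gram_perp_unit_vec resP unit2 total).
  exact: (gram_unit_vec_field valA unit2 loc (unit_vec_gram (field_residue K) unit2K uv)).
- by move=> p hp; apply: stab_2p; [case: hp|exact: core_K].
- by move=> _ p hp; apply: stab_p; [case: hp|exact: core_K].
Qed.
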